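(* Fix $d\ge2$, $0<R_1<R_2$, the angular index $\ell\ge0$, and the branch index $p\ge1$. Let $k_{\ell,p}=k_{\ell,p}(\alpha_1,\alpha_2)$, $\alpha_1,\alpha_2>0$, be the $p$-th resonance, and let $k_{\ell,p}^{NN},k_{\ell,p}^{ND},k_{\ell,p}^{DN},k_{\ell,p}^{DD}$ denote the limiting values for the Neumann–Neumann, Neumann–Dirichlet, Dirichlet–Neumann and Dirichlet–Dirichlet problems, with normalised eigenfunctions $u^{NN}_{\ell,p}$, $u^{ND}_{\ell,p}$, $u^{DN}_{\ell,p}$, $u^{DD}_{\ell,p}$. Then: (i) as $(\alpha_1,\alpha_2)\to(0,0)$, provided $(\ell,p)\ne(0,1)$, $$k_{\ell,p}=k_{\ell,p}^{NN}+c_1\alpha_1+c_2\alpha_2+O(\alpha_1^2+\alpha_1\alpha_2+\alpha_2^2),\qquad c_i=\frac{R_i^{d-1}|u_{\ell,p}^{NN}(R_i)|^2}{2k_{\ell,p}^{NN}}>0;$$ (ii) as $(\alpha_1,\alpha_2)\to(0,\infty)$, $$k_{\ell,p}=k_{\ell,p}^{ND}+d_1\alpha_1+d_2\alpha_2^{-1}+O(\alpha_1^2+\alpha_1\alpha_2^{-1}+\alpha_2^{-2}),$$ $$d_1=\frac{R_1^{d-1}|u_{\ell,p}^{ND}(R_1)|^2}{2k_{\ell,p}^{ND}}>0,\qquad d_2=-\frac{R_2^{d-1}|\partial_ru_{\ell,p}^{ND}(R_2)|^2}{2k_{\ell,p}^{ND}}<0;$$ (iii) as $(\alpha_1,\alpha_2)\to(\infty,0)$,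 $$k_{\ell,p}=k_{\ell,p}^{DN}+e_1\alpha_1^{-1}+e_2\alpha_2+O(\alpha_1^{-2}+\alpha_1^{-1}\alpha_2+\alpha_2^{2}),$$ $$e_1=-\frac{R_1^{d-1}|\partial_ru_{\ell,p}^{DN}(R_1)|^2}{2k_{\ell,p}^{DN}}<0,\qquad e_2=\frac{R_2^{d-1}|u_{\ell,p}^{DN}(R_2)|^2}{2k_{\ell,p}^{DN}}>0;$$ (iv) as $(\alpha_1,\alpha_2)\to(\infty,\infty)$, writing $\mu_i=1/\alpha_i$, $$k_{\ell,p}=k_{\ell,p}^{DD}+f_1\mu_1+f_2\mu_2+g_{\ell,p}\,\mu_1\mu_2+O(\mu_1^2+\mu_2^2),\qquad f_i=-\frac{R_i^{d-1}|\partial_ru_{\ell,p}^{DD}(R_i)|^2}{2k_{\ell,p}^{DD}}<0,$$ where, with primes denoting $\partial_k$, $$g_{\ell,p}=-\frac1{\mathrm A_\ell'}\left[\mathrm D_\ell-\frac{\mathrm B_\ell\mathrm C_\ell'+\mathrm C_\ell\mathrm B_\ell'}{\mathrm A_\ell'}+\frac{\mathrm A_\ell''\,\mathrm B_\ell\,\mathrm C_\ell}{(\mathrm A_\ell')^2}\right]_{k=k_{\ell,p}^{DD}}.$$ The mixed coefficient $g_{\ell,p}$ is in general nonzero; for $d=3$, $R_1=1$, $R_2=2$ and the fundamental branch $p=1$ it evaluates to $g_{\ell,1}\approx6.28,\ 6.20,\ 5.96$ for $\ell=0,1,2$. For $d=3$ and the radial mode $\ell=0$ the closed form $g_{0,1}=2\pi/(R_2-R_1)^3$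 holds for every shell.
   Context: For $\alpha_1,\alpha_2>0$, $k_{\ell,1}<k_{\ell,2}<\cdots$ are the positive numbers $k$ such that $\lambda=k^2$ is an eigenvalue of $$u''+\frac{d-1}{r}u'+\Bigl(\lambda-\frac{\ell(\ell+d-2)}{r^2}\Bigr)u=0\ \text{ on }(R_1,R_2),\qquad -u'(R_1)+\alpha_1u(R_1)=0,\quad u'(R_2)+\alpha_2u(R_2)=0 .$$ The superscripts NN, ND, DN, DD refer to the same ODE with the Robin condition at the inner boundary $R_1$ (first letter) and at the outer boundary $R_2$ (second letter) replaced by the Neumann condition $u'=0$ (N) or the Dirichlet condition $u=0$ (D); $k^{XY}_{\ell,p}\ge0$ is the square root of the $p$-th eigenvalue in increasing order ($k^{NN}_{0,1}=0$, with constant eigenfunction, is counted as $p=1$), and $u^{XY}_{\ell,p}$ is its real eigenfunction normalised by $\int_{R_1}^{R_2}|u|^2r^{d-1}dr=1$. Let $\nu=d/2-1$, $\mu=\ell+\nu$ (not to be confused with $\mu_i=1/\alpha_i$), $L_i=\ell/R_i$, and $Z_{\mu,i}=Z_\mu(kR_i)$, $Z_{\mu+1,i}=Z_{\mu+1}(kR_i)$ for $Z\in\{J,Y\}$ (Bessel functions of first and second kind). Define the functions of $k$ $$\mathrm A_\ell=J_{\mu,1}Y_{\mu,2}-J_{\mu,2}Y_{\mu,1},$$ $$\mathrm B_\ell=L_2\bigl(J_{\mu,1}Y_{\mu,2}-J_{\mu,2}Y_{\mu,1}\bigr)+k\bigl(J_{\mu+1,2}Y_{\mu,1}-J_{\mu,1}Y_{\mu+1,2}\bigr),$$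 $$\mathrm C_\ell=-L_1\bigl(J_{\mu,1}Y_{\mu,2}-J_{\mu,2}Y_{\mu,1}\bigr)+k\bigl(J_{\mu+1,1}Y_{\mu,2}-J_{\mu,2}Y_{\mu+1,1}\bigr),$$ $$\mathrm D_\ell=\bigl(kJ_{\mu+1,1}-L_1J_{\mu,1}\bigr)\bigl(L_2Y_{\mu,2}-kY_{\mu+1,2}\bigr)-\bigl(L_2J_{\mu,2}-kJ_{\mu+1,2}\bigr)\bigl(kY_{\mu+1,1}-L_1Y_{\mu,1}\bigr).$$ For $k>0$ the eigenvalue condition is equivalent to $\mathrm A_\ell\alpha_1\alpha_2+\mathrm B_\ell\alpha_1+\mathrm C_\ell\alpha_2+\mathrm D_\ell=0$. *)

(* Defs.v *)
From Stdlib Require Export Reals Rprod Factorial List.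
From Coquelicot Require Export Coquelicot.
Export ListNotations.
Open Scope R_scope.

(* 1/Gamma(z), as the limit of Gauss's product; it is 0 at z = 0, -1, -2, ... *)
Definition rgamma (z : R) : R :=
  real (Lim_seq (fun n =>
    prod_f_R0 (fun j => z + INR j) n / (INR (fact n) * Rpower (INR n) z))).

(* Only meaningful for x > 0, because of the real power. *)
Definition besselJ (nu x : R) : R :=
  Rpower (x / 2) nu *
  Series (fun m =>
    (-1) ^ m / INR (fact m) * rgamma (nu + INR m + 1) * (x / 2) ^ (2 * m)).

Definition besselY_quotient (x nu : R) : R :=
  (besselJ nu x * cos (nu * PI) - besselJ (- nu) x) / sin (nu * PI).

(* At integer order the quotient is 0/0 and is replaced by its limit in the order. *)
Definition besselY (nu x : R) : R :=
  if Req_EM_T (sin (nu * PI)) 0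
  then real (Lim (besselY_quotient x) nu)
  else besselY_quotient x nu.

Inductive boundary_condition : Set :=
| Robin (alpha : R)
| Neumann
| Dirichlet.

(* [dn] is the outward normal derivative: -u' at R1, u' at R2. *)
Definition bc_holds (b : boundary_condition) (u dn : R) : Prop :=
  match b with
  | Robin alpha => dn + alpha * u = 0
  | Neumann => dn = 0
  | Dirichlet => u = 0
  end.

(* [du] is the derivative of [u] up to the boundary: u is C^1 on [R1, R2], so
   du R1 and du R2 are the one-sided derivatives at the end points. *)
Definition eigenfunction (d l : nat) (R1 R2 : R) (b1 b2 : boundary_condition)
    (lambda : R) (u du : R -> R) : Prop :=
  continuous_on (fun r => R1 <= r <= R2) u /\
  continuous_on (fun r => R1 <= r <= R2) du /\
  (forall r, R1 < r < R2 ->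
     is_derive u r (du r) /\
     ex_derive du r /\
     Derive du r + (INR d - 1) / r * du r
       + (lambda - INR l * (INR l + INR d - 2) / r ^ 2) * u r = 0) /\
  bc_holds b1 (u R1) (- du R1) /\
  bc_holds b2 (u R2) (du R2) /\
  (exists r, R1 <= r <= R2 /\ u r <> 0).

Definition eigenvalue (d l : nat) (R1 R2 : R) (b1 b2 : boundary_condition)
    (lambda : R) : Prop :=
  exists u du, eigenfunction d l R1 R2 b1 b2 lambda u du.

Definition normalised_eigenfunction (d l : nat) (R1 R2 : R)
    (b1 b2 : boundary_condition) (lambda : R) (u du : R -> R) : Prop :=
  eigenfunction d l R1 R2 b1 b2 lambda u du /\
  is_RInt (fun r => Rabs (u r) ^ 2 * r ^ (d - 1)) R1 R2 1.

(* [x] is the [p]-th smallest element of [E], counting from p = 1: it belongs to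
   E and exactly p - 1 elements of E lie below it. *)
Definition is_nth_smallest (E : R -> Prop) (p : nat) (x : R) : Prop :=
  E x /\
  exists s : list R,
    NoDup s /\ S (length s) = p /\ (forall y, In y s <-> E y /\ y < x).

Definition robin_resonance (d l : nat) (R1 R2 : R) (alpha1 alpha2 : R)
    (p : nat) (k : R) : Prop :=
  is_nth_smallest
    (fun k => 0 < k /\ eigenvalue d l R1 R2 (Robin alpha1) (Robin alpha2) (k ^ 2))
    p k.

Definition limit_resonance (d l : nat) (R1 R2 : R) (b1 b2 : boundary_condition)
    (p : nat) (k : R) : Prop :=
  0 <= k /\ is_nth_smallest (eigenvalue d l R1 R2 b1 b2) p (k ^ 2).

Definition is_bigO {T : Type} (F : (T -> Prop) -> Prop) (f g : T -> R) : Prop :=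
  exists C : R, F (fun x => Rabs (f x) <= C * Rabs (g x)).

Definition bessel_order (d l : nat) : R := INR l + (INR d / 2 - 1).

Section Characteristic.

Variables (d l : nat) (R1 R2 : R).

Let J1 k := besselJ (bessel_order d l) (k * R1).
Let J2 k := besselJ (bessel_order d l) (k * R2).
Let Y1 k := besselY (bessel_order d l) (k * R1).
Let Y2 k := besselY (bessel_order d l) (k * R2).
Let J1' k := besselJ (bessel_order d l + 1) (k * R1).
Let J2' k := besselJ (bessel_order d l + 1) (k * R2).
Let Y1' k := besselY (bessel_order d l + 1) (k * R1).
Let Y2' k := besselY (bessel_order d l + 1) (k * R2).
Let L1 := INR l / R1.
Let L2 := INR l / R2.

(* Here a prime marks the order mu + 1, not a derivative. *)
Definition char_A (k : R) : R := J1 k * Y2 k - J2 k * Y1 k.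

Definition char_B (k : R) : R :=
  L2 * (J1 k * Y2 k - J2 k * Y1 k) + k * (J2' k * Y1 k - J1 k * Y2' k).

Definition char_C (k : R) : R :=
  - L1 * (J1 k * Y2 k - J2 k * Y1 k) + k * (J1' k * Y2 k - J2 k * Y1' k).

Definition char_D (k : R) : R :=
  (k * J1' k - L1 * J1 k) * (L2 * Y2 k - k * Y2' k)
  - (L2 * J2 k - k * J2' k) * (k * Y1' k - L1 * Y1 k).

Definition mixed_coefficient (k : R) : R :=
  - / Derive char_A k *
  (char_D k
   - (char_B k * Derive char_C k + char_C k * Derive char_B k) / Derive char_A k
   + Derive_n char_A 2 k * char_B k * char_C k / (Derive char_A k) ^ 2).

End Characteristic.

(* Main.v *)
(** All limiting conditions are of the form X = 0 for a trace X (u or its normal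
    derivative), and the Robin condition is X + eps Y = 0 with the other trace Y and
    eps = alpha or 1/alpha.  With v0, v1 the solutions having (X, Y) = (0, 1), (-1, 0) at
    R1, the squared resonances are the roots lambda of
      P0 + eps1 P1 + eps2 P2 + eps1 eps2 P3,
    where P0 = X2(v0), P1 = X2(v1), P2 = Y2(v0), P3 = Y2(v1) are entire in lambda.
    Lagrange's identity shows that the roots of P0 are simple and gives the first order
    coefficients; compactness of [0, lambda_p], together with the positivity of all
    eigenvalues, shows that the p-th root moves to the p-th root.  The term
    g mu1 mu2 of the last expansion is absorbed by its error term.

    For d = 3 the Bessel functions have half-integer order and are elementary, up to the
    factor 1/Gamma(1/2), whose value is irrelevant because the mixed coefficient is
    invariant under a common rescaling of A, B, C, D. *)

Require Import Defs.
From Stdlib Require Import ZArith Reals Lra Lia List Classical ClassicalChoice Ranalysis5.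
From Coquelicot Require Import Coquelicot.
Import ListNotations.
Open Scope R_scope.

(** * Perturbation of simple roots *)

(** The spectral parameter lam is preferred to k because the traces at R2 are everywhere-convergent
    power series in lam. Only the last step passes to k, through P (k^2): this produces the factor
    1/(2 k0) and requires k0 > 0, which is where (l, p) = (0, 1) is excluded in the Neumann-Neumann
    case. The solutions are not built from Bessel functions: writing u = r^l f removes the
    centrifugal term and leaves (r^m f')' = - lam r^m f with m = d - 1 + 2l, whose Picard iterates
    have factorial bounds. The index p is defined by counting, so closeness of the p-th roots is not
    a local matter; it comes from two injections between finite sets of roots, one in each
    direction. Bessel functions enter only through the mixed coefficient, and for d = 3 they are
    reached from sine and cosine by the three-term recurrence in the order. The first roots for l =
    1, 2 have no closed form, so the coefficient is enclosed by rational interval arithmetic, with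
    bounds on products handed to [lra] as linear facts. *)

Ltac rabs_lra := unfold Rabs; repeat destruct Rcase_abs; intros; lra.

Definition C1_class (f f' : R -> R) : Prop :=
  forall x, is_derive f x (f' x) /\ continuous f' x.

Lemma is_derive_continuity_pt (f : R -> R) (x l : R) : is_derive f x l -> continuity_pt f x.
Proof.
intros H; apply continuity_pt_filterlim, (ex_derive_continuous f); now exists l.
Qed.

Lemma C1_continuity (f f' : R -> R) : C1_class f f' -> forall x, continuity_pt f x.
Proof. intros H x; apply (is_derive_continuity_pt f x (f' x)), H. Qed.

(** No order between x and y is assumed, so that estimates in |y - x| need no case split. *)
Lemma mvt_two_points (f f' : R -> R) (x y : R) :
  (forall z, Rmin x y <= z <= Rmax x y -> is_derive f z (f' z)) ->
  exists c, f y - f x = f' c * (y - x) /\ Rmin x y <= c <= Rmax x y.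
Proof.
intros H; destruct (MVT_gen f x y f') as [c [Hc E]].
- intros z Hz; apply H; lra.
- intros z Hz; now apply (is_derive_continuity_pt f z (f' z)), H.
- exists c; split; [exact E | exact Hc].
Qed.

Lemma continuous_bounded (f : R -> R) (a b : R) :
  a <= b -> (forall x, a <= x <= b -> continuity_pt f x) ->
  exists M, 0 <= M /\ forall x, a <= x <= b -> Rabs (f x) <= M.
Proof.
intros Hab Hf.
destruct (continuity_ab_maj (fun x => Rabs (f x)) a b Hab) as [m [Hm _]].
- intros c Hc; apply (continuity_pt_comp f Rabs); [now apply Hf | apply Rcontinuity_abs].
- exists (Rabs (f m)); split; [apply Rabs_pos | exact Hm].
Qed.

Lemma C1_lipschitz (f f' : R -> R) (a b : R) :
  C1_class f f' -> a <= b ->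
  exists L, 0 <= L /\ forall x y, a <= x <= b -> a <= y <= b ->
    Rabs (f y - f x) <= L * Rabs (y - x).
Proof.
intros Hf Hab.
destruct (continuous_bounded f' a b Hab) as [L [L0 HL]].
{ intros x _; apply continuity_pt_filterlim, Hf. }
exists L; split; [exact L0|]; intros x y Hx Hy.
destruct (mvt_two_points f f' x y) as [c [E Hc]]; [intros z _; apply Hf|].
rewrite E, Rabs_mult; apply Rmult_le_compat_r; [apply Rabs_pos|].
apply HL; revert Hc; unfold Rmin, Rmax; destruct (Rle_dec x y); lra.
Qed.

(** The mean value point c is within |x - t| of t and f' is Lipschitz, so the remainder is quadratic
    with a constant uniform in the base point t. *)
Lemma C1_taylor (f f' f'' : R -> R) (a b : R) :
  C1_class f f' -> C1_class f' f'' -> a <= b ->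
  exists C, 0 <= C /\ forall t x, a <= t <= b -> a <= x <= b ->
    Rabs (f x - f t - f' t * (x - t)) <= C * (x - t) ^ 2.
Proof.
intros Hf Hf' Hab.
destruct (C1_lipschitz f' f'' a b Hf' Hab) as [L [L0 HL]].
exists L; split; [exact L0|]; intros t x Ht Hx.
destruct (mvt_two_points f f' t x) as [c [E Hc]]; [intros z _; apply Hf|].
rewrite E; replace (f' c * (x - t) - f' t * (x - t)) with ((f' c - f' t) * (x - t)) by ring.
assert (B : a <= c <= b /\ Rabs (c - t) <= Rabs (x - t)).
{ revert Hc; unfold Rmin, Rmax; destruct (Rle_dec t x); intros Hc; split; try lra;
  rabs_lra. }
destruct B as [B1 B2].
rewrite Rabs_mult.
rewrite <- pow2_abs; replace (L * Rabs (x - t) ^ 2) with (L * Rabs (x - t) * Rabs (x - t)) by ring.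
apply Rmult_le_compat_r; [apply Rabs_pos|].
apply Rle_trans with (1 := HL t c Ht B1); apply Rmult_le_compat_l; lra.
Qed.

(** Pigeonhole for a relation: each element of l removes its partner from s, and injectivity keeps
    the partners of the others. It compares numbers of roots without constructing a matching
    function. *)
Lemma injection_length {A B : Type} (rel : A -> B -> Prop) (l : list A) :
  forall s : list B, NoDup l ->
  (forall y, In y l -> exists x, In x s /\ rel y x) ->
  (forall y y' x, In y l -> In y' l -> rel y x -> rel y' x -> y = y') ->
  (length l <= length s)%nat.
Proof.
induction l as [|y l IH]; intros s Nd Hex Hinj; [simpl; lia|].
inversion Nd as [|? ? Hy Nd']; subst.
destruct (Hex y (or_introl eq_refl)) as [x [Hx Hr]].
destruct (in_split x s Hx) as [s1 [s2 ->]].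
rewrite length_app; simpl.
enough (length l <= length (s1 ++ s2))%nat by (rewrite length_app in *; lia).
apply IH; [exact Nd'| |].
- intros y' Hy'; destruct (Hex y' (or_intror Hy')) as [x' [Hx' Hr']].
  exists x'; split; [|exact Hr'].
  apply in_app_or in Hx'; apply in_or_app.
  destruct Hx' as [?|[->|?]]; [now left| |now right].
  exfalso; apply Hy; rewrite (Hinj y y' x'); simpl; auto.
- intros; eapply Hinj; simpl; eauto.
Qed.

(** Merges the neighbourhoods of finitely many roots into one radius; monotonicity in the radius
    makes the minimum admissible. *)
Lemma uniform_radius (P : R -> R -> Prop) (l : list R) :
  (forall t d d', P t d -> 0 < d' <= d -> P t d') ->
  (forall t, In t l -> exists d, 0 < d /\ P t d) ->
  exists d, 0 < d /\ forall t, In t l -> P t d.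
Proof.
intros Hm; induction l as [|t l IH]; intros H.
- exists 1; split; [lra | intros t []].
- destruct (H t (or_introl eq_refl)) as [d1 [H1 P1]].
  destruct IH as [d2 [H2 P2]]; [intros; apply H; now right|].
  exists (Rmin d1 d2); split; [now apply Rmin_glb_lt|].
  intros t' [<-|Ht'].
  + apply (Hm _ d1); [exact P1|]; split; [now apply Rmin_glb_lt | apply Rmin_l].
  + apply (Hm _ d2); [now apply P2|]; split; [now apply Rmin_glb_lt | apply Rmin_r].
Qed.

(** The factor 2 makes the open balls of radius d around distinct points disjoint. *)
Lemma list_separation (l : list R) :
  exists d, 0 < d /\ forall t, In t l -> forall t', In t' l ->
    t <> t' -> 2 * d <= Rabs (t - t').
Proof.
apply (uniform_radius (fun t d => forall t', In t' l -> t <> t' -> 2 * d <= Rabs (t - t'))).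
- intros t d d' H Hd t' Ht' Hn; specialize (H t' Ht' Hn); lra.
- intros t _.
  destruct (uniform_radius (fun t' d => t <> t' -> 2 * d <= Rabs (t - t')) l)
    as [d [H1 H2]].
  + intros t' d d' H Hd Hn; specialize (H Hn); lra.
  + intros t' _; destruct (Req_dec t t') as [->|Hn].
    * exists 1; split; [lra | easy].
    * exists (Rabs (t - t') / 2); split; [|lra].
      apply Rdiv_lt_0_compat; [apply Rabs_pos_lt|]; lra.
  + exists d; split; [exact H1|]; intros t' Ht' Hn; now apply H2.
Qed.

(** P varies by less than |P t| / 2 near t and the perturbation contributes at most |P t| / 2, so
    the sum cannot vanish. *)
Lemma nonzero_near (P : R -> R) (Q : R -> R -> R -> R) (I : R -> Prop) (K t : R) :
  0 <= K ->
  (forall e1 e2 x, 0 < e1 < 1 -> 0 < e2 < 1 -> I x -> Rabs (Q e1 e2 x) <= K * (e1 + e2)) ->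
  continuity_pt P t -> P t <> 0 ->
  exists d, 0 < d /\ forall e1 e2 x, 0 < e1 < d -> 0 < e2 < d -> I x ->
    Rabs (x - t) < d -> P x + Q e1 e2 x <> 0.
Proof.
intros K0 HQ Hc Hn.
assert (Hm : 0 < Rabs (P t)) by now apply Rabs_pos_lt.
pose proof (proj1 (continuity_pt_locally _ _) Hc) as Hc1; clear Hc; rename Hc1 into Hc.
destruct (Hc (mkposreal (Rabs (P t) / 2) ltac:(lra))) as [d1 Hd1]; simpl in Hd1.
(* For e1, e2 < d2 the perturbation is at most |P t| / 2; K + 1 keeps the quotient defined when K =
   0. *)
set (d2 := Rabs (P t) / (4 * (K + 1))).
assert (Hd2 : 0 < d2) by (apply Rdiv_lt_0_compat; lra).
assert (E2 : 4 * (K + 1) * d2 = Rabs (P t)) by (unfold d2; field; lra).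
exists (Rmin d1 (Rmin 1 d2)); split.
{ repeat apply Rmin_glb_lt; try lra; apply cond_pos. }
intros e1 e2 x He1 He2 Ix Hx Hz.
pose proof (Rmin_l d1 (Rmin 1 d2)); pose proof (Rmin_r d1 (Rmin 1 d2)).
pose proof (Rmin_l 1 d2); pose proof (Rmin_r 1 d2).
assert (H3 : Rabs (P x - P t) < Rabs (P t) / 2).
{ apply Hd1; change (Rabs (x - t) < d1); lra. }
assert (H4 : Rabs (Q e1 e2 x) <= K * (e1 + e2)) by (apply HQ; trivial; lra).
assert (H5 : K * (e1 + e2) <= Rabs (P t) / 2).
{ apply Rle_trans with (K * (2 * d2)); [apply Rmult_le_compat_l|]; lra. }
revert H3 H4 H5 Hm; rabs_lra.
Qed.

(** Difference quotients near t stay within half of P' t: this gives both the expansion used for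
    uniqueness and the sign change used for existence. *)
Lemma slope_near (P P' P'' : R -> R) (t : R) :
  C1_class P P' -> C1_class P' P'' -> P' t <> 0 ->
  exists d, 0 < d /\ forall x y, Rabs (x - t) < d -> Rabs (y - t) < d ->
    exists q, Rabs (q - P' t) <= Rabs (P' t) / 2 /\ P y - P x = q * (y - x).
Proof.
intros HP HP' Hn.
assert (Hm : 0 < Rabs (P' t)) by now apply Rabs_pos_lt.
pose proof (C1_continuity _ _ HP' t) as Hc.
pose proof (proj1 (continuity_pt_locally _ _) Hc) as Hc1; clear Hc; rename Hc1 into Hc.
destruct (Hc (mkposreal (Rabs (P' t) / 2) ltac:(lra))) as [d Hd]; simpl in Hd.
exists d; split; [apply cond_pos|]; intros x y Hx Hy.
destruct (mvt_two_points P P' x y) as [c [E B]]; [intros z _; apply HP|].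
exists (P' c); split; [apply Rlt_le|exact E].
apply Hd; change (Rabs (c - t) < d); revert B Hx Hy; unfold Rmin, Rmax, Rabs.
destruct (Rle_dec x y); repeat destruct Rcase_abs; intros; lra.
Qed.

Lemma expanding_near (P P' P'' : R -> R) (t : R) :
  C1_class P P' -> C1_class P' P'' -> P' t <> 0 ->
  exists d, 0 < d /\ forall x y, Rabs (x - t) < d -> Rabs (y - t) < d ->
    Rabs (P' t) / 2 * Rabs (y - x) <= Rabs (P y - P x).
Proof.
intros HP HP' Hn; destruct (slope_near P P' P'' t HP HP' Hn) as [d [Hd H]].
exists d; split; [exact Hd|]; intros x y Hx Hy.
destruct (H x y Hx Hy) as [q [Hq ->]].
rewrite Rabs_mult; apply Rmult_le_compat_r; [apply Rabs_pos|].
revert Hq; rabs_lra.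
Qed.

(** Between two roots P would change by at least |P' t| / 2 times their distance, while the
    perturbation changes by strictly less. *)
Lemma unique_near (P P' P'' : R -> R) (Q : R -> R -> R -> R) (I : R -> Prop) (K t : R) :
  0 <= K ->
  (forall e1 e2 x y, 0 < e1 < 1 -> 0 < e2 < 1 -> I x -> I y ->
     Rabs (Q e1 e2 y - Q e1 e2 x) <= K * (e1 + e2) * Rabs (y - x)) ->
  C1_class P P' -> C1_class P' P'' -> P' t <> 0 ->
  exists d, 0 < d /\ forall e1 e2 x y, 0 < e1 < d -> 0 < e2 < d -> I x -> I y ->
    Rabs (x - t) < d -> Rabs (y - t) < d ->
    P x + Q e1 e2 x = 0 -> P y + Q e1 e2 y = 0 -> x = y.
Proof.
intros K0 HQ HP HP' Hn.
assert (Hm : 0 < Rabs (P' t)) by now apply Rabs_pos_lt.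
destruct (expanding_near P P' P'' t HP HP' Hn) as [d1 [Hd1 He]].
set (d2 := Rabs (P' t) / (8 * (K + 1))).
assert (Hd2 : 0 < d2) by (apply Rdiv_lt_0_compat; lra).
assert (E2 : 8 * (K + 1) * d2 = Rabs (P' t)) by (unfold d2; field; lra).
exists (Rmin d1 (Rmin 1 d2)); split; [repeat apply Rmin_glb_lt; lra|].
intros e1 e2 x y He1 He2 Ix Iy Hx Hy Zx Zy.
pose proof (Rmin_l d1 (Rmin 1 d2)); pose proof (Rmin_r d1 (Rmin 1 d2)).
pose proof (Rmin_l 1 d2); pose proof (Rmin_r 1 d2).
apply NNPP; intros Hxy.
assert (H3 : 0 < Rabs (y - x)) by (apply Rabs_pos_lt; lra).
assert (H4 : Rabs (P' t) / 2 * Rabs (y - x) <= Rabs (P y - P x)) by (apply He; lra).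
assert (H5 : Rabs (Q e1 e2 y - Q e1 e2 x) <= K * (e1 + e2) * Rabs (y - x))
  by (apply HQ; trivial; lra).
replace (P y - P x) with (- (Q e1 e2 y - Q e1 e2 x)) in H4 by lra.
rewrite Rabs_Ropp in H4.
assert (H6 : K * (e1 + e2) < Rabs (P' t) / 2).
{ apply Rle_lt_trans with (K * (2 * d2)); [apply Rmult_le_compat_l|]; lra. }
assert (K * (e1 + e2) * Rabs (y - x) < Rabs (P' t) / 2 * Rabs (y - x))
  by (apply Rmult_lt_compat_r; lra).
lra.
Qed.

(** Intermediate value theorem on [t - h, t + h]: P changes sign across its simple root, by an
    amount at h and - h that a small perturbation cannot undo. *)
Lemma exists_near (P P' P'' : R -> R) (Q : R -> R -> R -> R) (I : R -> Prop) (K t eta : R) :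
  0 <= K -> 0 < eta ->
  (forall x, Rabs (x - t) < eta -> I x) ->
  (forall e1 e2 x, 0 < e1 < 1 -> 0 < e2 < 1 -> I x -> Rabs (Q e1 e2 x) <= K * (e1 + e2)) ->
  (forall e1 e2 x, continuity_pt (Q e1 e2) x) ->
  C1_class P P' -> C1_class P' P'' -> P t = 0 -> P' t <> 0 ->
  exists d, 0 < d /\ forall e1 e2, 0 < e1 < d -> 0 < e2 < d ->
    exists x, Rabs (x - t) < eta /\ P x + Q e1 e2 x = 0.
Proof.
intros K0 Heta HI HQ HQc HP HP' Hz Hn.
destruct (slope_near P P' P'' t HP HP' Hn) as [d1 [Hd1 He]].
set (h := Rmin d1 eta / 2).
assert (Hh : 0 < h) by (apply Rdiv_lt_0_compat; [apply Rmin_glb_lt|]; lra).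
assert (Hh1 : h < d1) by (unfold h in *; pose proof (Rmin_l d1 eta); lra).
assert (Hh2 : h < eta) by (unfold h in *; pose proof (Rmin_r d1 eta); lra).
clearbody h.
assert (Hm : 0 < Rabs (P' t)) by now apply Rabs_pos_lt.
(* Introducing m through an equation keeps it an atom for the arithmetic tactics. *)
destruct (ex_intro (fun m => m = Rabs (P' t) / 2 * h) _ eq_refl) as [m Em].
assert (Hm' : 0 < m) by (rewrite Em; apply Rmult_lt_0_compat; lra).
set (d2 := m / (4 * (K + 1))).
assert (Hd2 : 0 < d2) by (apply Rdiv_lt_0_compat; lra).
assert (E2 : 4 * (K + 1) * d2 = m) by (unfold d2; field; lra).
exists (Rmin 1 d2); split; [apply Rmin_glb_lt; lra|].
intros e1 e2 He1 He2.
pose proof (Rmin_l 1 d2); pose proof (Rmin_r 1 d2).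
assert (H5 : K * (e1 + e2) < m).
{ apply Rle_lt_trans with (K * (2 * d2)); [apply Rmult_le_compat_l|]; lra. }
set (G := fun x => P' t * (P x + Q e1 e2 x)).
(* P' t * P (t + y) has the sign of y and dominates the perturbation at y = h, - h. *)
assert (HG : forall y, Rabs y = h -> exists q, 0 < q /\ Rabs (G (t + y) - q * y) < q * h).
{ intros y Hy.
  assert (Ey : t + y - t = y) by ring.
  destruct (He t (t + y)) as [q [Bq Eq]]; try (rewrite ?Ey, ?Rminus_diag, ?Rabs_R0; lra).
  rewrite Ey, Hz, Rminus_0_r in Eq.
  assert (HQy : Rabs (Q e1 e2 (t + y)) < m).
  { apply Rle_lt_trans with (2 := H5), HQ; try lra; apply HI; rewrite Ey; lra. }
  assert (Hq : Rabs (P' t) * Rabs (P' t) / 2 <= P' t * q).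
  { assert (Rabs ((q - P' t) * P' t) <= Rabs (P' t) / 2 * Rabs (P' t))
      by (rewrite Rabs_mult; apply Rmult_le_compat_r; lra).
    assert (Rabs (P' t) * Rabs (P' t) = P' t * P' t)
      by (rewrite <- Rabs_mult; apply Rabs_right, Rle_ge, Rle_0_sqr).
    pose proof (Rabs_le_between ((q - P' t) * P' t) (Rabs (P' t) / 2 * Rabs (P' t))); lra. }
  assert (0 < Rabs (P' t) * Rabs (P' t)) by now apply Rmult_lt_0_compat.
  exists (P' t * q); split; [lra|].
  replace (G (t + y) - P' t * q * y) with (P' t * Q e1 e2 (t + y)) by (unfold G; rewrite Eq; ring).
  rewrite Rabs_mult; apply Rlt_le_trans with (Rabs (P' t) * m); [now apply Rmult_lt_compat_l|].
  rewrite Em, <- Rmult_assoc; apply Rmult_le_compat_r; lra. }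
destruct (HG h) as [q1 [Q1 G1]]; [apply Rabs_right; lra|].
destruct (HG (- h)) as [q2 [Q2 G2]]; [rewrite Rabs_Ropp; apply Rabs_right; lra|].
apply Rabs_def2 in G1; apply Rabs_def2 in G2.
destruct (IVT_interv G (t + - h) (t + h)) as [z [Hz1 Hz2]]; try lra.
{ intros x _; apply (continuity_pt_scal (fun x => P x + Q e1 e2 x)), continuity_pt_plus;
    [eapply C1_continuity; eauto | apply HQc]. }
exists z; split; [rabs_lra|].
now apply Rmult_integral in Hz2; destruct Hz2.
Qed.

Definition perturbation (P1 P2 P3 : R -> R) (e1 e2 x : R) : R :=
  e1 * P1 x + e2 * P2 x + e1 * e2 * P3 x.

(** For e2 < 1 the product e1 e2 is at most e1, so the bilinear term is also O(e1 + e2). The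
    combination [Comb] serves both for values and for differences. *)
Lemma perturbation_bounds (P1 P1' P2 P2' P3 P3' : R -> R) (a b : R) :
  C1_class P1 P1' -> C1_class P2 P2' -> C1_class P3 P3' -> a <= b ->
  exists K, 0 <= K /\
    (forall e1 e2 x, 0 < e1 < 1 -> 0 < e2 < 1 -> a <= x <= b ->
       Rabs (perturbation P1 P2 P3 e1 e2 x) <= K * (e1 + e2)) /\
    (forall e1 e2 x y, 0 < e1 < 1 -> 0 < e2 < 1 -> a <= x <= b -> a <= y <= b ->
       Rabs (perturbation P1 P2 P3 e1 e2 y - perturbation P1 P2 P3 e1 e2 x)
       <= K * (e1 + e2) * Rabs (y - x)).
Proof.
intros H1 H2 H3 Hab.
assert (Comb : forall e1 e2 u v w a1 a2 a3, 0 < e1 < 1 -> 0 < e2 < 1 ->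
  Rabs u <= a1 -> Rabs v <= a2 -> Rabs w <= a3 ->
  Rabs (e1 * u + e2 * v + e1 * e2 * w) <= (a1 + a2 + a3) * (e1 + e2)).
{ intros e1 e2 u v w a1 a2 a3 He1 He2 Hu Hv Hw.
  assert (T : Rabs (e1 * u + e2 * v + e1 * e2 * w)
              <= e1 * Rabs u + e2 * Rabs v + e1 * e2 * Rabs w).
  { eapply Rle_trans; [apply Rabs_triang|].
    eapply Rle_trans; [apply Rplus_le_compat_r, Rabs_triang|].
    rewrite !Rabs_mult, (Rabs_right e1), (Rabs_right e2) by lra; lra. }
  pose proof (Rabs_pos u); pose proof (Rabs_pos v); pose proof (Rabs_pos w).
  assert (e1 * Rabs u <= e1 * a1) by (apply Rmult_le_compat_l; lra).
  assert (e2 * Rabs v <= e2 * a2) by (apply Rmult_le_compat_l; lra).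
  assert (e1 * e2 * Rabs w <= e1 * a3).
  { rewrite Rmult_assoc; apply Rmult_le_compat_l; [lra|].
    apply Rle_trans with (1 * Rabs w); [apply Rmult_le_compat_r|]; lra. }
  assert (0 <= e1 * a2) by (apply Rmult_le_pos; lra).
  assert (0 <= e2 * a1) by (apply Rmult_le_pos; lra).
  assert (0 <= e2 * a3) by (apply Rmult_le_pos; lra).
  lra. }
destruct (continuous_bounded P1 a b Hab) as [m1 [M1 B1]];
  [intros; eapply C1_continuity; eauto|].
destruct (continuous_bounded P2 a b Hab) as [m2 [M2 B2]];
  [intros; eapply C1_continuity; eauto|].
destruct (continuous_bounded P3 a b Hab) as [m3 [M3 B3]];
  [intros; eapply C1_continuity; eauto|].
destruct (C1_lipschitz _ _ a b H1 Hab) as [l1 [L1 D1]].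
destruct (C1_lipschitz _ _ a b H2 Hab) as [l2 [L2 D2]].
destruct (C1_lipschitz _ _ a b H3 Hab) as [l3 [L3 D3]].
exists (m1 + m2 + m3 + (l1 + l2 + l3)); split; [lra|split].
- intros e1 e2 x He1 He2 Hx.
  apply Rle_trans with ((m1 + m2 + m3) * (e1 + e2)).
  + apply Comb; auto.
  + apply Rmult_le_compat_r; lra.
- intros e1 e2 x y He1 He2 Hx Hy.
  replace (perturbation P1 P2 P3 e1 e2 y - perturbation P1 P2 P3 e1 e2 x) with
    (e1 * (P1 y - P1 x) + e2 * (P2 y - P2 x) + e1 * e2 * (P3 y - P3 x))
    by (unfold perturbation; ring).
  pose proof (Rabs_pos (y - x)).
  eapply Rle_trans; [apply Comb; auto|].
  rewrite <- !Rmult_plus_distr_r, Rmult_assoc, (Rmult_comm (Rabs _)), <- Rmult_assoc.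
  apply Rmult_le_compat_r; [lra|]; apply Rmult_le_compat_r; lra.
Qed.

(** Expansion of distances first gives x - x0 = O(e1 + e2). Inserted into the equation, this makes
    the Taylor remainder of P, the variation of the perturbation between x0 and x, and the bilinear
    term all quadratic; what is left is a linear equation for x - x0. *)
Lemma root_expansion (P P' P'' P1 P1' P2 P2' P3 P3' : R -> R) (x0 : R) :
  C1_class P P' -> C1_class P' P'' -> C1_class P1 P1' -> C1_class P2 P2' -> C1_class P3 P3' ->
  P x0 = 0 -> P' x0 <> 0 ->
  exists d C, 0 < d < 1 /\ forall e1 e2 x, 0 < e1 < d -> 0 < e2 < d -> Rabs (x - x0) < d ->
    P x + perturbation P1 P2 P3 e1 e2 x = 0 ->
    Rabs (x - (x0 - (e1 * P1 x0 + e2 * P2 x0) / P' x0)) <= C * (e1 ^ 2 + e2 ^ 2).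
Proof.
intros HP HP' H1 H2 H3 Z0 N0.
destruct (expanding_near P P' P'' x0 HP HP' N0) as [d [Hd He]].
destruct (perturbation_bounds P1 P1' P2 P2' P3 P3' (x0 - 1) (x0 + 1) H1 H2 H3)
  as [K [K0 [B1 B2]]]; [lra|].
destruct (C1_taylor P P' P'' (x0 - 1) (x0 + 1) HP HP') as [T [T0 HT]]; [lra|].
assert (Hm : 0 < Rabs (P' x0)) by now apply Rabs_pos_lt.
destruct (ex_intro (fun m => m = Rabs (P' x0)) _ eq_refl) as [m Em].
rewrite <- Em in Hm.
set (D := 2 * K / m).
assert (D0 : 0 <= D) by (apply Rmult_le_pos; [lra | apply Rlt_le, Rinv_0_lt_compat; lra]).
(* The three summands bound those three quadratic terms, m = |P' x0| comes from the division, and 2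
   from (e1 + e2)^2 <= 2 (e1^2 + e2^2). *)
exists (Rmin d (/ 2)), ((T * (D * D) + K * D + Rabs (P3 x0)) * 2 / m).
split; [split; [apply Rmin_glb_lt; lra | pose proof (Rmin_r d (/ 2)); lra]|].
intros e1 e2 x He1 He2 Hx Hz.
pose proof (Rmin_l d (/ 2)); pose proof (Rmin_r d (/ 2)).
assert (Ix : x0 - 1 <= x <= x0 + 1) by (revert Hx; rabs_lra).
set (s := e1 + e2).
assert (Hdist : Rabs (x - x0) <= D * s).
{ assert (A : m / 2 * Rabs (x - x0) <= K * s).
  { rewrite Em; apply Rle_trans with (Rabs (P x - P x0)).
    - apply He; [rewrite Rminus_diag, Rabs_R0|]; lra.
    - replace (P x - P x0) with (- perturbation P1 P2 P3 e1 e2 x) by lra.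
      rewrite Rabs_Ropp; apply B1; lra. }
  apply Rmult_le_reg_l with (m / 2); [lra|].
  apply Rle_trans with (1 := A); right; unfold D; field; lra. }
set (y := Rabs (x - x0)) in *.
assert (y0 : 0 <= y) by apply Rabs_pos.
assert (s0 : 0 < s) by (unfold s; lra).
assert (y2 : y ^ 2 <= D * D * s ^ 2).
{ replace (D * D * s ^ 2) with ((D * s) ^ 2) by ring; apply pow_incr; lra. }
assert (E : Rabs (P' x0 * (x - x0) + (e1 * P1 x0 + e2 * P2 x0))
            <= (T * (D * D) + K * D + Rabs (P3 x0)) * s ^ 2).
{ assert (A1 := HT x0 x ltac:(lra) Ix); rewrite Z0 in A1.
  assert (A2 := B2 e1 e2 x0 x ltac:(lra) ltac:(lra) ltac:(lra) Ix).
  rewrite <- pow2_abs in A1; fold y in A1, A2.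
  replace (P' x0 * (x - x0) + (e1 * P1 x0 + e2 * P2 x0)) with
    (- (P x - 0 - P' x0 * (x - x0))
     - (perturbation P1 P2 P3 e1 e2 x - perturbation P1 P2 P3 e1 e2 x0)
     - e1 * e2 * P3 x0) by (unfold perturbation in *; lra).
  eapply Rle_trans; [apply Rabs_triang|].
  eapply Rle_trans; [apply Rplus_le_compat_r, Rabs_triang|].
  rewrite !Rabs_Ropp, !Rabs_mult, (Rabs_right e1), (Rabs_right e2) by lra.
  fold s in A2.
  assert (T * y ^ 2 <= T * (D * D * s ^ 2)) by (apply Rmult_le_compat_l; lra).
  assert (K * s * y <= K * s * (D * s)).
  { apply Rmult_le_compat_l; [apply Rmult_le_pos|]; lra. }
  assert (e1 * e2 * Rabs (P3 x0) <= s ^ 2 * Rabs (P3 x0)).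
  { apply Rmult_le_compat_r; [apply Rabs_pos|]; unfold s.
    assert (0 < e1 * e2) by (apply Rmult_lt_0_compat; lra).
    pose proof (pow2_ge_0 e1); pose proof (pow2_ge_0 e2); lra. }
  lra. }
assert (N : 0 <= T * (D * D) + K * D + Rabs (P3 x0)).
{ pose proof (Rabs_pos (P3 x0)).
  assert (0 <= T * (D * D)) by (apply Rmult_le_pos; [|apply Rmult_le_pos]; lra).
  assert (0 <= K * D) by (apply Rmult_le_pos; lra). lra. }
set (Ct := T * (D * D) + K * D + Rabs (P3 x0)) in *.
replace (x - (x0 - (e1 * P1 x0 + e2 * P2 x0) / P' x0)) with
  (/ P' x0 * (P' x0 * (x - x0) + (e1 * P1 x0 + e2 * P2 x0))) by (field; exact N0).
rewrite Rabs_mult, Rabs_inv, <- Em.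
apply Rle_trans with (/ m * (Ct * s ^ 2)).
- apply Rmult_le_compat_l; [apply Rlt_le, Rinv_0_lt_compat|]; lra.
- replace (Ct * 2 / m * (e1 ^ 2 + e2 ^ 2)) with (/ m * (Ct * (2 * (e1 ^ 2 + e2 ^ 2))))
    by (field; lra).
  apply Rmult_le_compat_l; [apply Rlt_le, Rinv_0_lt_compat; lra|].
  apply Rmult_le_compat_l; [exact N|].
  unfold s; pose proof (pow2_ge_0 (e1 - e2)); lra.
Qed.

(* Away from the roots of P the perturbed function has no root, by compactness, and
   near each of them it has exactly one; hence counting roots from the left leads to
   the same one. *)
Lemma nth_root_close (P P' P'' P1 P1' P2 P2' P3 P3' : R -> R) (p : nat) (x0 eta0 : R) :
  C1_class P P' -> C1_class P' P'' -> C1_class P1 P1' -> C1_class P2 P2' -> C1_class P3 P3' ->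
  (forall x, P x = 0 -> 0 <= x) -> (forall x, P x = 0 -> P' x <> 0) ->
  is_nth_smallest (fun x => P x = 0) p x0 -> 0 < eta0 ->
  exists d, 0 < d /\ forall e1 e2 x, 0 < e1 < d -> 0 < e2 < d ->
    (forall y, P y + perturbation P1 P2 P3 e1 e2 y = 0 -> 0 < y) ->
    is_nth_smallest (fun y => P y + perturbation P1 P2 P3 e1 e2 y = 0) p x ->
    Rabs (x - x0) < eta0.
Proof.
intros HP HP' H1 H2 H3 Hpos Hsimple [Z0 [s [Nd [Hl Hs]]]] Heta0.
pose proof (Hpos _ Z0) as x0pos.
(* Roots of P up to x0 lie in [0, x0], so their neighbourhoods of radius at most 1 stay in I. *)
set (I := fun x => -1 <= x <= x0 + 1).
destruct (perturbation_bounds P1 P1' P2 P2' P3 P3' (-1) (x0 + 1) H1 H2 H3)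
  as [K [K0 [B1 B2]]]; [lra|].
set (Q := perturbation P1 P2 P3) in *.
assert (Qc : forall e1 e2 x, continuity_pt (Q e1 e2) x).
{ intros e1 e2 x; unfold Q, perturbation.
  repeat apply continuity_pt_plus;
  apply (continuity_pt_scal _ _ x); eapply C1_continuity; eauto. }
assert (HT : forall t, In t (x0 :: s) -> P t = 0 /\ t <= x0).
{ intros t [<-|Ht]; [split; [exact Z0 | lra]|]. apply Hs in Ht; split; [|apply Rlt_le]; apply Ht. }
assert (NdT : NoDup (x0 :: s)).
{ constructor; [|exact Nd]; intros Hin; apply Hs in Hin; lra. }
destruct (uniform_radius (fun t d => forall e1 e2 x y, 0 < e1 < d -> 0 < e2 < d ->
    I x -> I y -> Rabs (x - t) < d -> Rabs (y - t) < d ->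
    P x + Q e1 e2 x = 0 -> P y + Q e1 e2 y = 0 -> x = y) (x0 :: s)) as [d1 [Hd1 U1]].
{ intros t d d' H Hd e1 e2 x y He1 He2 Ix Iy Hx Hy; apply (H e1 e2 x y); trivial; lra. }
{ intros t Ht; apply (unique_near P P' P'' Q I K t); trivial.
  apply Hsimple, HT, Ht. }
destruct (list_separation (x0 :: s)) as [d2 [Hd2 U2]].
set (eta := Rmin (Rmin d1 d2) (Rmin eta0 1)).
assert (Heta : 0 < eta) by (repeat apply Rmin_glb_lt; lra).
assert (He1 : eta <= d1) by (unfold eta; eapply Rle_trans; apply Rmin_l).
assert (He2 : eta <= d2) by (unfold eta; eapply Rle_trans; [apply Rmin_l | apply Rmin_r]).
assert (He3 : eta <= eta0) by (unfold eta; eapply Rle_trans; [apply Rmin_r | apply Rmin_l]).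
assert (He4 : eta <= 1) by (unfold eta; eapply Rle_trans; [apply Rmin_r | apply Rmin_r]).
clearbody eta.
destruct (uniform_radius (fun t d => forall e1 e2, 0 < e1 < d -> 0 < e2 < d ->
    exists x, Rabs (x - t) < eta /\ P x + Q e1 e2 x = 0) (x0 :: s)) as [d3 [Hd3 U3]].
{ intros t d d' H Hd e1 e2 F1 F2; apply H; lra. }
{ intros t Ht; apply (exists_near P P' P'' Q I K t eta); trivial; try apply HT, Ht.
  - intros x Hx; unfold I; pose proof (proj2 (HT t Ht)).
    pose proof (Hpos t (proj1 (HT t Ht))).
    revert Hx; rabs_lra.
  - apply Hsimple, HT, Ht. }
(* A gauge on the line: at a root of P the radius is eta, elsewhere it is small enough to exclude
   perturbed roots. *)
assert (Hchoice : forall t, exists d : posreal, d <= eta /\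
    (P t <> 0 -> forall e1 e2 x, 0 < e1 < d -> 0 < e2 < d -> I x -> Rabs (x - t) < d ->
       P x + Q e1 e2 x <> 0)).
{ intros t; destruct (Req_dec (P t) 0) as [Hz|Hz].
  - exists (mkposreal eta Heta); simpl; split; [lra|]; intros; contradiction.
  - destruct (nonzero_near P Q I K t K0 B1 (C1_continuity _ _ HP t) Hz) as [d [Hd Hn]].
    assert (Hm : 0 < Rmin d eta) by (apply Rmin_glb_lt; lra).
    exists (mkposreal _ Hm); simpl; split; [apply Rmin_r|].
    pose proof (Rmin_l d eta).
    intros _ e1 e2 x F1 F2 Ix Hx; apply Hn; trivial; lra. }
apply choice in Hchoice; destruct Hchoice as [delta Hdelta].
(* Compactness bounds the useful gauge radii below by d4. It is stated under a double negation,
   hence the argument by contradiction in [Far]. *)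
destruct (compactness_value_1d 0 x0 delta) as [d4 Hd4].
exists (Rmin (Rmin d1 d3) d4); split.
{ repeat apply Rmin_glb_lt; try lra; apply cond_pos. }
intros e1 e2 x F1 F2 Fpos [Zx [s' [Nd' [Hl' Hs']]]].
pose proof (Rmin_l (Rmin d1 d3) d4); pose proof (Rmin_r (Rmin d1 d3) d4).
pose proof (Rmin_l d1 d3); pose proof (Rmin_r d1 d3).
assert (Near : forall t, In t (x0 :: s) -> exists y, Rabs (y - t) < eta /\ P y + Q e1 e2 y = 0)
  by (intros; apply U3; trivial; lra).
assert (Far : forall y, y <= x0 -> P y + Q e1 e2 y = 0 ->
  exists t, P t = 0 /\ Rabs (y - t) < eta).
{ intros y Hy Zy; pose proof (Fpos y Zy).
  apply NNPP; intros Hno; apply (Hd4 y); [lra|]; intros [t [Ht [Hyt Hdt]]].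
  destruct (Hdelta t) as [D1 D2].
  destruct (Req_dec (P t) 0) as [Hz|Hz].
  - apply Hno; exists t; split; [exact Hz | lra].
  - revert Zy; apply (D2 Hz); unfold I; lra. }
apply Rlt_le_trans with (2 := He3); apply Rnot_le_lt; intros Hfar.
assert (Hcase : x0 + eta <= x \/ x <= x0 - eta)
  by (revert Hfar; rabs_lra).
(* If x is too far right, the p roots x0 :: s of P inject into the p - 1 perturbed roots below x; if
   too far left, the p perturbed roots x :: s' inject into the p - 1 roots of P below x0. *)
destruct Hcase as [Hx|Hx].
- assert (length (x0 :: s) <= length s')%nat; [|simpl in *; lia].
  apply (injection_length (fun t y => Rabs (y - t) < eta)); trivial.
  + intros t Ht; destruct (Near t Ht) as [y [Hy Zy]]; exists y; split; [|exact Hy].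
    apply Hs'; split; [exact Zy|]; pose proof (proj2 (HT t Ht)).
    revert Hy; rabs_lra.
  + intros t t' y Ht Ht' Hy Hy'; apply NNPP; intros Hne.
    specialize (U2 t Ht t' Ht' Hne).
    revert U2 Hy Hy'; rabs_lra.
- assert (length (x :: s') <= length s)%nat; [|simpl in *; lia].
  assert (Hin : forall y, In y (x :: s') -> y <= x /\ P y + Q e1 e2 y = 0).
  { intros y [<-|Hy]; [split; [lra | exact Zx]|].
    apply Hs' in Hy; split; [apply Rlt_le|]; apply Hy. }
  apply (injection_length (fun y t => In t s /\ Rabs (y - t) < eta)); trivial.
  + constructor; [|exact Nd']; intros Hi; apply Hs' in Hi; lra.
  + intros y Hy; destruct (Hin y Hy) as [Hyx Zy].
    destruct (Far y ltac:(lra) Zy) as [t [Zt Ht]].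
    assert (In t s).
    { apply Hs; split; [exact Zt|]; revert Ht; rabs_lra. }
    exists t; auto.
  + intros y y' t Hy Hy' [Ht Hyt] [_ Hyt'].
    destruct (Hin y Hy) as [Hyx Zy]; destruct (Hin y' Hy') as [Hyx' Zy'].
    pose proof (Fpos y Zy); pose proof (Fpos y' Zy').
    apply (U1 t (or_intror Ht) e1 e2); unfold I; trivial; lra.
Qed.

(** * Calculus on a closed interval *)

Notation segment a b := (fun r : R => a <= r <= b).

(** Composition with [clamp] extends a function continuous on [a, b] to a continuous function on the
    whole line, so that results on total functions apply up to the end points. *)
Definition clamp (a b x : R) : R := Rmax a (Rmin b x).

Lemma clamp_bounds (a b x : R) : a <= b -> a <= clamp a b x <= b.
Proof. unfold clamp, Rmax, Rmin; repeat destruct Rle_dec; lra. Qed.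

Lemma clamp_id (a b x : R) : a <= x <= b -> clamp a b x = x.
Proof. unfold clamp, Rmax, Rmin; repeat destruct Rle_dec; lra. Qed.

Lemma clamp_lipschitz (a b x y : R) : Rabs (clamp a b y - clamp a b x) <= Rabs (y - x).
Proof.
unfold clamp, Rmax, Rmin, Rabs; repeat destruct Rle_dec; repeat destruct Rcase_abs; lra.
Qed.

Lemma clamp_continuous (f : R -> R) (a b x : R) :
  a <= b -> continuous_on (segment a b) f -> continuous (fun y => f (clamp a b y)) x.
Proof.
intros Hab Hf P HP.
specialize (Hf (clamp a b x) (clamp_bounds a b x Hab) P HP).
destruct Hf as [e He]; exists e; intros y Hy.
apply He; [|now apply clamp_bounds].
change (Rabs (clamp a b y - clamp a b x) < e); change (Rabs (y - x) < e) in Hy.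
pose proof (clamp_lipschitz a b x y); lra.
Qed.

Lemma continuous_on_clamp (f : R -> R) (a b : R) :
  a <= b -> (forall x, continuous (fun y => f (clamp a b y)) x) ->
  continuous_on (segment a b) f.
Proof.
intros Hab Hf x Hx.
apply filterlim_within_ext with (fun y => f (clamp a b y)).
- intros y Hy; now rewrite clamp_id.
- refine (filterlim_filter_le_1 _ (filter_le_within (F := locally x) _) _).
  pose proof (Hf x) as H; unfold continuous in H; now rewrite clamp_id in H.
Qed.

Lemma continuous_on_plus (f g : R -> R) (a b : R) :
  a <= b -> continuous_on (segment a b) f -> continuous_on (segment a b) g ->
  continuous_on (segment a b) (fun x => f x + g x).
Proof.
intros Hab Hf Hg; apply continuous_on_clamp; [exact Hab|]; intros x.
apply (continuous_plus (fun y => f (clamp a b y)) (fun y => g (clamp a b y))); apply clamp_continuous; assumption.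
Qed.

Lemma continuous_on_mult (f g : R -> R) (a b : R) :
  a <= b -> continuous_on (segment a b) f -> continuous_on (segment a b) g ->
  continuous_on (segment a b) (fun x => f x * g x).
Proof.
intros Hab Hf Hg; apply continuous_on_clamp; [exact Hab|]; intros x.
apply (continuous_mult (fun y => f (clamp a b y)) (fun y => g (clamp a b y))); apply clamp_continuous; assumption.
Qed.

Lemma continuous_on_opp (f : R -> R) (a b : R) :
  a <= b -> continuous_on (segment a b) f ->
  continuous_on (segment a b) (fun x => - f x).
Proof.
intros Hab Hf; apply continuous_on_clamp; [exact Hab|]; intros x.
apply (continuous_opp (fun y => f (clamp a b y))); apply clamp_continuous; assumption.
Qed.

Lemma continuous_on_minus (f g : R -> R) (a b : R) :
  a <= b -> continuous_on (segment a b) f -> continuous_on (segment a b) g ->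
  continuous_on (segment a b) (fun x => f x - g x).
Proof.
intros Hab Hf Hg; apply continuous_on_plus; trivial; now apply continuous_on_opp.
Qed.

Lemma is_derive_continuous_on (f f' : R -> R) (a b : R) :
  (forall r, a <= r <= b -> is_derive f r (f' r)) -> continuous_on (segment a b) f.
Proof.
intros H; apply (continuous_on_forall (segment a b)); intros r Hr.
apply (ex_derive_continuous f); exists (f' r); now apply H.
Qed.

Lemma continuous_on_const (c a b : R) : continuous_on (segment a b) (fun _ => c).
Proof. apply continuous_on_forall; intros x _; apply continuous_const. Qed.

Lemma locally_open_interval (a b x : R) : a < x < b -> locally x (fun y => a < y < b).
Proof.
intros Hx; assert (Hm : 0 < Rmin (x - a) (b - x)) by (apply Rmin_glb_lt; lra).
exists (mkposreal _ Hm); intros y Hy; change (Rabs (y - x) < Rmin (x - a) (b - x)) in Hy.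
pose proof (Rmin_l (x - a) (b - x)); pose proof (Rmin_r (x - a) (b - x)).
revert Hy; rabs_lra.
Qed.

Lemma is_derive_locally_constant (f : R -> R) (a b c x l : R) :
  a < x < b -> (forall y, a < y < b -> f y = c) -> is_derive f x l -> l = 0.
Proof.
intros Hx Hc Hl; rewrite <- (is_derive_unique _ _ _ Hl).
rewrite (Derive_ext_loc f (fun _ => c)); [apply Derive_const|].
apply (filter_imp _ _ Hc), locally_open_interval, Hx.
Qed.

Lemma clamp_is_derive (f : R -> R) (a b x l : R) :
  a < x < b -> is_derive f x l -> is_derive (fun y => f (clamp a b y)) x l.
Proof.
intros Hx; apply is_derive_ext_loc.
apply (filter_imp (fun y => a < y < b)); [|now apply locally_open_interval].
intros y Hy; rewrite clamp_id; [reflexivity | lra].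
Qed.

(** The derivative is known only inside the interval; the clamped extension supplies continuity at
    the ends and has the same derivative inside. *)
Lemma mvt_closed (f f' : R -> R) (a b : R) :
  a < b -> continuous_on (segment a b) f ->
  (forall r, a < r < b -> is_derive f r (f' r)) ->
  forall x y, a <= x -> x < y -> y <= b -> exists c, x < c < y /\ f y - f x = f' c * (y - x).
Proof.
intros Hab Hc Hd x y Hx Hxy Hy.
set (g := fun z => f (clamp a b z)).
assert (pr1 : forall c, x < c < y -> derivable_pt g c).
{ intros c Hcc; exists (f' c); apply is_derive_Reals, clamp_is_derive; [lra|]; apply Hd; lra. }
destruct (MVT g (fun z => z) x y pr1 (fun c _ => derivable_pt_id c) Hxy) as [c [Hcc E]].
- intros c _; apply continuity_pt_filterlim, clamp_continuous; [lra | exact Hc].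
- intros c _; apply derivable_continuous_pt, derivable_pt_id.
- exists c; split; [exact Hcc|].
  replace (f y) with (g y) by (unfold g; now rewrite clamp_id by lra).
  replace (f x) with (g x) by (unfold g; now rewrite clamp_id by lra).
  assert (E1 : derive_pt g c (pr1 c Hcc) = f' c).
  { apply derive_pt_eq_0, is_derive_Reals, clamp_is_derive; [lra|]; apply Hd; lra. }
  rewrite E1 in E.
  replace (derive_pt (fun z : R => z) c (derivable_pt_id c)) with 1 in E
    by (symmetry; apply derive_pt_id).
  lra.
Qed.

Lemma constant_closed (f : R -> R) (a b : R) :
  a < b -> continuous_on (segment a b) f ->
  (forall r, a < r < b -> is_derive f r 0) ->
  forall x y, a <= x <= b -> a <= y <= b -> f x = f y.
Proof.
intros Hab Hc Hd.
assert (H : forall x y, a <= x -> x < y -> y <= b -> f x = f y).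
{ intros x y Hx Hxy Hy.
  destruct (mvt_closed f (fun _ => 0) a b Hab Hc Hd x y Hx Hxy Hy) as [c [_ E]]; lra. }
intros x y Hx Hy; destruct (Rtotal_order x y) as [Hxy|[->|Hxy]]; trivial.
- apply H; lra.
- symmetry; apply H; lra.
Qed.

Lemma increasing_closed (f f' : R -> R) (a b : R) :
  a < b -> continuous_on (segment a b) f ->
  (forall r, a < r < b -> is_derive f r (f' r)) ->
  (forall r, a < r < b -> 0 <= f' r) ->
  forall x y, a <= x -> x <= y -> y <= b -> f x <= f y.
Proof.
intros Hab Hc Hd Hp x y Hx Hxy Hy.
destruct (Req_dec x y) as [->|Hne]; [lra|].
destruct (mvt_closed f f' a b Hab Hc Hd x y) as [c [Hcc E]]; try lra.
assert (0 <= f' c * (y - x)) by (apply Rmult_le_pos; [apply Hp|]; lra).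
lra.
Qed.

(** The integral of the clamped extension is differentiable everywhere. *)
Lemma antiderivative_closed (f : R -> R) (a b : R) :
  a <= b -> continuous_on (segment a b) f ->
  exists G : R -> R, G a = 0 /\ continuous_on (segment a b) G /\
    (forall r, a < r < b -> is_derive G r (f r)) /\ is_RInt f a b (G b).
Proof.
intros Hab Hf.
set (g := fun x => f (clamp a b x)).
assert (Hg : forall x, continuous g x) by (intros; now apply clamp_continuous).
assert (Hint : forall x y, ex_RInt g x y)
  by (intros; apply (ex_RInt_continuous (V := R_CompleteNormedModule)); auto).
assert (HG : forall x, is_derive (fun x => RInt g a x) x (g x)).
{ intros x; apply (is_derive_RInt g _ a x); [|apply Hg].
  apply filter_forall; intros y; apply (RInt_correct (V := R_CompleteNormedModule) g a y), Hint. }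
exists (fun x => RInt g a x); split; [apply (RInt_point a g)|split; [|split]].
- apply (is_derive_continuous_on _ g); intros; apply HG.
- intros r Hr; replace (f r) with (g r); [apply HG | unfold g; now rewrite clamp_id by lra].
- apply (is_RInt_ext g); [|apply (RInt_correct (V := R_CompleteNormedModule)), Hint].
  intros x; rewrite Rmin_left, Rmax_right by exact Hab; intros Hx; unfold g; now rewrite clamp_id by lra.
Qed.

(** F differs from the antiderivative of f by a function with zero derivative inside and continuous
    up to the ends, hence by a constant. *)
Lemma is_RInt_closed (F f : R -> R) (a b : R) :
  a < b -> continuous_on (segment a b) F -> continuous_on (segment a b) f ->
  (forall r, a < r < b -> is_derive F r (f r)) ->
  is_RInt f a b (F b - F a).
Proof.
intros Hab HF Hf Hd.
destruct (antiderivative_closed f a b) as (G & Ga & HGc & HG & HI); [lra | exact Hf |].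
replace (F b - F a) with (G b); [exact HI|].
assert (E : G b - F b = G a - F a); [|lra].
apply (constant_closed (fun x => G x - F x) a b); try lra.
- apply continuous_on_minus; trivial; lra.
- intros r Hr; evar_last.
  + apply (is_derive_minus G F); [now apply HG | now apply Hd].
  + apply (minus_eq_zero (f r)).
Qed.

(** The antiderivative is nondecreasing from 0 to a value I <= 0, so it is constant and its
    derivative vanishes. *)
Lemma is_RInt_nonneg_zero (f : R -> R) (a b I : R) :
  a < b -> continuous_on (segment a b) f -> (forall r, a <= r <= b -> 0 <= f r) ->
  is_RInt f a b I -> I <= 0 -> forall r, a < r < b -> f r = 0.
Proof.
intros Hab Hf Hp HI I0 r Hr.
destruct (antiderivative_closed f a b) as (G & Ga & HGc & HG & HI'); [lra | exact Hf |].
assert (Gb : G b = I) by (rewrite <- (is_RInt_unique _ _ _ _ HI); symmetry; now apply is_RInt_unique).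
assert (Hm : forall x y, a <= x -> x <= y -> y <= b -> G x <= G y).
{ apply (increasing_closed G f a b Hab HGc HG); intros x Hx; apply Hp; lra. }
apply (is_derive_locally_constant G a b 0 r); [exact Hr | | now apply HG].
intros y Hy; pose proof (Hm a y); pose proof (Hm y b); lra.
Qed.

(** * The radial equation *)

Definition radial_potential (d l : nat) (r : R) : R :=
  INR l * (INR l + INR d - 2) / r ^ 2.

(** The differential part of [eigenfunction], solved for the second derivative and freed from
    boundary and nontriviality conditions, so that solutions can be combined linearly. *)
Definition radial_solution (d l : nat) (R1 R2 lam : R) (u du : R -> R) : Prop :=
  continuous_on (segment R1 R2) u /\
  continuous_on (segment R1 R2) du /\
  forall r, R1 < r < R2 ->
    is_derive u r (du r) /\
    is_derive du r (- (INR d - 1) / r * du r - (lam - radial_potential d l r) * u r).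

Lemma eigenfunction_radial (d l : nat) (R1 R2 : R) (b1 b2 : boundary_condition)
    (lam : R) (u du : R -> R) :
  eigenfunction d l R1 R2 b1 b2 lam u du <->
  radial_solution d l R1 R2 lam u du /\
  bc_holds b1 (u R1) (- du R1) /\ bc_holds b2 (u R2) (du R2) /\
  (exists r, R1 <= r <= R2 /\ u r <> 0).
Proof.
unfold eigenfunction, radial_solution, radial_potential; split.
- intros (Hu & Hdu & Hode & Hb); split; [|exact Hb].
  split; [exact Hu|]; split; [exact Hdu|]; intros r Hr.
  destruct (Hode r Hr) as (D1 & D2 & E); split; [exact D1|].
  replace (_ - _) with (Derive du r) by (unfold Rdiv in *; lra).
  now apply Derive_correct.
- intros ((Hu & Hdu & Hode) & Hb); split; [exact Hu|]; split; [exact Hdu|].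
  split; [|exact Hb]; intros r Hr; destruct (Hode r Hr) as (D1 & D2).
  split; [exact D1|]; split; [eexists; exact D2|].
  rewrite (is_derive_unique _ _ _ D2); unfold Rdiv; ring.
Qed.

Lemma radial_solution_comb (d l : nat) (R1 R2 lam a b : R) (u du v dv : R -> R) :
  R1 <= R2 -> radial_solution d l R1 R2 lam u du -> radial_solution d l R1 R2 lam v dv ->
  radial_solution d l R1 R2 lam (fun r => a * u r + b * v r) (fun r => a * du r + b * dv r).
Proof.
intros H12 (Hu & Hdu & Hu') (Hv & Hdv & Hv'); split; [|split].
- apply continuous_on_plus; trivial; apply continuous_on_mult; trivial; apply continuous_on_const.
- apply continuous_on_plus; trivial; apply continuous_on_mult; trivial; apply continuous_on_const.
- intros r Hr; destruct (Hu' r Hr) as [A1 A2]; destruct (Hv' r Hr) as [B1 B2]; split.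
  + apply (is_derive_plus (fun r => a * u r) (fun r => b * v r)); now apply is_derive_scal.
  + match goal with |- is_derive _ _ ?x => replace x with
      (plus (a * (- (INR d - 1) / r * du r - (lam - radial_potential d l r) * u r))
            (b * (- (INR d - 1) / r * dv r - (lam - radial_potential d l r) * v r))) end.
    * apply (is_derive_plus (fun r => a * du r) (fun r => b * dv r)); now apply is_derive_scal.
    * unfold plus; simpl; ring.
Qed.

Lemma is_derive_weight (d : nat) (r : R) : (1 <= d)%nat -> r <> 0 ->
  is_derive (fun x => x ^ (d - 1)) r ((INR d - 1) / r * r ^ (d - 1)).
Proof.
intros Hd Hr; destruct d as [|n]; [lia|].
replace (S n - 1)%nat with n by lia; rewrite S_INR.
auto_derive; [trivial|]; destruct n as [|n]; simpl; [field; exact Hr|].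
field; exact Hr.
Qed.

Lemma weight_continuous_on (n : nat) (a b : R) : continuous_on (segment a b) (fun x => x ^ n).
Proof.
apply (is_derive_continuous_on _ (fun x => INR n * x ^ pred n)); intros r _.
auto_derive; [trivial | ring].
Qed.

(** The weight r^(d-1) puts the equation in divergence form: the first-order terms cancel in the
    derivative, and so does the potential, leaving only lam - mu. *)
Definition wronskian (d : nat) (u du v dv : R -> R) (r : R) : R :=
  r ^ (d - 1) * (u r * dv r - v r * du r).

Lemma is_derive_wronskian (d l : nat) (R1 R2 lam mu : R) (u du v dv : R -> R) :
  (1 <= d)%nat -> 0 < R1 -> R1 < R2 ->
  radial_solution d l R1 R2 lam u du -> radial_solution d l R1 R2 mu v dv ->
  forall r, R1 < r < R2 ->
  is_derive (wronskian d u du v dv) r ((lam - mu) * (u r * v r * r ^ (d - 1))).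
Proof.
intros Hd R1p H12 (_ & _ & Hu) (_ & _ & Hv) r Hr.
destruct (Hu r Hr) as [A1 A2]; destruct (Hv r Hr) as [B1 B2].
pose proof (is_derive_weight d r Hd ltac:(lra)) as W.
unfold wronskian.
evar (x : R); replace ((lam - mu) * (u r * v r * r ^ (d - 1))) with x; subst x.
- apply (is_derive_mult (fun x => x ^ (d - 1)) (fun x => u x * dv x - v x * du x));
    [exact W | | intros; apply Rmult_comm].
  apply (is_derive_minus (fun x => u x * dv x) (fun x => v x * du x)).
  + apply (is_derive_mult u dv); [exact A1 | exact B2 | intros; apply Rmult_comm].
  + apply (is_derive_mult v du); [exact B1 | exact A2 | intros; apply Rmult_comm].
- unfold plus, mult, minus, plus, opp; simpl; field; lra.
Qed.

Lemma wronskian_continuous_on (d l : nat) (R1 R2 lam mu : R) (u du v dv : R -> R) :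
  R1 <= R2 -> radial_solution d l R1 R2 lam u du -> radial_solution d l R1 R2 mu v dv ->
  continuous_on (segment R1 R2) (wronskian d u du v dv).
Proof.
intros H12 (Hu & Hdu & _) (Hv & Hdv & _).
apply continuous_on_mult; [exact H12 | apply weight_continuous_on|].
apply continuous_on_minus; trivial; apply continuous_on_mult; trivial.
Qed.

Lemma lagrange_identity (d l : nat) (R1 R2 lam mu : R) (u du v dv : R -> R) :
  (1 <= d)%nat -> 0 < R1 -> R1 < R2 ->
  radial_solution d l R1 R2 lam u du -> radial_solution d l R1 R2 mu v dv ->
  is_RInt (fun r => (lam - mu) * (u r * v r * r ^ (d - 1))) R1 R2
    (wronskian d u du v dv R2 - wronskian d u du v dv R1).
Proof.
intros Hd R1p H12 Hu Hv; apply is_RInt_closed; trivial.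
- apply (wronskian_continuous_on d l R1 R2 lam mu); trivial; lra.
- destruct Hu as (Hu & _ & _); destruct Hv as (Hv & _ & _).
  apply continuous_on_mult; [lra | apply continuous_on_const|].
  apply continuous_on_mult; [lra | | apply weight_continuous_on].
  apply continuous_on_mult; trivial; lra.
- now apply (is_derive_wronskian d l R1 R2).
Qed.

Lemma wronskian_constant (d l : nat) (R1 R2 lam : R) (u du v dv : R -> R) :
  (1 <= d)%nat -> 0 < R1 -> R1 < R2 ->
  radial_solution d l R1 R2 lam u du -> radial_solution d l R1 R2 lam v dv ->
  forall r s, R1 <= r <= R2 -> R1 <= s <= R2 -> wronskian d u du v dv r = wronskian d u du v dv s.
Proof.
intros Hd R1p H12 Hu Hv; apply constant_closed; try lra.
- apply (wronskian_continuous_on d l R1 R2 lam lam); trivial; lra.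
- intros r Hr.
  replace 0 with ((lam - lam) * (u r * v r * r ^ (d - 1))) by ring.
  now apply (is_derive_wronskian d l R1 R2).
Qed.

(* r^(d-1) u u' is nondecreasing when lam <= 0, while the boundary conditions make it
   nonnegative at R1 and nonpositive at R2. *)
Lemma eigenvalue_nonneg (d l : nat) (R1 R2 : R) (b1 b2 : boundary_condition) (lam : R) :
  (2 <= d)%nat -> 0 < R1 -> R1 < R2 ->
  (forall a, b1 = Robin a -> 0 < a) -> (forall a, b2 = Robin a -> 0 < a) ->
  eigenvalue d l R1 R2 b1 b2 lam ->
  0 <= lam /\ (lam = 0 -> l = 0%nat /\ b1 = Neumann /\ b2 = Neumann).
Proof.
intros Hd R1p H12 Hb1 Hb2 [u [du Hef]].
apply eigenfunction_radial in Hef; destruct Hef as (Hsol & B1 & B2 & [r0 [Hr0 Hn]]).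
assert (d2 : 2 <= INR d) by (apply (le_INR 2); exact Hd).
assert (l0 : 0 <= INR l) by apply pos_INR.
set (G := fun r => r ^ (d - 1) * (u r * du r)).
set (G' := fun r => r ^ (d - 1) * (du r * du r + (radial_potential d l r - lam) * (u r * u r))).
assert (HG : forall r, R1 < r < R2 -> is_derive G r (G' r)).
{ intros r Hr; destruct (proj2 (proj2 Hsol) r Hr) as [A1 A2]; unfold G, G'.
  evar_last.
  - apply (is_derive_mult (fun r => r ^ (d - 1)) (fun r => u r * du r));
      [apply is_derive_weight; [lia | lra] | | intros; apply Rmult_comm].
    apply (is_derive_mult u du); [exact A1 | exact A2 | intros; apply Rmult_comm].
  - unfold plus, mult; simpl; field; lra. }
assert (HGc : continuous_on (segment R1 R2) G).
{ apply continuous_on_mult; [lra | apply weight_continuous_on|].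
  destruct Hsol as (? & ? & _); apply continuous_on_mult; trivial; lra. }
assert (Hw : forall r, R1 <= r -> 0 < r ^ (d - 1)) by (intros; apply pow_lt; lra).
assert (Hq : forall r, R1 <= r -> 0 <= radial_potential d l r).
{ intros r Hr; apply Rmult_le_pos; [apply Rmult_le_pos; lra|].
  apply Rlt_le, Rinv_0_lt_compat, pow_lt; lra. }
(* Each condition makes u times its outward derivative nonpositive; at R1 the outward derivative is
   - du, which reverses the sign of G there. *)
assert (Hsgn : forall b x y, (forall a, b = Robin a -> 0 < a) -> bc_holds b x y -> x * y <= 0).
{ intros b x y Hb; destruct b as [a| |]; simpl; intros E.
  - specialize (Hb a eq_refl); replace y with (- (a * x)) by lra.
    pose proof (Rle_0_sqr x); unfold Rsqr in *.
    assert (0 <= a * (x * x)) by (apply Rmult_le_pos; lra); lra.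
  - rewrite E; lra.
  - rewrite E; lra. }
assert (G1 : 0 <= G R1).
{ apply Rmult_le_pos; [apply Rlt_le, Hw; lra|]. specialize (Hsgn b1 _ _ Hb1 B1); lra. }
assert (G2 : G R2 <= 0).
{ specialize (Hsgn b2 _ _ Hb2 B2); pose proof (Hw R2 ltac:(lra)); unfold G.
  assert (0 <= R2 ^ (d - 1) * - (u R2 * du R2)) by (apply Rmult_le_pos; lra); lra. }
(* G is nondecreasing with G R1 >= 0 >= G R2, so it vanishes and both nonnegative summands of its
   derivative are zero. *)
assert (Key : lam <= 0 -> forall r, R1 < r < R2 ->
  du r * du r = 0 /\ (radial_potential d l r - lam) * (u r * u r) = 0).
{ intros Hlam.
  assert (Hp : forall r, R1 <= r ->
    0 <= du r * du r /\ 0 <= (radial_potential d l r - lam) * (u r * u r)).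
  { intros r Hr; split; [apply Rle_0_sqr|].
    apply Rmult_le_pos; [specialize (Hq r Hr); lra | apply Rle_0_sqr]. }
  assert (Hm : forall x y, R1 <= x -> x <= y -> y <= R2 -> G x <= G y).
  { apply (increasing_closed G G' R1 R2); trivial.
    intros r Hr; apply Rmult_le_pos; [apply Rlt_le, Hw; lra|].
    destruct (Hp r ltac:(lra)); lra. }
  assert (HG0 : forall r, R1 <= r <= R2 -> G r = 0).
  { intros r Hr; pose proof (Hm R1 r); pose proof (Hm r R2); lra. }
  intros r Hr.
  assert (E : G' r = 0).
  { apply (is_derive_locally_constant G R1 R2 0 r); [exact Hr | | now apply HG].
    intros y Hy; apply HG0; lra. }
  apply Rmult_integral in E; destruct E as [E|E]; [specialize (Hw r ltac:(lra)); lra|].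
  destruct (Hp r ltac:(lra)); lra. }
assert (Du : lam <= 0 -> forall r, R1 <= r <= R2 -> u r = u r0).
{ intros Hlam r Hr; apply (constant_closed u R1 R2); trivial; [apply Hsol|].
  intros x Hx; destruct (Key Hlam x Hx) as [E _].
  apply Rsqr_0_uniq in E; rewrite <- E; apply (proj2 (proj2 Hsol) x Hx). }
set (m := (R1 + R2) / 2); assert (Hm : R1 < m < R2) by (unfold m; lra).
split.
- apply Rnot_lt_le; intros Hlam; destruct (Key ltac:(lra) m Hm) as [_ E].
  rewrite (Du ltac:(lra) m ltac:(lra)) in E.
  apply Rmult_integral in E; destruct E as [E|E].
  + specialize (Hq m ltac:(lra)); lra.
  + now apply Hn, Rsqr_0_uniq.
(* At lam = 0 the eigenfunction is a nonzero constant. Vanishing of G at the ends then leaves only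
   the Neumann condition, and vanishing of the potential term leaves only l = 0. *)
- intros ->.
  assert (Z : forall b y, (forall a, b = Robin a -> 0 < a) -> bc_holds b (u r0) y -> u r0 * y = 0 ->
    b = Neumann).
  { intros [a| |] y Hb; simpl; trivial; intros E1 E2.
    - apply Rmult_integral in E2; destruct E2 as [|E2]; [contradiction|].
      specialize (Hb a eq_refl); rewrite E2, Rplus_0_l in E1.
      apply Rmult_integral in E1; destruct E1; [lra | contradiction].
    - contradiction. }
  assert (HG0 : G R1 = 0 /\ G R2 = 0).
  { assert (G R1 <= G R2); [|lra].
    apply (increasing_closed G G' R1 R2); trivial; try lra.
    intros r Hr; destruct (Key ltac:(lra) r Hr) as [E1 E2]; unfold G'; rewrite E1, E2; lra. }
  destruct HG0 as [Z1 Z2]; unfold G in Z1, Z2.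
  rewrite (Du ltac:(lra) R1 ltac:(lra)) in Z1, B1; rewrite (Du ltac:(lra) R2 ltac:(lra)) in Z2, B2.
  apply Rmult_integral in Z1; destruct Z1 as [Z1|Z1]; [specialize (Hw R1); lra|].
  apply Rmult_integral in Z2; destruct Z2 as [Z2|Z2]; [specialize (Hw R2); lra|].
  split; [|split; [apply (Z b1 (- du R1)) | apply (Z b2 (du R2))]; trivial; lra].
  destruct (Key ltac:(lra) m Hm) as [_ E].
  rewrite (Du ltac:(lra) m ltac:(lra)) in E.
  apply Rmult_integral in E; destruct E as [E|E]; [|now apply Rsqr_0_uniq in E].
  destruct l as [|l]; [reflexivity | exfalso].
  assert (0 < INR (S l)) by (apply lt_0_INR; lia).
  assert (0 < radial_potential d (S l) m); [|lra].
  apply Rmult_lt_0_compat; [apply Rmult_lt_0_compat; lra|].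
  apply Rinv_0_lt_compat, pow_lt; lra.
Qed.

(** * Solutions as power series in the spectral parameter *)

Lemma is_derive_RInt_pos (f : R -> R) (c : R) :
  0 < c -> (forall r, 0 < r -> continuous f r) ->
  forall r, 0 < r -> is_derive (fun x => RInt f c x) r (f r).
Proof.
intros Hc Hf r Hr.
apply (is_derive_RInt f (fun x => RInt f c x) c r); [|now apply Hf].
exists (mkposreal r Hr); intros y Hy.
change (Rabs (y - r) < r) in Hy.
apply (RInt_correct (V := R_CompleteNormedModule) f c y).
apply (ex_RInt_continuous (V := R_CompleteNormedModule)).
intros z Hz; apply Hf; revert Hz Hy; unfold Rmin, Rabs; destruct Rle_dec; destruct Rcase_abs; intros; lra.
Qed.

(** The function A x^(n+1)/(n+1) minus or plus h starts at 0 and has nonnegative derivative. The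
    division by n + 1 is the source of the factorial in the Picard bounds. *)
Lemma monomial_growth (h h' : R -> R) (A X : R) (n : nat) :
  h 0 = 0 -> 0 <= X -> (forall x, 0 <= x <= X -> is_derive h x (h' x)) ->
  (forall x, 0 <= x <= X -> Rabs (h' x) <= A * x ^ n) ->
  Rabs (h X) <= A * X ^ S n / INR (S n).
Proof.
intros H0 HX Hd Hb.
assert (Hn : 0 < INR (S n)) by (apply lt_0_INR; lia).
assert (Hs : forall e, (e = 1 \/ e = -1) -> e * h X <= A * X ^ S n / INR (S n)).
{ intros e He.
destruct (mvt_two_points (fun x => A * x ^ S n / INR (S n) - e * h x)
    (fun x => A * x ^ n - e * h' x) 0 X) as [c [E Hc]].
  - intros x Hx; rewrite Rmin_left, Rmax_right in Hx by lra.
    apply (is_derive_minus (fun x => A * x ^ S n / INR (S n)) (fun x => e * h x)).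
    + auto_derive; [trivial|]; change (match n with 0%nat => 1 | S _ => INR n + 1 end) with (INR (S n)); field; lra.
    + now apply is_derive_scal, Hd.
  - rewrite Rmin_left, Rmax_right in Hc by lra; cbv beta in E.
    rewrite H0, pow_ne_zero in E by lia.
    assert (0 <= A * c ^ n - e * h' c).
    { specialize (Hb c Hc); destruct He as [-> | ->]; revert Hb; rabs_lra. }
    assert (0 <= (A * c ^ n - e * h' c) * (X - 0)) by (apply Rmult_le_pos; lra).
    unfold Rdiv in *; lra. }
pose proof (Hs 1 ltac:(lra)); pose proof (Hs (-1) ltac:(lra)).
rabs_lra.
Qed.

Lemma monomial_growth_at (f f' : R -> R) (A a b c r : R) (n : nat) :
  f c = 0 -> a <= c <= b -> a <= r <= b ->
  (forall x, a <= x <= b -> is_derive f x (f' x)) ->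
  (forall x, a <= x <= b -> Rabs (f' x) <= A * Rabs (x - c) ^ n) ->
  Rabs (f r) <= A * Rabs (r - c) ^ S n / INR (S n).
Proof.
intros H0 Hc Hr Hd Hb.
destruct (Rle_or_lt c r) as [Hcr|Hcr].
- replace (f r) with (f (c + (r - c))) by (f_equal; ring).
  rewrite (Rabs_right (r - c)) by lra.
  apply (monomial_growth (fun x => f (c + x)) (fun x => f' (c + x))); try lra.
  + now rewrite Rplus_0_r.
  + intros x Hx; evar_last.
    * apply (is_derive_comp f (fun x => c + x)); [apply Hd; lra | auto_derive; [trivial|reflexivity]].
    * unfold scal; simpl; unfold mult; simpl; ring.
  + intros x Hx; eapply Rle_trans; [apply Hb; lra|].
    replace (c + x - c) with x by ring; rewrite (Rabs_right x) by lra; lra.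
- replace (f r) with (f (c - (c - r))) by (f_equal; ring).
  rewrite (Rabs_left (r - c)) by lra; replace (- (r - c)) with (c - r) by ring.
  apply (monomial_growth (fun x => f (c - x)) (fun x => - f' (c - x))); try lra.
  + now rewrite Rminus_0_r.
  + intros x Hx; evar_last.
    * apply (is_derive_comp f (fun x => c - x)); [apply Hd; lra | auto_derive; [trivial|reflexivity]].
    * unfold scal; simpl; unfold mult; simpl; ring.
  + intros x Hx; rewrite Rabs_Ropp; eapply Rle_trans; [apply Hb; lra|].
    replace (c - x - c) with (- x) by ring; rewrite Rabs_Ropp, (Rabs_right x) by lra; lra.
Qed.

(* The functions g_n with (r^m g_{n+1}')' = - r^m g_n, so that sum_n lam^n g_n solves
   (r^m f')' = - lam r^m f; [picard'] are their derivatives. *)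
Fixpoint picard (m : nat) (c : R) (g0 : R -> R) (n : nat) : R -> R :=
  match n with
  | O => g0
  | S n => fun r =>
      RInt (fun t => - / t ^ m * RInt (fun s => s ^ m * picard m c g0 n s) c t) c r
  end.

Definition picard' (m : nat) (c : R) (g0 g0' : R -> R) (n : nat) : R -> R :=
  match n with
  | O => g0'
  | S n => fun t => - / t ^ m * RInt (fun s => s ^ m * picard m c g0 n s) c t
  end.

(** Coefficients after multiplication by lam: [shift g n] is the coefficient of lam^n in lam times
    the series of g. *)
Definition shift (g : nat -> R -> R) (n : nat) : R -> R :=
  match n with O => fun _ => 0 | S n => g n end.

Lemma continuous_pow_mult (m : nat) (f : R -> R) (r : R) :
  continuous f r -> continuous (fun s => s ^ m * f s) r.
Proof.
intros Hf; apply (continuous_mult (fun s => s ^ m) f); [|exact Hf].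
apply (ex_derive_continuous (fun s => s ^ m)); auto_derive; trivial.
Qed.

Lemma pow_inv_derive (m : nat) (r : R) : r <> 0 ->
  is_derive (fun t => - / t ^ m) r (INR m / r * / r ^ m).
Proof.
intros Hr; auto_derive; [now apply pow_nonzero|].
assert (r ^ m <> 0) by now apply pow_nonzero.
destruct m as [|k]; [simpl; field; exact Hr|].
rewrite Nat.pred_succ; simpl pow; field; split; [|exact Hr].
now apply pow_nonzero.
Qed.

Section Picard.

Context (m : nat) (c : R) (g0 g0' : R -> R).

Let g := picard m c g0.
Let g' := picard' m c g0 g0'.

(** The hypotheses on g0 say that it solves the equation at lam = 0. At each step the derivative is
    treated first, since the iterate is its integral and needs its continuity. *)
Lemma picard_derive :
  0 < c ->
  (forall r, 0 < r -> is_derive g0 r (g0' r)) ->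
  (forall r, 0 < r -> is_derive g0' r (- (INR m / r) * g0' r)) ->
  forall n r, 0 < r -> is_derive (g n) r (g' n r) /\
    is_derive (g' n) r (- (INR m / r) * g' n r - shift g n r).
Proof.
intros Hc H0 H0' n; induction n as [|n IH]; intros r Hr.
- split; [now apply H0|].
  replace (_ - _) with (- (INR m / r) * g0' r) by (unfold g', shift; simpl; ring).
  now apply H0'.
- assert (Hcont : forall t, 0 < t -> continuous (fun s => s ^ m * g n s) t).
  { intros t Ht; apply continuous_pow_mult, (ex_derive_continuous (g n)).
    exists (g' n t); now apply IH. }
  assert (Hin := is_derive_RInt_pos _ c Hc Hcont).
  assert (Hd : forall t, 0 < t -> is_derive (g' (S n)) t (- (INR m / t) * g' (S n) t - shift g (S n) t)).
  { intros t Ht; assert (t ^ m <> 0) by (apply pow_nonzero; lra).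
    unfold g', picard', shift; evar_last.
    - apply (is_derive_mult (fun t => - / t ^ m) (fun t => RInt (fun s => s ^ m * picard m c g0 n s) c t));
        [apply pow_inv_derive; lra | now apply Hin | intros; apply Rmult_comm].
    - unfold plus, mult; simpl; fold g; field; split; [assumption | lra]. }
  split; [|now apply Hd].
  apply (is_derive_RInt_pos (g' (S n)) c Hc); [|exact Hr].
  intros t Ht; apply (ex_derive_continuous (g' (S n))); eexists; now apply Hd.
Qed.

Lemma picard_base (n : nat) : g (S n) c = 0 /\ g' (S n) c = 0.
Proof.
split; [unfold g; simpl; apply (RInt_point (V := R_CompleteNormedModule) c)|].
unfold g', picard'.
pose proof (RInt_point (V := R_CompleteNormedModule) c (fun s => s ^ m * picard m c g0 n s)) as E.
rewrite E; apply Rmult_0_r.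
Qed.

(** Of the two integrations in a step, the inner one gives a factor |r - c| absorbed into M, and
    only the outer one gains 1/(n+1). Hence the derivative of index n + 1 carries the power n. *)
Lemma picard_bound (a b G : R) :
  0 < a -> a <= c <= b ->
  (forall r, 0 < r -> is_derive g0 r (g0' r)) ->
  (forall r, 0 < r -> is_derive g0' r (- (INR m / r) * g0' r)) ->
  (forall r, a <= r <= b -> Rabs (g0 r) <= G) ->
  exists M, 1 <= M /\ forall n r, a <= r <= b ->
    Rabs (g n r) <= G * M ^ n * Rabs (r - c) ^ n / INR (fact n) /\
    Rabs (g' (S n) r) <= G * M ^ S n * Rabs (r - c) ^ n / INR (fact n).
Proof.
intros Ha Hc H0 H0' HG.
set (K := b ^ m / a ^ m).
assert (Ham : 0 < a ^ m) by now apply pow_lt.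
assert (Hbm : a ^ m <= b ^ m) by (apply pow_incr; lra).
assert (K1 : 1 <= K).
{ apply Rmult_le_reg_r with (a ^ m); [exact Ham|]. unfold K; field_simplify; lra. }
assert (HM : K * b <= K * (b + 1)) by (apply Rmult_le_compat_l; lra).
(* K bounds the ratio of weights s^m / r^m on [a, b], and b bounds |r - c|; b + 1 in place of b
   ensures M >= 1. *)
exists (K * (b + 1)); split; [apply Rle_trans with (K * 1); [lra | apply Rmult_le_compat_l; lra]|].
assert (HM0 : 0 <= K * b) by (apply Rmult_le_pos; lra).
set (M := K * (b + 1)) in *.
assert (G0 : 0 <= G) by (apply Rle_trans with (2 := HG c Hc), Rabs_pos).
assert (Step : forall n,
  (forall r, a <= r <= b -> Rabs (g n r) <= G * M ^ n * Rabs (r - c) ^ n / INR (fact n)) ->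
  forall r, a <= r <= b -> Rabs (g' (S n) r) <= G * M ^ S n * Rabs (r - c) ^ n / INR (fact n)).
{ intros n IH r Hr.
  assert (Hf : 0 < INR (fact n)) by apply INR_fact_lt_0.
  assert (Hcont : forall t, 0 < t -> continuous (fun s => s ^ m * g n s) t).
  { intros t Ht; apply continuous_pow_mult, (ex_derive_continuous (g n)).
    exists (g' n t); apply picard_derive; trivial; lra. }
  assert (Hin := is_derive_RInt_pos _ c ltac:(lra) Hcont).
  destruct (mvt_two_points (fun t => RInt (fun s => s ^ m * g n s) c t) (fun s => s ^ m * g n s) c r)
    as [xi [E Hxi]].
  - intros x Hx; apply Hin; revert Hx; unfold Rmin; destruct Rle_dec; lra.
  - assert (Hxi' : a <= xi <= b /\ Rabs (xi - c) <= Rabs (r - c)).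
    { revert Hxi; unfold Rmin, Rmax, Rabs; destruct Rle_dec; repeat destruct Rcase_abs; intros; lra. }
    destruct Hxi' as [X1 X2].
    pose proof (RInt_point (V := R_CompleteNormedModule) c (fun s => s ^ m * g n s)) as Z.
    change (RInt (fun s : R => s ^ m * g n s) c c = 0) in Z.
    rewrite Z, Rminus_0_r in E.
    unfold g', picard'; fold g; fold (g n); rewrite E.
    assert (Hrm : a ^ m <= r ^ m) by (apply pow_incr; lra).
    rewrite !Rabs_mult, Rabs_Ropp, Rabs_inv, (Rabs_right (r ^ m)), (Rabs_right (xi ^ m))
      by (apply Rle_ge, pow_le; lra).
    replace (G * M ^ S n * Rabs (r - c) ^ n / INR (fact n)) with
      (M * (G * M ^ n * Rabs (r - c) ^ n / INR (fact n))) by (simpl; field; lra).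
    replace (/ r ^ m * (xi ^ m * Rabs (g n xi) * Rabs (r - c)))
      with ((xi ^ m / r ^ m * Rabs (r - c)) * Rabs (g n xi)) by (field; lra).
    apply Rmult_le_compat; try apply Rabs_pos.
    + apply Rmult_le_pos; [|apply Rabs_pos].
      apply Rmult_le_pos; [apply pow_le; lra | apply Rlt_le, Rinv_0_lt_compat; lra].
    + apply Rle_trans with (K * b); [|exact HM].
      apply Rmult_le_compat; try apply Rabs_pos.
      * apply Rmult_le_pos; [apply pow_le; lra | apply Rlt_le, Rinv_0_lt_compat; lra].
      * apply Rmult_le_compat; [apply pow_le; lra | apply Rlt_le, Rinv_0_lt_compat; lra | |].
        -- apply pow_incr; lra.
        -- apply Rinv_le_contravar; lra.
      * rabs_lra.
    + apply Rle_trans with (1 := IH xi X1); unfold Rdiv.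
      apply Rmult_le_compat_r; [apply Rlt_le, Rinv_0_lt_compat; lra|].
      apply Rmult_le_compat_l; [apply Rmult_le_pos; [exact G0 | apply pow_le; lra]|].
      apply pow_incr; split; [apply Rabs_pos | exact X2]. }
assert (Main : forall n r, a <= r <= b -> Rabs (g n r) <= G * M ^ n * Rabs (r - c) ^ n / INR (fact n)).
{ intros n; induction n as [|n IH]; intros r Hr.
  - unfold g; simpl; specialize (HG r Hr); lra.
  - assert (Hf : 0 < INR (fact n)) by apply INR_fact_lt_0.
    replace (G * M ^ S n * Rabs (r - c) ^ S n / INR (fact (S n))) with
      (G * M ^ S n / INR (fact n) * Rabs (r - c) ^ S n / INR (S n)).
    2:{ rewrite fact_simpl, mult_INR; field; split; (lra || (apply not_0_INR; lia)). }
    apply (monomial_growth_at (g (S n)) (g' (S n)) _ a b c r n); trivial.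
    + apply picard_base.
    + intros x Hx; apply picard_derive; trivial; lra.
    + intros x Hx; eapply Rle_trans; [apply Step; trivial|]; right; field; lra. }
intros n r Hr; split; [now apply Main | apply Step; auto].
Qed.

End Picard.

Definition exp_coef (q : R) (n : nat) : R := q ^ n / INR (fact n).

Lemma exp_coef_pos (q : R) (n : nat) : 0 <= q -> 0 <= exp_coef q n.
Proof.
intros Hq; apply Rmult_le_pos; [now apply pow_le|].
apply Rlt_le, Rinv_0_lt_compat, INR_fact_lt_0.
Qed.

(** Doubling q pays for a shift of the index: q q^n / n! = (n+1) q^(n+1) / (n+1)!, and n + 1 <=
    2^(n+1). *)
Lemma exp_coef_double (q : R) (n : nat) : 0 <= q ->
  exp_coef q n <= exp_coef (2 * q) n /\ q * exp_coef q n <= exp_coef (2 * q) (S n).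
Proof.
intros Hq.
assert (Hf : 0 < INR (fact n)) by apply INR_fact_lt_0.
assert (Hf' : 0 < INR (fact (S n))) by apply INR_fact_lt_0.
assert (Hqn : 0 <= q ^ n) by now apply pow_le.
split; unfold exp_coef, Rdiv.
- apply Rmult_le_compat_r; [apply Rlt_le, Rinv_0_lt_compat; lra|].
  apply pow_incr; lra.
- assert (H2 : INR (S n) <= 2 ^ S n).
  { clear; induction n as [|n IH]; [simpl; lra|].
    rewrite S_INR; replace (2 ^ S (S n)) with (2 ^ S n + 2 ^ S n) by (simpl; ring).
    pose proof (pow_R1_Rle 2 (S n)); lra. }
  replace (q * (q ^ n * / INR (fact n))) with (INR (S n) * (q ^ S n * / INR (fact (S n)))).
  2:{ rewrite fact_simpl, mult_INR; simpl pow; field; split; (lra || (apply not_0_INR; lia)). }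
  rewrite Rpow_mult_distr, Rmult_assoc; apply Rmult_le_compat_r; [|exact H2].
  apply Rmult_le_pos; [now apply pow_le | apply Rlt_le, Rinv_0_lt_compat; lra].
Qed.

Lemma is_series_exp_coef (q : R) : is_series (exp_coef q) (exp q).
Proof.
apply (is_series_ext (fun n => scal (pow_n q n) (/ INR (fact n)))).
- intros n; unfold exp_coef; rewrite pow_n_pow; reflexivity.
- apply is_exp_Reals.
Qed.

(** One exponential majorant serves the iterates and their first two derivatives, which is what
    termwise differentiation, twice in r and in lam, requires. *)
Lemma picard_coefficients (m : nat) (a b c x y : R) :
  0 < a -> a <= c <= b ->
  exists (g g' : nat -> R -> R) (A q : R), 0 <= A /\ 0 <= q /\
    g 0%nat c = x /\ g' 0%nat c = y /\ (forall n, g (S n) c = 0 /\ g' (S n) c = 0) /\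
    forall n r, a <= r <= b ->
      is_derive (g n) r (g' n r) /\
      is_derive (g' n) r (- (INR m / r) * g' n r - shift g n r) /\
      Rabs (g n r) <= A * exp_coef q n /\
      Rabs (g' n r) <= A * exp_coef q n /\
      Rabs (- (INR m / r) * g' n r - shift g n r) <= A * exp_coef q n.
Proof.
intros Ha Hc.
(* At lam = 0 the equation says that r^m g0' is constant; this choice takes the value y at c. *)
set (g0' := fun r => y * (c ^ m * / r ^ m)).
set (g0 := fun r => x + RInt g0' c r).
assert (H0' : forall r, 0 < r -> is_derive g0' r (- (INR m / r) * g0' r)).
{ intros r Hr; assert (r ^ m <> 0) by (apply pow_nonzero; lra).
  unfold g0'; evar_last.
  - apply (is_derive_ext (fun t => - (y * c ^ m) * - / t ^ m)); [intros t; change (- (y * c ^ m) * - / t ^ m = y * (c ^ m * / t ^ m)); ring|].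
    exact (is_derive_scal (fun t => - / t ^ m) r (- (y * c ^ m)) _ (pow_inv_derive m r (Rgt_not_eq _ _ Hr))).
  - ring. }
assert (H0 : forall r, 0 < r -> is_derive g0 r (g0' r)).
{ intros r Hr; unfold g0; evar_last.
  - apply (is_derive_plus (fun _ => x) (fun r => RInt g0' c r)); [apply is_derive_const|].
    apply is_derive_RInt_pos; [lra| |exact Hr].
    intros t Ht; apply (ex_derive_continuous g0'); eexists; now apply H0'.
  - unfold plus, zero; simpl; ring. }
assert (Hcont : forall f f' : R -> R, (forall r, 0 < r -> is_derive f r (f' r)) ->
  forall r, a <= r <= b -> continuity_pt f r).
{ intros f f' Hf r Hr; apply (is_derive_continuity_pt f r (f' r)), Hf; lra. }
destruct (continuous_bounded g0 a b ltac:(lra) (Hcont _ _ H0)) as [G1 [G1p HG1]].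
destruct (continuous_bounded g0' a b ltac:(lra) (Hcont _ _ H0')) as [G2 [G2p HG2]].
set (G := G1 + G2).
destruct (picard_bound m c g0 g0' a b G Ha Hc H0 H0') as [M [HM HB]].
{ intros r Hr; specialize (HG1 r Hr); unfold G; lra. }
set (q := M * (b + 1)).
assert (Hq : 1 <= q).
{ unfold q; apply Rle_trans with (M * 1); [lra | apply Rmult_le_compat_l; lra]. }
assert (HMq : M <= q).
{ unfold q; apply Rle_trans with (M * 1); [lra | apply Rmult_le_compat_l; lra]. }
assert (G0 : 0 <= G) by (unfold G; lra).
(* The factor 1 + m/a pays for the term (m/r) g' in the second derivative, and 2q for the index
   shift. *)
exists (picard m c g0), (picard' m c g0 g0'), (G * (1 + INR m / a)), (2 * q).
assert (Hma : 0 <= INR m / a)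
  by (apply Rmult_le_pos; [apply pos_INR | apply Rlt_le, Rinv_0_lt_compat, Ha]).
split; [apply Rmult_le_pos; lra|]; split; [lra|].
split; [simpl; unfold g0; rewrite (RInt_point (V := R_CompleteNormedModule) c g0'); apply Rplus_0_r|].
split; [simpl; unfold g0'; field; apply pow_nonzero; lra|].
split; [apply picard_base|].
intros n r Hr.
destruct (picard_derive m c g0 g0' ltac:(lra) H0 H0' n r ltac:(lra)) as [D1 D2].
split; [exact D1|]; split; [exact D2|].
assert (Hrc : 0 <= Rabs (r - c) <= b + 1)
  by (split; [apply Rabs_pos | rabs_lra]).
assert (Bd : forall k, G * M ^ k * Rabs (r - c) ^ k / INR (fact k) <= G * exp_coef q k).
{ intros k; unfold exp_coef, q, Rdiv; rewrite Rpow_mult_distr, !Rmult_assoc.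
  apply Rmult_le_compat_l; [exact G0|]; apply Rmult_le_compat_l; [apply pow_le; lra|].
  apply Rmult_le_compat_r; [apply Rlt_le, Rinv_0_lt_compat, INR_fact_lt_0|].
  now apply pow_incr. }
assert (Bg : forall k, Rabs (picard m c g0 k r) <= G * exp_coef q k)
  by (intros k; apply Rle_trans with (2 := Bd k), HB, Hr).
assert (E : forall k, 0 <= exp_coef q k) by (intros; apply exp_coef_pos; lra).
assert (B0 : Rabs (picard m c g0 n r) <= G * exp_coef (2 * q) n).
{ eapply Rle_trans; [apply Bg|]; apply Rmult_le_compat_l; [exact G0|].
  apply exp_coef_double; lra. }
assert (B1 : Rabs (picard' m c g0 g0' n r) <= G * exp_coef (2 * q) n).
{ destruct n as [|k].
  - unfold exp_coef; simpl; specialize (HG2 r Hr); unfold G; lra.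
  - eapply Rle_trans; [apply HB, Hr|].
    apply Rle_trans with (G * (q * exp_coef q k));
      [|apply Rmult_le_compat_l; [exact G0 | apply exp_coef_double; lra]].
    replace (G * M ^ S k * Rabs (r - c) ^ k / INR (fact k)) with
      (M * (G * M ^ k * Rabs (r - c) ^ k / INR (fact k))) by (simpl; unfold Rdiv; ring).
    replace (G * (q * exp_coef q k)) with (q * (G * exp_coef q k)) by ring.
    apply Rmult_le_compat; [lra | | exact HMq | apply Bd].
    eapply Rle_trans; [|apply HB, Hr]; apply Rabs_pos. }
assert (B2 : Rabs (shift (picard m c g0) n r) <= G * exp_coef (2 * q) n).
{ destruct n as [|k]; simpl.
  - rewrite Rabs_R0; apply Rmult_le_pos; [exact G0 | apply exp_coef_pos; lra].
  - eapply Rle_trans; [apply Bg|]; apply Rmult_le_compat_l; [exact G0|].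
    apply Rle_trans with (q * exp_coef q k); [|apply exp_coef_double; lra].
    specialize (E k); apply Rle_trans with (1 * exp_coef q k); [lra|].
    apply Rmult_le_compat_r; lra. }
set (w := G * exp_coef (2 * q) n) in *.
assert (w0 : 0 <= w) by (apply Rle_trans with (2 := B0), Rabs_pos).
replace (G * (1 + INR m / a) * exp_coef (2 * q) n) with (INR m / a * w + w) by (unfold w; ring).
assert (0 <= INR m / a * w) by (apply Rmult_le_pos; lra).
split; [lra|]; split; [lra|].
eapply Rle_trans; [apply Rabs_triang|]; apply Rplus_le_compat; [|rewrite Rabs_Ropp; exact B2].
assert (Hmr : 0 <= INR m / r <= INR m / a).
{ split; [apply Rmult_le_pos; [apply pos_INR | apply Rlt_le, Rinv_0_lt_compat; lra]|].
  apply Rmult_le_compat_l; [apply pos_INR | apply Rinv_le_contravar; lra]. }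
rewrite Rabs_mult, Rabs_Ropp, (Rabs_right (INR m / r)) by lra.
apply Rmult_le_compat; try lra; apply Rabs_pos.
Qed.

(** Weierstrass test: the tails of the differentiated series are bounded by those of B uniformly in
    r, so the partial sums may be differentiated in the limit. *)
Lemma series_derive (u u' : nat -> R -> R) (B : nat -> R) (a b : R) :
  ex_series B ->
  (forall n r, a < r < b -> is_derive (u n) r (u' n r) /\
     Rabs (u n r) <= B n /\ Rabs (u' n r) <= B n) ->
  forall r, a < r < b ->
  is_derive (fun x => Series (fun n => u n x)) r (Series (fun n => u' n r)).
Proof.
intros HB Hu r Hr.
assert (Hm0 : 0 < Rmin (r - a) (b - r)) by (apply Rmin_glb_lt; lra).
set (rad := mkposreal _ Hm0).
assert (Hball : forall x, Boule r rad x -> a < x < b).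
{ intros x Hx; unfold Boule in Hx; simpl in Hx.
  pose proof (Rmin_l (r - a) (b - r)); pose proof (Rmin_r (r - a) (b - r)).
  revert Hx; rabs_lra. }
assert (Hex : forall v : nat -> R, (forall n, Rabs (v n) <= B n) -> ex_series v).
{ intros v Hv; apply (ex_series_le v B); [exact Hv | exact HB]. }
apply is_derive_Reals.
apply (CVU_derivable (fun N x => sum_f_R0 (fun n => u n x) N)
  (fun N x => sum_f_R0 (fun n => u' n x) N) _ (fun x => Series (fun n => u' n x)) r rad).
- intros eps Heps.
  assert (Hl : is_lim_seq (fun N => Series B - sum_f_R0 B N) 0).
  { replace 0 with (Series B - Series B) by ring.
    apply is_lim_seq_minus'; [apply is_lim_seq_const|].
    apply (is_lim_seq_ext (sum_n B)); [intros; apply sum_n_Reals | now apply Series_correct]. }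
  apply is_lim_seq_Reals in Hl; destruct (Hl eps Heps) as [N HN]; exists N.
  intros n x Hn Hx; specialize (HN n Hn); unfold Rdist in HN; rewrite Rminus_0_r in HN.
  pose proof (Hball x Hx) as Hx'.
  assert (Hb' : forall n, Rabs (u' n x) <= B n) by (intros; now apply Hu).
  rewrite (Series_incr_n (fun n => u' n x) (S n)) by (try lia; now apply Hex).
  rewrite (Series_incr_n B (S n)) in HN by (try lia; exact HB).
  simpl Init.Nat.pred in *.
  replace (_ + _ - _) with (Series (fun k => u' (S n + k)%nat x)) by ring.
  replace (_ + _ - _) with (Series (fun k => B (S n + k)%nat)) in HN by ring.
  apply Rle_lt_trans with (2 := HN); apply Rle_trans with (2 := Rle_abs _).
  assert (HB' : ex_series (fun k => B (S n + k)%nat)) by now apply (ex_series_incr_n B (S n)).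
  eapply Rle_trans; [apply Series_Rabs|].
  + apply (ex_series_le (fun k => Rabs (u' (S n + k)%nat x)) (fun k => B (S n + k)%nat)); [|exact HB'].
    intros k; change (norm (Rabs (u' (S n + k)%nat x))) with (Rabs (Rabs (u' (S n + k)%nat x))).
    rewrite Rabs_Rabsolu; apply Hb'.
  + apply Series_le; [|exact HB']; intros k; split; [apply Rabs_pos | apply Hb'].
- intros x Hx; apply is_lim_seq_Reals.
  apply (is_lim_seq_ext (sum_n (fun n => u n x))); [intros; apply sum_n_Reals|].
  apply Series_correct, Hex; intros n; apply Hu, Hball, Hx.
- intros n x Hx; apply is_derive_Reals.
  induction n as [|n IH]; [apply Hu, Hball, Hx|].
  apply (is_derive_plus (fun x => sum_f_R0 (fun n => u n x) n) (u (S n))); [exact IH|].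
  apply Hu, Hball, Hx.
- unfold Boule; rewrite Rminus_diag, Rabs_R0; apply cond_pos.
Qed.

Lemma CV_radius_exp_coef (a : nat -> R) (A q : R) :
  0 <= q -> (forall n, Rabs (a n) <= A * exp_coef q n) -> CV_radius a = p_infty.
Proof.
intros Hq Ha.
assert (H : forall r : R, Rbar_le r (CV_radius a)).
{ intros r; apply (proj1 (Lub_Rbar_correct (CV_disk a))).
  apply (ex_series_le (fun n => Rabs (a n * r ^ n)) (fun n => A * exp_coef (q * Rabs r) n)).
  - intros n; change (norm (Rabs (a n * r ^ n))) with (Rabs (Rabs (a n * r ^ n))).
    rewrite Rabs_Rabsolu, Rabs_mult, <- RPow_abs.
    replace (A * exp_coef (q * Rabs r) n) with (A * exp_coef q n * Rabs r ^ n)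
      by (unfold exp_coef; rewrite Rpow_mult_distr; unfold Rdiv; ring).
    apply Rmult_le_compat_r; [apply pow_le, Rabs_pos | apply Ha].
  - eexists; exact (is_series_scal_l A _ _ (is_series_exp_coef (q * Rabs r))). }
destruct (CV_radius a) as [x| |]; [|reflexivity|].
- specialize (H (x + 1)); simpl in H; lra.
- specialize (H 0); simpl in H; contradiction.
Qed.

Definition C2_class (f : R -> R) : Prop :=
  exists f' f'', C1_class f f' /\ C1_class f' f''.

Lemma C2_class_comb (a b : R) (f g : R -> R) :
  C2_class f -> C2_class g -> C2_class (fun x => a * f x + b * g x).
Proof.
assert (H : forall f f' g g', C1_class f f' -> C1_class g g' ->
  C1_class (fun x => a * f x + b * g x) (fun x => a * f' x + b * g' x)).
{ intros u u' v v' Hu Hv x; destruct (Hu x) as [A1 A2]; destruct (Hv x) as [B1 B2]; split.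
  - apply (is_derive_plus (fun x => a * u x) (fun x => b * v x)); now apply is_derive_scal.
  - apply (continuous_plus (fun x => a * u' x) (fun x => b * v' x)).
    + now apply (continuous_scal_r a u').
    + now apply (continuous_scal_r b v'). }
intros [f' [f'' [F1 F2]]] [g' [g'' [G1 G2]]].
exists (fun x => a * f' x + b * g' x), (fun x => a * f'' x + b * g'' x); split; now apply H.
Qed.

Lemma C2_class_ext (f g : R -> R) : (forall x, f x = g x) -> C2_class f -> C2_class g.
Proof.
intros E [f' [f'' [F1 F2]]]; exists f', f''; split; [|exact F2].
intros x; split; [|apply F1]; apply (is_derive_ext f); [exact E | apply F1].
Qed.

Lemma C1_class_PSeries (a : nat -> R) :
  CV_radius a = p_infty -> C1_class (PSeries a) (PSeries (PS_derive a)).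
Proof.
intros Ha x; split; [apply is_derive_PSeries; rewrite Ha; exact I|].
apply continuity_pt_filterlim, PSeries_continuity; rewrite CV_radius_derive, Ha; exact I.
Qed.

Lemma C2_class_PSeries (a : nat -> R) : CV_radius a = p_infty -> C2_class (PSeries a).
Proof.
intros Ha; exists (PSeries (PS_derive a)), (PSeries (PS_derive (PS_derive a))).
split; apply C1_class_PSeries; [exact Ha | now rewrite CV_radius_derive].
Qed.

(** The factor n + 1 from differentiation cancels against (n+1)!, so the derivative is dominated by
    A q exp (q L). This depends on A, q and L only, which makes the Lipschitz constant of the
    solutions uniform in r. *)
Lemma PSeries_lipschitz (a : nat -> R) (A q L x y : R) :
  0 <= q -> (forall n, Rabs (a n) <= A * exp_coef q n) -> Rabs x <= L -> Rabs y <= L ->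
  Rabs (PSeries a y - PSeries a x) <= A * q * exp (q * L) * Rabs (y - x).
Proof.
intros Hq Ha Hx Hy.
assert (Hcv := CV_radius_exp_coef a A q Hq Ha).
destruct (mvt_two_points (PSeries a) (PSeries (PS_derive a)) x y) as [c [E Hc]];
  [intros z _; now apply C1_class_PSeries|].
rewrite E, Rabs_mult; apply Rmult_le_compat_r; [apply Rabs_pos|].
assert (HcL : Rabs c <= L).
{ revert Hx Hy Hc; unfold Rmin, Rmax, Rabs; destruct Rle_dec; repeat destruct Rcase_abs; intros; lra. }
assert (L0 : 0 <= L) by (apply Rle_trans with (2 := Hx), Rabs_pos).
assert (A0 : 0 <= A).
{ specialize (Ha 0%nat); unfold exp_coef in Ha; simpl in Ha.
  pose proof (Rabs_pos (a 0%nat)); lra. }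
assert (HB : is_series (fun n => A * q * exp_coef (q * L) n) (A * q * exp (q * L)))
  by exact (is_series_scal_l (A * q) _ _ (is_series_exp_coef (q * L))).
assert (Hb : forall n, Rabs (PS_derive a n * c ^ n) <= A * q * exp_coef (q * L) n).
{ intros n; unfold PS_derive.
  rewrite !Rabs_mult, <- RPow_abs, (Rabs_right (INR (S n))) by (apply Rle_ge, pos_INR).
  apply Rle_trans with (INR (S n) * (A * exp_coef q (S n)) * L ^ n).
  - apply Rmult_le_compat.
    + apply Rmult_le_pos; [apply pos_INR | apply Rabs_pos].
    + apply pow_le, Rabs_pos.
    + apply Rmult_le_compat_l; [apply pos_INR | apply Ha].
    + apply pow_incr; split; [apply Rabs_pos | exact HcL].
  - right; unfold exp_coef; rewrite fact_simpl, mult_INR, Rpow_mult_distr; simpl pow; field.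
    split; (apply INR_fact_neq_0 || (apply not_0_INR; lia)). }
unfold PSeries; rewrite <- (is_series_unique _ _ HB).
assert (Hex : ex_series (fun n => Rabs (PS_derive a n * c ^ n))).
{ apply (ex_series_le (fun n => Rabs (PS_derive a n * c ^ n)) (fun n => A * q * exp_coef (q * L) n));
    [|eexists; exact HB].
  intros n; change (norm (Rabs (PS_derive a n * c ^ n))) with (Rabs (Rabs (PS_derive a n * c ^ n))).
  rewrite Rabs_Rabsolu; apply Hb. }
eapply Rle_trans; [now apply Series_Rabs|].
apply Series_le; [|eexists; exact HB]; intros n; split; [apply Rabs_pos | apply Hb].
Qed.

(** The sum of lam^n g_n from [picard_coefficients]; at R1 every coefficient but the first vanishes,
    so the initial data do not depend on lam. *)
Lemma reduced_solutions (m : nat) (R1 R2 x y : R) :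
  0 < R1 -> R1 < R2 ->
  exists f f' : R -> R -> R,
    (forall lam, f lam R1 = x /\ f' lam R1 = y) /\
    (forall lam r, R1 <= r <= R2 -> is_derive (f lam) r (f' lam r) /\
       is_derive (f' lam) r (- (INR m / r) * f' lam r - lam * f lam r)) /\
    (forall r, R1 <= r <= R2 -> C2_class (fun lam => f lam r) /\ C2_class (fun lam => f' lam r)) /\
    (forall L, exists C, forall lam mu r, Rabs lam <= L -> Rabs mu <= L -> R1 <= r <= R2 ->
       Rabs (f mu r - f lam r) <= C * Rabs (mu - lam)).
Proof.
intros R1p H12.
(* The enlarged interval makes the derivatives at R1 and R2 two-sided. *)
destruct (picard_coefficients m (R1 / 2) (R2 + 1) R1 x y) as
  (g & g' & A & q & A0 & q0 & G0 & G0' & GS & HG); [lra | lra|].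
exists (fun lam r => PSeries (fun n => g n r) lam), (fun lam r => PSeries (fun n => g' n r) lam).
assert (Hbase : forall (h : nat -> R) lam, (forall n, h (S n) = 0) -> PSeries h lam = h 0%nat).
{ intros h lam Hh; unfold PSeries.
  apply is_series_unique, (filterlim_ext (fun _ => h 0%nat)); [|apply filterlim_const].
  intros n; induction n as [|n IH]; [rewrite sum_O; simpl; ring|].
  rewrite sum_Sn, <- IH, Hh; unfold plus; simpl; ring. }
split; [intros lam; split; rewrite Hbase; trivial; intros n; apply GS|].
assert (Hexp : forall lam, ex_series (fun n => A * exp_coef q n * Rabs lam ^ n)).
{ intros lam; apply (ex_series_ext (fun n => A * exp_coef (q * Rabs lam) n)).
  - intros n; unfold exp_coef; rewrite Rpow_mult_distr; unfold Rdiv; match goal with |- ?a = ?b => change (@eq R a b) end; ring.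
  - eexists; exact (is_series_scal_l A _ _ (is_series_exp_coef (q * Rabs lam))). }
assert (Hterm : forall v lam n, Rabs v <= A * exp_coef q n ->
  Rabs (v * lam ^ n) <= A * exp_coef q n * Rabs lam ^ n).
{ intros v lam n Hv; rewrite Rabs_mult, <- RPow_abs.
  apply Rmult_le_compat_r; [apply pow_le, Rabs_pos | exact Hv]. }
assert (Hex : forall (h : nat -> R) lam, (forall n, Rabs (h n) <= A * exp_coef q n) ->
  ex_series (fun n => h n * lam ^ n)).
{ intros h lam Hh; apply (ex_series_le (fun n => h n * lam ^ n) (fun n => A * exp_coef q n * Rabs lam ^ n)); [|apply Hexp].
  intros n; now apply Hterm. }
assert (Hd : forall (u u' : nat -> R -> R) lam r, R1 / 2 < r < R2 + 1 ->
  (forall n r, R1 / 2 <= r <= R2 + 1 -> is_derive (u n) r (u' n r) /\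
     Rabs (u n r) <= A * exp_coef q n /\ Rabs (u' n r) <= A * exp_coef q n) ->
  is_derive (fun r => PSeries (fun n => u n r) lam) r (PSeries (fun n => u' n r) lam)).
{ intros u u' lam r Hr Hu; unfold PSeries.
  apply (series_derive (fun n r => u n r * lam ^ n) (fun n r => u' n r * lam ^ n)
    (fun n => A * exp_coef q n * Rabs lam ^ n) (R1 / 2) (R2 + 1)); [apply Hexp | | exact Hr].
  intros n s Hs; destruct (Hu n s ltac:(lra)) as (D & B1 & B2).
  split; [|split; now apply Hterm].
  apply (is_derive_ext (fun z => lam ^ n * u n z)); [intros; apply Rmult_comm|].
  rewrite Rmult_comm; now apply is_derive_scal. }
split; [|split].
- intros lam r Hr; split; [apply Hd; [lra|]; intros n s Hs; destruct (HG n s Hs) as (?&?&?&?&?); auto|].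
  replace (- (INR m / r) * PSeries (fun n => g' n r) lam - lam * PSeries (fun n => g n r) lam) with
    (PSeries (fun n => - (INR m / r) * g' n r - shift g n r) lam).
  + apply (Hd g' (fun n r => - (INR m / r) * g' n r - shift g n r)); [lra|].
    intros n s Hs; destruct (HG n s Hs) as (?&?&?&?&?); auto.
  + assert (Bg : forall n, Rabs (g n r) <= A * exp_coef q n) by (intros n; apply HG; lra).
    assert (Bg' : forall n, Rabs (g' n r) <= A * exp_coef q n) by (intros n; apply HG; lra).
    assert (Es : ex_series (fun n => shift g n r * lam ^ n)).
    { apply (ex_series_incr_1 (fun n => shift g n r * lam ^ n)); simpl.
      apply (ex_series_ext (fun n => lam * (g n r * lam ^ n))); [intros; match goal with |- ?a = ?b => change (@eq R a b) end; ring|].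
      apply (ex_series_scal_l lam (fun n => g n r * lam ^ n)), Hex, Bg. }
    unfold PSeries.
    rewrite (Series_ext _ (fun n => - (INR m / r) * (g' n r * lam ^ n) + - (shift g n r * lam ^ n)))
      by (intros; ring).
    rewrite Series_plus, Series_scal_l, Series_opp.
    * rewrite (Series_incr_1 _ Es); simpl.
      rewrite (Series_ext (fun k => g k r * (lam * lam ^ k)) (fun k => lam * (g k r * lam ^ k)))
        by (intros; ring).
      rewrite Series_scal_l; ring.
    * apply (ex_series_scal_l (- (INR m / r)) (fun n => g' n r * lam ^ n)), Hex, Bg'.
    * now apply (ex_series_opp (fun n => shift g n r * lam ^ n)).
- intros r Hr; split; apply C2_class_PSeries, (CV_radius_exp_coef _ A q q0); intros n; apply HG; lra.
- intros L; exists (A * q * exp (q * L)); intros lam mu r Hl Hm Hr.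
  apply PSeries_lipschitz; trivial; intros n; apply HG; lra.
Qed.

(** Since r^l solves the equation at lam = 0, the substitution u = r^l f removes the potential and
    turns d - 1 into m = d - 1 + 2l. The data for f are those of u / r^l at R1. *)
Lemma radial_solutions (d l : nat) (R1 R2 x y : R) :
  (2 <= d)%nat -> 0 < R1 -> R1 < R2 ->
  exists U DU : R -> R -> R,
    (forall lam, U lam R1 = x /\ DU lam R1 = y) /\
    (forall lam, radial_solution d l R1 R2 lam (U lam) (DU lam)) /\
    C2_class (fun lam => U lam R2) /\ C2_class (fun lam => DU lam R2) /\
    (forall L, exists C, forall lam mu r, Rabs lam <= L -> Rabs mu <= L -> R1 <= r <= R2 ->
       Rabs (U mu r - U lam r) <= C * Rabs (mu - lam)).
Proof.
intros Hd R1p H12.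
set (m := (d - 1 + 2 * l)%nat).
assert (HR : R1 ^ l <> 0) by (apply pow_nonzero; lra).
destruct (reduced_solutions m R1 R2 (x / R1 ^ l) ((y - INR l / R1 * x) / R1 ^ l) R1p H12)
  as (f & f' & Hi & Hode & Hsm & Hlip).
exists (fun lam r => r ^ l * f lam r), (fun lam r => r ^ l * f' lam r + INR l / r * r ^ l * f lam r).
assert (Em : INR m = INR d - 1 + 2 * INR l).
{ unfold m; rewrite plus_INR, minus_INR, mult_INR by lia; reflexivity. }
assert (Hpow : forall r, 0 < r -> is_derive (fun r => r ^ l) r (INR l / r * r ^ l)).
{ intros r Hr; auto_derive; [trivial|].
  destruct l as [|k]; [simpl; field; lra|].
  rewrite Nat.pred_succ; simpl pow; field; lra. }
assert (Hpow' : forall r, 0 < r ->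
  is_derive (fun r => INR l / r * r ^ l) r ((INR l * (INR l - 1)) / r ^ 2 * r ^ l)).
{ intros r Hr; evar_last.
  - apply (is_derive_mult (fun r => INR l / r) (fun r => r ^ l)); [|now apply Hpow | intros; apply Rmult_comm].
    instantiate (1 := - INR l / r ^ 2); auto_derive; [lra | field; lra].
  - unfold plus, mult; simpl; field; lra. }
assert (D1 : forall lam r, R1 <= r <= R2 -> is_derive (fun r => r ^ l * f lam r) r
  (r ^ l * f' lam r + INR l / r * r ^ l * f lam r)).
{ intros lam r Hr; evar_last.
  - apply (is_derive_mult (fun r => r ^ l) (f lam));
      [apply Hpow; lra | exact (proj1 (Hode lam r Hr)) | intros; apply Rmult_comm].
  - unfold plus, mult; simpl; ring. }
assert (D2 : forall lam r, R1 <= r <= R2 ->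
  is_derive (fun r => r ^ l * f' lam r + INR l / r * r ^ l * f lam r) r
  (- (INR d - 1) / r * (r ^ l * f' lam r + INR l / r * r ^ l * f lam r)
   - (lam - radial_potential d l r) * (r ^ l * f lam r))).
{ intros lam r Hr; evar_last.
  - apply (is_derive_plus (fun r => r ^ l * f' lam r) (fun r => INR l / r * r ^ l * f lam r)).
    + apply (is_derive_mult (fun r => r ^ l) (f' lam));
        [apply Hpow; lra | exact (proj2 (Hode lam r Hr)) | intros; apply Rmult_comm].
    + apply (is_derive_mult (fun r => INR l / r * r ^ l) (f lam));
        [apply Hpow'; lra | exact (proj1 (Hode lam r Hr)) | intros; apply Rmult_comm].
  - unfold plus, mult, radial_potential; simpl; rewrite Em; field; lra. }
split; [|split; [|split; [|split]]].
- intros lam; destruct (Hi lam) as [-> ->]; split; field; repeat split; trivial; lra.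
- intros lam; split; [|split].
  + apply (is_derive_continuous_on _ _ _ _ (D1 lam)).
  + apply (is_derive_continuous_on _ _ _ _ (D2 lam)).
  + intros r Hr; split; [apply D1 | apply D2]; lra.
- destruct (Hsm R2 ltac:(lra)) as [S1 S2].
  apply (C2_class_ext (fun lam => R2 ^ l * f lam R2 + 0 * f lam R2)); [intros; ring|].
  exact (C2_class_comb _ _ _ _ S1 S1).
- destruct (Hsm R2 ltac:(lra)) as [S1 S2].
  apply (C2_class_ext (fun lam => R2 ^ l * f' lam R2 + INR l / R2 * R2 ^ l * f lam R2)); [intros; ring|].
  exact (C2_class_comb _ _ _ _ S2 S1).
- intros L; destruct (Hlip L) as [C HC]; exists (R2 ^ l * C); intros lam mu r Hl Hm Hr.
  replace (r ^ l * f mu r - r ^ l * f lam r) with (r ^ l * (f mu r - f lam r)) by ring.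
  rewrite Rabs_mult, Rmult_assoc, (Rabs_right (r ^ l)) by (apply Rle_ge, pow_le; lra).
  apply Rmult_le_compat; [apply pow_le; lra | apply Rabs_pos | apply pow_incr; lra | now apply HC].
Qed.

(** The Wronskians of u with two solutions V, W vanish at s, hence everywhere, while V and W have
    nonzero Wronskian; Cramer's rule then kills u and du. *)
Lemma radial_solution_unique_zero (d l : nat) (R1 R2 lam : R) (u du : R -> R) (s : R) :
  (2 <= d)%nat -> 0 < R1 -> R1 < R2 -> radial_solution d l R1 R2 lam u du ->
  R1 <= s <= R2 -> u s = 0 -> du s = 0 ->
  forall r, R1 <= r <= R2 -> u r = 0 /\ du r = 0.
Proof.
intros Hd R1p H12 Hu Hs Z1 Z2 r Hr.
destruct (radial_solutions d l R1 R2 1 0 Hd R1p H12) as (V & DV & HV & SV & _).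
destruct (radial_solutions d l R1 R2 0 1 Hd R1p H12) as (W & DW & HW & SW & _).
destruct (HV lam) as [V1 V2]; destruct (HW lam) as [W1 W2].
assert (Hp : forall x, R1 <= x -> x ^ (d - 1) <> 0) by (intros; apply pow_nonzero; lra).
assert (H0 : forall v dv, radial_solution d l R1 R2 lam v dv -> u r * dv r - v r * du r = 0).
{ intros v dv Hv.
  pose proof (wronskian_constant d l R1 R2 lam _ _ _ _ ltac:(lia) R1p H12 Hu Hv r s Hr Hs) as E.
  unfold wronskian in E; rewrite Z1, Z2, Rmult_0_l, Rmult_0_r, Rminus_diag, Rmult_0_r in E.
  apply Rmult_integral in E; destruct E as [E|E]; [|exact E].
  exfalso; revert E; apply Hp, Hr. }
pose proof (H0 _ _ (SV lam)) as EV; pose proof (H0 _ _ (SW lam)) as EW.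
assert (Hn : V lam r * DW lam r - W lam r * DV lam r <> 0).
{ pose proof (wronskian_constant d l R1 R2 lam _ _ _ _ ltac:(lia) R1p H12 (SV lam) (SW lam)
    r R1 Hr ltac:(lra)) as E; unfold wronskian in E.
  intros E0; rewrite E0, V1, V2, W1, W2 in E; apply (Hp R1); lra. }
split; apply Rmult_eq_reg_r with (2 := Hn); rewrite Rmult_0_l.
- transitivity (V lam r * (u r * DW lam r - W lam r * du r) - W lam r * (u r * DV lam r - V lam r * du r));
    [ring | rewrite EV, EW; ring].
- transitivity (DV lam r * (u r * DW lam r - W lam r * du r) - DW lam r * (u r * DV lam r - V lam r * du r));
    [ring | rewrite EV, EW; ring].
Qed.

Lemma radial_solution_unique (d l : nat) (R1 R2 lam : R) (u du v dv : R -> R) (s : R) :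
  (2 <= d)%nat -> 0 < R1 -> R1 < R2 ->
  radial_solution d l R1 R2 lam u du -> radial_solution d l R1 R2 lam v dv ->
  R1 <= s <= R2 -> u s = v s -> du s = dv s ->
  forall r, R1 <= r <= R2 -> u r = v r /\ du r = dv r.
Proof.
intros Hd R1p H12 Hu Hv Hs E1 E2 r Hr.
destruct (radial_solution_unique_zero d l R1 R2 lam _ _ s Hd R1p H12
  (radial_solution_comb d l R1 R2 lam 1 (-1) u du v dv ltac:(lra) Hu Hv)) with (r := r);
  trivial; lra.
Qed.

(** * The characteristic function *)

Lemma radial_solution_zero_interior (d l : nat) (R1 R2 lam : R) (u du : R -> R) :
  (2 <= d)%nat -> 0 < R1 -> R1 < R2 -> radial_solution d l R1 R2 lam u du ->
  (forall r, R1 < r < R2 -> u r = 0) -> forall r, R1 <= r <= R2 -> u r = 0 /\ du r = 0.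
Proof.
intros Hd R1p H12 Hsol Hz.
set (s := (R1 + R2) / 2); assert (Hs : R1 < s < R2) by (unfold s; lra).
apply (radial_solution_unique_zero d l R1 R2 lam u du s); trivial; [lra | now apply Hz|].
apply (is_derive_locally_constant u R1 R2 0 s); trivial.
apply (proj2 (proj2 Hsol) s Hs).
Qed.

(* For a limiting condition ([true] for Dirichlet, [false] for Neumann) the trace that
   vanishes and the complementary one; the Robin condition is their combination with
   the small coefficient 1/alpha or alpha. *)
Definition vanishing_trace (t : bool) (u dn : R) : R := if t then u else dn.
Definition other_trace (t : bool) (u dn : R) : R := if t then dn else u.
Definition limit_bc (t : bool) : boundary_condition := if t then Dirichlet else Neumann.
Definition robin_bc (t : bool) (e : R) : boundary_condition := Robin (if t then / e else e).
(** The sign in Green's formula, and also that of the shift of the level: a small Robin parameter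
    raises a Neumann level and lowers a Dirichlet one. *)
Definition side_sign (t : bool) : R := if t then -1 else 1.

Lemma limit_bc_trace (t : bool) (u dn : R) :
  bc_holds (limit_bc t) u dn <-> vanishing_trace t u dn + 0 * other_trace t u dn = 0.
Proof. destruct t; simpl; split; intros; lra. Qed.

Lemma robin_bc_trace (t : bool) (e u dn : R) : 0 < e ->
  (bc_holds (robin_bc t e) u dn <-> vanishing_trace t u dn + e * other_trace t u dn = 0).
Proof.
intros He; destruct t; simpl; [|reflexivity].
replace (u + e * dn) with (e * (dn + / e * u)) by (field; lra); split; intros H.
- rewrite H; ring.
- apply Rmult_integral in H; destruct H; [lra | assumption].
Qed.

(** Puts the Lagrange bracket in terms of the traces, so that the four limiting problems share one
    computation. *)
Lemma green_trace (t : bool) (u dnu v dnv : R) :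
  u * dnv - v * dnu = side_sign t *
    (other_trace t u dnu * vanishing_trace t v dnv - other_trace t v dnv * vanishing_trace t u dnu).
Proof. destruct t; unfold side_sign, other_trace, vanishing_trace; ring. Qed.

(** The values e1 = e2 = 0 give the limiting problem and positive values the Robin problem, so one
    characteristic function covers both. *)
Definition trace_solution (d l : nat) (R1 R2 : R) (t1 t2 : bool) (e1 e2 lam : R) (u du : R -> R) : Prop :=
  radial_solution d l R1 R2 lam u du /\
  vanishing_trace t1 (u R1) (- du R1) + e1 * other_trace t1 (u R1) (- du R1) = 0 /\
  vanishing_trace t2 (u R2) (du R2) + e2 * other_trace t2 (u R2) (du R2) = 0 /\
  exists r, R1 <= r <= R2 /\ u r <> 0.

Lemma eigenfunction_limit_trace (d l : nat) (R1 R2 : R) (t1 t2 : bool) (lam : R) (u du : R -> R) :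
  eigenfunction d l R1 R2 (limit_bc t1) (limit_bc t2) lam u du <->
  trace_solution d l R1 R2 t1 t2 0 0 lam u du.
Proof. now rewrite eigenfunction_radial, !limit_bc_trace. Qed.

Lemma eigenfunction_robin_trace (d l : nat) (R1 R2 : R) (t1 t2 : bool) (e1 e2 lam : R) (u du : R -> R) :
  0 < e1 -> 0 < e2 ->
  eigenfunction d l R1 R2 (robin_bc t1 e1) (robin_bc t2 e2) lam u du <->
  trace_solution d l R1 R2 t1 t2 e1 e2 lam u du.
Proof. intros H1 H2; now rewrite eigenfunction_radial, !robin_bc_trace. Qed.

Section Shooting.

Context (d l : nat) (R1 R2 : R) (t1 t2 : bool).
Context (Hd : (2 <= d)%nat) (R1p : 0 < R1) (H12 : R1 < R2).
Context (U0 DU0 U1 DU1 : R -> R -> R).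
(** The outward derivative at R1 is - du, which explains the signs. With these data U0 + e1 U1
    satisfies the condition at R1 for every e1, and its complementary trace there is 1. *)
Context (Hi0 : forall lam, U0 lam R1 = (if t1 then 0 else 1) /\ DU0 lam R1 = if t1 then -1 else 0).
Context (Hi1 : forall lam, U1 lam R1 = (if t1 then -1 else 0) /\ DU1 lam R1 = if t1 then 0 else 1).
Context (Hs0 : forall lam, radial_solution d l R1 R2 lam (U0 lam) (DU0 lam)).
Context (Hs1 : forall lam, radial_solution d l R1 R2 lam (U1 lam) (DU1 lam)).

Let P0 lam := vanishing_trace t2 (U0 lam R2) (DU0 lam R2).
Let P1 lam := vanishing_trace t2 (U1 lam R2) (DU1 lam R2).
Let P2 lam := other_trace t2 (U0 lam R2) (DU0 lam R2).
Let P3 lam := other_trace t2 (U1 lam R2) (DU1 lam R2).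

(** The condition at R1 leaves one free parameter, the complementary trace y; both sides have the
    same data at R1. *)
Lemma shooting_unique (e1 lam : R) (u du : R -> R) :
  radial_solution d l R1 R2 lam u du ->
  vanishing_trace t1 (u R1) (- du R1) + e1 * other_trace t1 (u R1) (- du R1) = 0 ->
  let y := other_trace t1 (u R1) (- du R1) in
  forall r, R1 <= r <= R2 ->
    u r = y * (U0 lam r + e1 * U1 lam r) /\ du r = y * (DU0 lam r + e1 * DU1 lam r).
Proof.
intros Hu Hb y r Hr.
assert (Hc := radial_solution_comb d l R1 R2 lam y (y * e1) _ _ _ _ (Rlt_le _ _ H12) (Hs0 lam) (Hs1 lam)).
destruct (radial_solution_unique d l R1 R2 lam u du _ _ R1 Hd R1p H12 Hu Hc) with (r := r) as [-> ->];
  trivial.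
- lra.
- destruct (Hi0 lam) as [-> _]; destruct (Hi1 lam) as [-> _].
  unfold y; destruct t1; simpl in *; lra.
- destruct (Hi0 lam) as [_ ->]; destruct (Hi1 lam) as [_ ->].
  unfold y; destruct t1; simpl in *; lra.
- split; ring.
Qed.

Lemma shooting_characteristic (e1 e2 lam : R) :
  (exists u du, trace_solution d l R1 R2 t1 t2 e1 e2 lam u du) <->
  P0 lam + perturbation P1 P2 P3 e1 e2 lam = 0.
Proof.
assert (E : forall y, vanishing_trace t2 (y * (U0 lam R2 + e1 * U1 lam R2)) (y * (DU0 lam R2 + e1 * DU1 lam R2))
  + e2 * other_trace t2 (y * (U0 lam R2 + e1 * U1 lam R2)) (y * (DU0 lam R2 + e1 * DU1 lam R2))
  = y * (P0 lam + perturbation P1 P2 P3 e1 e2 lam)).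
{ intros y; unfold P0, P1, P2, P3, perturbation, vanishing_trace, other_trace; destruct t2; ring. }
split.
- intros (u & du & Hu & B1 & B2 & [r [Hr Hn]]).
  pose proof (shooting_unique e1 lam u du Hu B1) as Huq; simpl in Huq.
  destruct (Huq R2 ltac:(lra)) as [E1 E2]; rewrite E1, E2, E in B2.
  apply Rmult_integral in B2; destruct B2 as [B2|B2]; [|exact B2].
  destruct (Huq r Hr) as [E3 _]; rewrite B2, Rmult_0_l in E3; contradiction.
- intros Hz.
  exists (fun r => 1 * U0 lam r + e1 * U1 lam r), (fun r => 1 * DU0 lam r + e1 * DU1 lam r).
  assert (Hc := radial_solution_comb d l R1 R2 lam 1 e1 _ _ _ _ (Rlt_le _ _ H12) (Hs0 lam) (Hs1 lam)).
  split; [exact Hc|]; split; [|split].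
  + destruct (Hi0 lam) as [-> ->]; destruct (Hi1 lam) as [-> ->]; destruct t1; simpl; ring.
  + specialize (E 1); rewrite !Rmult_1_l in *; rewrite E; exact Hz.
  + apply NNPP; intros Hno.
    destruct (radial_solution_zero_interior d l R1 R2 lam _ _ Hd R1p H12 Hc) with (r := R1) as [Z1 Z2].
    * intros r Hr; apply NNPP; intros Hn; apply Hno; exists r; split; [lra | exact Hn].
    * lra.
    * revert Z1 Z2; destruct (Hi0 lam) as [-> ->]; destruct (Hi1 lam) as [-> ->]; destruct t1; lra.
Qed.

(** The Wronskian of U0 and U1 takes the same value at R1 and R2, and at a root of P0 only P2 P1
    survives at R2. This expresses P1 through P2, so that the coefficient belonging to R1 can be
    computed from data at R2. *)
Lemma shooting_wronskian (lam : R) : P0 lam = 0 ->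
  R2 ^ (d - 1) * (side_sign t2 * (P2 lam * P1 lam)) = side_sign t1 * R1 ^ (d - 1).
Proof.
intros Hz.
pose proof (wronskian_constant d l R1 R2 lam _ _ _ _ ltac:(lia) R1p H12
  (Hs0 lam) (Hs1 lam) R2 R1 ltac:(lra) ltac:(lra)) as W.
unfold wronskian in W; rewrite (green_trace t2) in W; fold (P0 lam) (P1 lam) (P2 lam) in W.
rewrite Hz in W; destruct (Hi0 lam) as [E1 E2]; destruct (Hi1 lam) as [E3 E4].
rewrite E1, E2, E3, E4 in W.
replace (R2 ^ (d - 1) * (side_sign t2 * (P2 lam * P1 lam))) with
  (R2 ^ (d - 1) * (side_sign t2 * (P2 lam * P1 lam - other_trace t2 (U1 lam R2) (DU1 lam R2) * 0)))
  by ring.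
rewrite W; destruct t1; unfold side_sign; ring.
Qed.

Lemma shooting_mass (lam : R) : exists N, 0 < N /\
  is_RInt (fun r => U0 lam r * U0 lam r * r ^ (d - 1)) R1 R2 N.
Proof.
clear P1 P3 Hi1 Hs1 U1 DU1.
assert (Hc : continuous_on (segment R1 R2) (fun r => U0 lam r * U0 lam r * r ^ (d - 1))).
{ destruct (Hs0 lam) as [Hc _].
  apply continuous_on_mult; [lra| |apply weight_continuous_on]; apply continuous_on_mult; trivial; lra. }
assert (Hp : forall r, R1 <= r <= R2 -> 0 <= U0 lam r * U0 lam r * r ^ (d - 1)).
{ intros r Hr; apply Rmult_le_pos; [apply Rle_0_sqr | apply pow_le; lra]. }
destruct (antiderivative_closed _ R1 R2 (Rlt_le _ _ H12) Hc) as (G & _ & _ & _ & HN); revert HN.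
generalize (G R2); intros N HN; exists N; split; [|exact HN].
apply Rnot_le_lt; intros HN0.
pose proof (is_RInt_nonneg_zero _ R1 R2 N H12 Hc Hp HN HN0) as Hz; simpl in Hz.
destruct (radial_solution_zero_interior d l R1 R2 lam _ _ Hd R1p H12 (Hs0 lam)) with (r := R1) as [Z1 Z2].
- intros r Hr; specialize (Hz r Hr); apply Rmult_integral in Hz; destruct Hz as [Hz|Hz].
  + now apply Rsqr_0_uniq in Hz.
  + pose proof (pow_lt r (d - 1) ltac:(lra)); lra.
- lra.
- revert Z1 Z2; destruct (Hi0 lam) as [-> ->]; destruct t1; lra.
Qed.

(* Lagrange's identity for U0 at lam and at a nearby mu gives
   R2^(d-1) s2 P2(lam) P0(mu) = (lam - mu) (N + O(mu - lam)). *)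
Lemma shooting_derivative (lam N P0' : R) :
  (forall L, exists C, forall la mu r, Rabs la <= L -> Rabs mu <= L -> R1 <= r <= R2 ->
     Rabs (U0 mu r - U0 la r) <= C * Rabs (mu - la)) ->
  is_RInt (fun r => U0 lam r * U0 lam r * r ^ (d - 1)) R1 R2 N ->
  is_derive P0 lam P0' -> P0 lam = 0 ->
  R2 ^ (d - 1) * (side_sign t2 * P2 lam) * P0' = - N.
Proof.
intros Hlip HN HP Hz.
destruct (Hlip (Rabs lam + 1)) as [C HC].
destruct (continuous_bounded (fun r => U0 lam (clamp R1 R2 r)) R1 R2) as [V [V0 HV]]; [lra | |].
{ intros x _; apply continuity_pt_filterlim, clamp_continuous; [lra | apply (Hs0 lam)]. }
set (kap := R2 ^ (d - 1) * (side_sign t2 * P2 lam)).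
set (D := (R2 - R1) * (V * C * R2 ^ (d - 1))).
assert (C0 : 0 <= C).
{ assert (H1 := HC lam (lam - 1) R1 ltac:(lra)).
  replace (lam - 1 - lam) with (-1) in H1 by ring.
  replace (Rabs (-1)) with 1 in H1 by (rabs_lra).
  pose proof (Rabs_pos (U0 (lam - 1) R1 - U0 lam R1)).
  assert (Rabs (lam - 1) <= Rabs lam + 1) by (rabs_lra).
  specialize (H1 ltac:(assumption) ltac:(lra)); lra. }
assert (W0 : 0 <= R2 ^ (d - 1)) by (apply pow_le; lra).
assert (D0 : 0 <= D) by (repeat apply Rmult_le_pos; trivial; lra).
assert (Q : forall mu, Rabs (mu - lam) <= 1 ->
  Rabs (kap * P0 mu + (mu - lam) * N) <= D * Rabs (mu - lam) ^ 2).
{ intros mu Hmu.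
  assert (Hmu' : Rabs mu <= Rabs lam + 1)
    by (revert Hmu; rabs_lra).
  pose proof (lagrange_identity d l R1 R2 lam mu _ _ _ _ ltac:(lia) R1p H12 (Hs0 lam) (Hs0 mu)) as HL.
  assert (EW : wronskian d (U0 lam) (DU0 lam) (U0 mu) (DU0 mu) R2
    - wronskian d (U0 lam) (DU0 lam) (U0 mu) (DU0 mu) R1 = kap * P0 mu).
  { unfold wronskian; rewrite (green_trace t2 (U0 lam R2)); fold (P0 lam) (P0 mu) (P2 lam).
    rewrite Hz; destruct (Hi0 lam) as [-> ->]; destruct (Hi0 mu) as [-> ->]; unfold kap; ring. }
  rewrite EW in HL.
  pose proof (is_RInt_scal _ _ _ (lam - mu) _ HN) as HN'.
  pose proof (is_RInt_minus _ _ _ _ _ _ HL HN') as HM.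
  replace (kap * P0 mu + (mu - lam) * N) with (minus (kap * P0 mu) (scal (lam - mu) N))
    by (unfold minus, plus, opp, scal; simpl; unfold mult; simpl; ring).
  replace (D * Rabs (mu - lam) ^ 2) with
    ((R2 - R1) * (V * C * R2 ^ (d - 1) * Rabs (mu - lam) ^ 2)) by (unfold D; ring).
  refine (norm_RInt_le_const _ R1 R2 _ _ (Rlt_le _ _ H12) _ HM).
  intros r Hr; unfold minus, plus, opp, scal; simpl; unfold mult; simpl.
  match goal with |- norm ?x <= _ => change (norm x) with (Rabs x) end.
  replace (_ + - _) with ((lam - mu) * (U0 lam r * (U0 mu r - U0 lam r) * r ^ (d - 1))) by ring.
  rewrite !Rabs_mult, (Rabs_minus_sym lam mu).
  assert (A1 : Rabs (U0 lam r) <= V).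
  { specialize (HV r Hr); rewrite clamp_id in HV by exact Hr; exact HV. }
  assert (A2 : Rabs (U0 mu r - U0 lam r) <= C * Rabs (mu - lam)) by (apply HC; trivial; lra).
  assert (A3 : Rabs (r ^ (d - 1)) <= R2 ^ (d - 1)).
  { rewrite Rabs_right by (apply Rle_ge, pow_le; lra); apply pow_incr; lra. }
  replace (V * C * R2 ^ (d - 1) * (Rabs (mu - lam) * (Rabs (mu - lam) * 1))) with
    (Rabs (mu - lam) * (V * (C * Rabs (mu - lam)) * R2 ^ (d - 1))) by ring.
  apply Rmult_le_compat_l; [apply Rabs_pos|].
  apply Rmult_le_compat; [apply Rmult_le_pos; apply Rabs_pos | apply Rabs_pos | | exact A3].
  apply Rmult_le_compat; trivial; apply Rabs_pos. }
(* By [Q] this function is quadratically small at lam, so its derivative kap P0' + N is zero. *)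
set (h := fun mu => kap * P0 mu + (mu - lam) * N).
assert (H1 : is_derive h lam (kap * P0' + N)).
{ unfold h; evar_last.
  - apply (is_derive_plus (fun mu => kap * P0 mu) (fun mu => (mu - lam) * N)).
    + apply is_derive_scal, HP.
    + instantiate (1 := N); auto_derive; [trivial | ring].
  - reflexivity. }
assert (H2 : is_derive h lam 0).
{ apply is_derive_Reals; intros eps Heps.
  assert (Hm : 0 < Rmin 1 (eps / (D + 1))) by (apply Rmin_glb_lt; [lra | apply Rdiv_lt_0_compat; lra]).
  exists (mkposreal _ Hm); simpl; intros k Hk Hkd.
  pose proof (Rmin_l 1 (eps / (D + 1))); pose proof (Rmin_r 1 (eps / (D + 1))).
  specialize (Q (lam + k)); replace (lam + k - lam) with k in Q by ring.
  assert (Hka : 0 < Rabs k) by now apply Rabs_pos_lt.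
  replace ((h (lam + k) - h lam) / k - 0) with ((kap * P0 (lam + k) + k * N) / k)
    by (unfold h; rewrite Hz; field; exact Hk).
  unfold Rdiv; rewrite Rabs_mult, Rabs_inv.
  apply Rle_lt_trans with (D * Rabs k ^ 2 * / Rabs k).
  - apply Rmult_le_compat_r; [apply Rlt_le, Rinv_0_lt_compat; lra | apply Q; lra].
  - replace (D * Rabs k ^ 2 * / Rabs k) with (D * Rabs k) by (field; lra).
    apply Rle_lt_trans with ((D + 1) * Rabs k); [apply Rmult_le_compat_r; lra|].
    apply Rlt_le_trans with ((D + 1) * (eps / (D + 1))); [apply Rmult_lt_compat_l; lra|].
    right; field; lra. }
pose proof (is_derive_unique _ _ _ H1) as E1; pose proof (is_derive_unique _ _ _ H2) as E2.
fold kap; lra.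
Qed.

End Shooting.

(** For a normalised eigenfunction this is the derivative of the eigenvalue in the small parameter
    of that end; the coefficient for k follows on division by 2k. *)
Definition boundary_mass (d : nat) (R0 : R) (t : bool) (u dn : R) : R :=
  side_sign t * (R0 ^ (d - 1) * other_trace t u dn ^ 2).

(** Collects what the perturbation argument needs from the equation. With s1, s2 the side signs and
    N the mass of U0, at a root P0' = - s2 N / (R2^(d-1) P2) and P1 = s1 s2 R1^(d-1) / (R2^(d-1)
    P2). Thus - P1/P0' = s1 R1^(d-1) / N and - P2/P0' = s2 R2^(d-1) P2^2 / N. *)
Lemma characteristic_function (d l : nat) (R1 R2 : R) (t1 t2 : bool) :
  (2 <= d)%nat -> 0 < R1 -> R1 < R2 ->
  exists P0 P0' P0'' P1 P1' P2 P2' P3 P3' : R -> R,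
    C1_class P0 P0' /\ C1_class P0' P0'' /\
    C1_class P1 P1' /\ C1_class P2 P2' /\ C1_class P3 P3' /\
    (forall e1 e2 lam, (exists u du, trace_solution d l R1 R2 t1 t2 e1 e2 lam u du) <->
       P0 lam + perturbation P1 P2 P3 e1 e2 lam = 0) /\
    (forall lam, P0 lam = 0 -> P0' lam <> 0) /\
    (forall lam u du, P0 lam = 0 -> trace_solution d l R1 R2 t1 t2 0 0 lam u du ->
       is_RInt (fun r => Rabs (u r) ^ 2 * r ^ (d - 1)) R1 R2 1 ->
       other_trace t1 (u R1) (- du R1) <> 0 /\ other_trace t2 (u R2) (du R2) <> 0 /\
       - (P1 lam / P0' lam) = boundary_mass d R1 t1 (u R1) (- du R1) /\
       - (P2 lam / P0' lam) = boundary_mass d R2 t2 (u R2) (du R2)).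
Proof.
intros Hd R1p H12.
destruct (radial_solutions d l R1 R2 (if t1 then 0 else 1) (if t1 then -1 else 0) Hd R1p H12)
  as (U0 & DU0 & Hi0 & Hs0 & Su0 & Sd0 & Hlip).
destruct (radial_solutions d l R1 R2 (if t1 then -1 else 0) (if t1 then 0 else 1) Hd R1p H12)
  as (U1 & DU1 & Hi1 & Hs1 & Su1 & Sd1 & _).
assert (S0 : C2_class (fun lam => vanishing_trace t2 (U0 lam R2) (DU0 lam R2))) by (destruct t2; assumption).
assert (S1 : C2_class (fun lam => vanishing_trace t2 (U1 lam R2) (DU1 lam R2))) by (destruct t2; assumption).
assert (S2 : C2_class (fun lam => other_trace t2 (U0 lam R2) (DU0 lam R2))) by (destruct t2; assumption).
assert (S3 : C2_class (fun lam => other_trace t2 (U1 lam R2) (DU1 lam R2))) by (destruct t2; assumption).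
set (P0 := fun lam => vanishing_trace t2 (U0 lam R2) (DU0 lam R2)) in *.
set (P1 := fun lam => vanishing_trace t2 (U1 lam R2) (DU1 lam R2)) in *.
set (P2 := fun lam => other_trace t2 (U0 lam R2) (DU0 lam R2)) in *.
set (P3 := fun lam => other_trace t2 (U1 lam R2) (DU1 lam R2)) in *.
destruct S0 as (P0' & P0'' & C0 & C0'); destruct S1 as (P1' & _ & HC1 & _).
destruct S2 as (P2' & _ & HC2 & _); destruct S3 as (P3' & _ & HC3 & _).
exists P0, P0', P0'', P1, P1', P2, P2', P3, P3'.
assert (W2 : 0 < R2 ^ (d - 1)) by (apply pow_lt; lra).
assert (W1 : 0 < R1 ^ (d - 1)) by (apply pow_lt; lra).
assert (Hder : forall lam N, P0 lam = 0 ->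
  is_RInt (fun r => U0 lam r * U0 lam r * r ^ (d - 1)) R1 R2 N ->
  R2 ^ (d - 1) * (side_sign t2 * P2 lam) * P0' lam = - N).
{ intros lam N Hz HN.
  exact (shooting_derivative d l R1 R2 t1 t2 Hd R1p H12 U0 DU0 Hi0 Hs0 lam N (P0' lam)
    Hlip HN (proj1 (C0 lam)) Hz). }
split; [exact C0|]; split; [exact C0'|]; split; [exact HC1|]; split; [exact HC2|]; split; [exact HC3|].
split; [exact (shooting_characteristic d l R1 R2 t1 t2 Hd R1p H12 U0 DU0 U1 DU1 Hi0 Hi1 Hs0 Hs1)|].
split.
- intros lam Hz Hn.
  destruct (shooting_mass d l R1 R2 t1 Hd R1p H12 U0 DU0 Hi0 Hs0 lam) as [N [Np HN]].
  specialize (Hder lam N Hz HN); rewrite Hn in Hder; lra.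
- intros lam u du Hz (Hu & B1 & B2 & Hn) Hint.
  destruct (shooting_mass d l R1 R2 t1 Hd R1p H12 U0 DU0 Hi0 Hs0 lam) as [N [Np HN]].
  specialize (Hder lam N Hz HN).
  assert (HW := shooting_wronskian d l R1 R2 t1 t2 Hd R1p H12 U0 DU0 U1 DU1 Hi0 Hi1 Hs0 Hs1 lam Hz).
  change (R2 ^ (d - 1) * (side_sign t2 * (P2 lam * P1 lam)) = side_sign t1 * R1 ^ (d - 1)) in HW.
  assert (Huq := shooting_unique d l R1 R2 t1 Hd R1p H12 U0 DU0 U1 DU1 Hi0 Hi1 Hs0 Hs1 0 lam u du Hu B1).
  simpl in Huq; set (y := other_trace t1 (u R1) (- du R1)) in *.
  (* The normalised eigenfunction is y U0, so 1/N is the square of its complementary trace at R1. *)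
  assert (Ey : y ^ 2 * N = 1).
  { apply (is_RInt_scal _ _ _ (y ^ 2)) in HN.
    rewrite <- (is_RInt_unique _ _ _ _ Hint); symmetry.
    apply is_RInt_unique, (is_RInt_ext _ _ _ _ _ ) with (2 := HN).
    intros r; rewrite Rmin_left, Rmax_right by lra; intros Hr.
    destruct (Huq r ltac:(lra)) as [-> _]; rewrite pow2_abs.
    unfold scal; simpl; unfold mult; simpl; ring. }
  assert (Y2 : other_trace t2 (u R2) (du R2) = y * P2 lam).
  { destruct (Huq R2 ltac:(lra)) as [-> ->]; unfold P2, other_trace; destruct t2; ring. }
  assert (Hy : y <> 0) by (intros E; rewrite E in Ey; lra).
  assert (HP2 : P2 lam <> 0) by (intros E; rewrite E in Hder; lra).
  assert (HP0' : P0' lam <> 0) by (intros E; rewrite E in Hder; lra).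
  assert (Hs2 : side_sign t2 * side_sign t2 = 1) by (destruct t2; unfold side_sign; ring).
  assert (Hs2' : side_sign t2 <> 0) by (destruct t2; unfold side_sign; lra).
  assert (EP0' : P0' lam = - N * side_sign t2 / (R2 ^ (d - 1) * P2 lam)).
  { rewrite <- Hder; transitivity (P0' lam * (side_sign t2 * side_sign t2));
      [rewrite Hs2; ring | field; split; [exact HP2 | lra]]. }
  assert (EP1 : P1 lam = side_sign t1 * R1 ^ (d - 1) * side_sign t2 / (R2 ^ (d - 1) * P2 lam)).
  { rewrite <- HW; transitivity (P1 lam * (side_sign t2 * side_sign t2));
      [rewrite Hs2; ring | field; split; [exact HP2 | lra]]. }
  assert (EN : y ^ 2 = / N) by (apply Rmult_eq_reg_r with N; [rewrite Ey; field|]; lra).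
  split; [exact Hy|]; split; [rewrite Y2; now apply Rmult_integral_contrapositive|].
  unfold boundary_mass; split.
  + fold y; rewrite EN, EP0', EP1; field; repeat split; trivial; lra.
  + rewrite Y2, Rpow_mult_distr, EN, EP0'.
    transitivity (R2 ^ (d - 1) * P2 lam ^ 2 / N / side_sign t2); [field; repeat split; trivial; lra|].
    transitivity (R2 ^ (d - 1) * P2 lam ^ 2 / N * (side_sign t2 * side_sign t2) / side_sign t2);
      [rewrite Hs2; field; repeat split; trivial; lra | field; repeat split; trivial; lra].
Qed.

(** * From eigenvalues to resonances *)

Lemma is_nth_smallest_ext (E E' : R -> Prop) (p : nat) (x : R) :
  (forall y, E y <-> E' y) -> is_nth_smallest E p x -> is_nth_smallest E' p x.
Proof.
intros H [Hx [s [Nd [Hl Hs]]]]; split; [now apply H|].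
exists s; split; [exact Nd|]; split; [exact Hl|]; intros y; rewrite Hs; now rewrite H.
Qed.

(** Squaring is an increasing bijection of the positive numbers; positivity of all of E ensures that
    no element below k^2 is missed. *)
Lemma is_nth_smallest_square (E : R -> Prop) (p : nat) (k : R) :
  (forall y, E y -> 0 < y) -> is_nth_smallest (fun k => 0 < k /\ E (k ^ 2)) p k ->
  is_nth_smallest E p (k ^ 2).
Proof.
intros Hpos [[Hk Ek] [s [Nd [Hl Hs]]]]; split; [exact Ek|].
exists (map (fun k => k ^ 2) s); split; [|split].
- assert (Hp : forall x, In x s -> 0 < x) by (intros x Hx; now apply Hs in Hx).
  clear - Nd Hp; induction Nd as [|x s Hx Nd IH]; simpl; constructor.
  + intros Hi; apply in_map_iff in Hi; destruct Hi as [x' [E Hx']].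
    assert (x' = x); [|now subst].
    pose proof (Hp x (or_introl eq_refl)); pose proof (Hp x' (or_intror Hx')).
    apply Rsqr_inj; unfold Rsqr; lra.
  + apply IH; intros; apply Hp; now right.
- now rewrite length_map.
- intros y; rewrite in_map_iff; split.
  + intros [x [<- Hx]]; apply Hs in Hx; destruct Hx as [[Hx Ex] Hxk]; split; [exact Ex|].
    assert (x * x < k * k) by (apply Rmult_le_0_lt_compat; lra); lra.
  + intros [Ey Hy]; pose proof (Hpos y Ey) as Hyp.
    assert (Esq : sqrt y ^ 2 = y) by (apply pow2_sqrt; lra).
    exists (sqrt y); split; [exact Esq|]; apply Hs; split; [split|].
    * now apply sqrt_lt_R0.
    * now rewrite Esq.
    * apply Rsqr_incrst_0; [unfold Rsqr; lra | apply sqrt_pos | lra].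
Qed.

Lemma C1_class_square (f f' : R -> R) :
  C1_class f f' -> C1_class (fun k => f (k ^ 2)) (fun k => 2 * k * f' (k ^ 2)).
Proof.
intros Hf k.
assert (Hsq : is_derive (fun k => k ^ 2) k (2 * k)) by (auto_derive; [trivial | ring]).
split; [apply (is_derive_comp f (fun k => k ^ 2)); [apply Hf | exact Hsq]|].
apply (continuous_mult (fun k => 2 * k) (fun k => f' (k ^ 2))).
- apply (ex_derive_continuous (fun k => 2 * k)); auto_derive; trivial.
- apply (continuous_comp (fun k => k ^ 2) f'); [|apply Hf].
  apply (ex_derive_continuous (fun k => k ^ 2)); eexists; exact Hsq.
Qed.

Lemma C1_class_double_mult (f f' : R -> R) :
  C1_class f f' -> C1_class (fun k => 2 * k * f k) (fun k => 2 * f k + 2 * k * f' k).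
Proof.
intros Hf k; destruct (Hf k) as [D1 D2].
assert (Hl : forall c, is_derive (fun k => 2 * k) c 2) by (intros; auto_derive; [trivial | ring]).
split.
- apply (is_derive_mult (fun k => 2 * k) f); [apply Hl | exact D1 | intros; apply Rmult_comm].
- apply (continuous_plus (fun k => 2 * f k) (fun k => 2 * k * f' k)).
  + apply (continuous_scal_r 2 f), (ex_derive_continuous f); now exists (f' k).
  + apply (continuous_mult (fun k => 2 * k) f'); [|exact D2].
    apply (ex_derive_continuous (fun k => 2 * k)); eexists; apply Hl.
Qed.

(** Roots are counted in lam, where every limiting eigenvalue is a simple root of P0, whereas the
    expansion is taken for P0 (k^2), whose derivative 2 k0 P0' (k0^2) is nonzero and yields the
    denominators 2 k0. *)
Theorem resonance_expansion (d l : nat) (R1 R2 : R) (t1 t2 : bool) (p : nat) (k0 : R) (u du : R -> R) :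
  (2 <= d)%nat -> 0 < R1 -> R1 < R2 -> (1 <= p)%nat ->
  (t1 = false -> t2 = false -> (l, p) <> (0%nat, 1%nat)) ->
  limit_resonance d l R1 R2 (limit_bc t1) (limit_bc t2) p k0 ->
  normalised_eigenfunction d l R1 R2 (limit_bc t1) (limit_bc t2) (k0 ^ 2) u du ->
  let K1 := boundary_mass d R1 t1 (u R1) (- du R1) / (2 * k0) in
  let K2 := boundary_mass d R2 t2 (u R2) (du R2) / (2 * k0) in
  0 < side_sign t1 * K1 /\ 0 < side_sign t2 * K2 /\
  exists D C, 0 < D /\ 0 <= C /\ forall e1 e2 k, 0 < e1 < D -> 0 < e2 < D ->
    is_nth_smallest
      (fun k => 0 < k /\ eigenvalue d l R1 R2 (robin_bc t1 e1) (robin_bc t2 e2) (k ^ 2)) p k ->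
    Rabs (k - (k0 + K1 * e1 + K2 * e2)) <= C * (e1 ^ 2 + e2 ^ 2).
Proof.
intros Hd R1p H12 Hp Hlp [k0nn Hnth] [Hef Hint] K1 K2.
destruct (characteristic_function d l R1 R2 t1 t2 Hd R1p H12) as
  (P0 & P0' & P0'' & P1 & P1' & P2 & P2' & P3 & P3' & C0 & C0' & HC1 & HC2 & HC3 & Hch & Hsimple & Hcoef).
assert (Hlim : forall lam, eigenvalue d l R1 R2 (limit_bc t1) (limit_bc t2) lam <-> P0 lam = 0).
{ intros lam; rewrite <- (Rplus_0_r (P0 lam)).
  replace 0 with (perturbation P1 P2 P3 0 0 lam) at 1 by (unfold perturbation; ring).
  rewrite <- (Hch 0 0 lam); unfold eigenvalue.
  split; intros [v [dv Hv]]; exists v, dv; now apply eigenfunction_limit_trace. }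
assert (Hrob : forall e1 e2, 0 < e1 -> 0 < e2 -> forall lam,
  eigenvalue d l R1 R2 (robin_bc t1 e1) (robin_bc t2 e2) lam <->
  P0 lam + perturbation P1 P2 P3 e1 e2 lam = 0).
{ intros e1 e2 He1 He2 lam; rewrite <- (Hch e1 e2 lam); unfold eigenvalue.
  split; intros [v [dv Hv]]; exists v, dv; now apply eigenfunction_robin_trace. }
assert (Hnr : forall t b, limit_bc t = Robin b -> 0 < b) by (intros [] b; discriminate).
assert (Hz : P0 (k0 ^ 2) = 0) by apply Hlim, Hnth.
assert (Hnn : forall x, P0 x = 0 -> 0 <= x).
{ intros x Hx; apply Hlim, eigenvalue_nonneg in Hx; trivial; try apply Hnr; apply Hx. }
(* If k0 = 0, then 0 is an eigenvalue, so both conditions are Neumann and l = 0; no eigenvalue lies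
   below it, so p = 1, the excluded case. *)
assert (k0p : 0 < k0).
{ destruct (Rle_lt_or_eq_dec 0 k0 k0nn) as [|E]; [assumption|exfalso].
  assert (E0 : k0 ^ 2 = 0) by (rewrite <- E; ring).
  destruct Hnth as [Hev [s [_ [Hl Hs]]]].
  apply eigenvalue_nonneg in Hev; trivial; try apply Hnr.
  destruct (proj2 Hev E0) as (El & Eb1 & Eb2).
  assert (s = []).
  { destruct s as [|x s]; [reflexivity|exfalso].
    destruct (proj1 (Hs x) (or_introl eq_refl)) as [Hx Hxl].
    apply Hlim, Hnn in Hx; lra. }
  apply Hlp; [now destruct t1 | now destruct t2|]; subst; reflexivity. }
apply eigenfunction_limit_trace in Hef.
destruct (Hcoef (k0 ^ 2) u du Hz Hef Hint) as (Y1 & Y2 & E1 & E2).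
assert (Hsgn : forall t R0 y z, 0 < R0 -> other_trace t y z <> 0 ->
  0 < side_sign t * (boundary_mass d R0 t y z / (2 * k0))).
{ intros t R0 y z HR Hy.
  replace (side_sign t * (boundary_mass d R0 t y z / (2 * k0))) with
    (R0 ^ (d - 1) * other_trace t y z ^ 2 / (2 * k0))
    by (unfold boundary_mass; destruct t; unfold side_sign; field; lra).
  apply Rdiv_lt_0_compat; [|lra].
  apply Rmult_lt_0_compat; [now apply pow_lt | now apply pow2_gt_0]. }
split; [now apply Hsgn|]; split; [apply Hsgn; trivial; lra|].
pose proof (Hsimple _ Hz) as HP0'.
destruct (root_expansion (fun k => P0 (k ^ 2)) _ _ (fun k => P1 (k ^ 2)) _ (fun k => P2 (k ^ 2)) _
  (fun k => P3 (k ^ 2)) _ k0 (C1_class_square _ _ C0) (C1_class_double_mult _ _ (C1_class_square _ _ C0'))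
  (C1_class_square _ _ HC1) (C1_class_square _ _ HC2) (C1_class_square _ _ HC3) Hz) as (D & C & Dp & HE).
{ apply Rmult_integral_contrapositive; split; [lra | exact HP0']. }
(* The tolerance D k0 on k^2 gives |k - k0| < D, because k + k0 >= k0. *)
destruct (nth_root_close P0 P0' P0'' P1 P1' P2 P2' P3 P3' p (k0 ^ 2) (D * k0)) as (D' & Dp' & HD'); trivial.
{ now apply (is_nth_smallest_ext _ _ _ _ Hlim). }
{ apply Rmult_lt_0_compat; lra. }
exists (Rmin D D'), (Rabs C).
split; [apply Rmin_glb_lt; lra|]; split; [apply Rabs_pos|].
intros e1 e2 k He1 He2 Hk.
pose proof (Rmin_l D D'); pose proof (Rmin_r D D').
assert (He1p : 0 < e1) by lra; assert (He2p : 0 < e2) by lra.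
assert (Hpos : forall y, P0 y + perturbation P1 P2 P3 e1 e2 y = 0 -> 0 < y).
{ intros y Hy; apply Hrob in Hy; trivial.
  apply eigenvalue_nonneg in Hy; trivial.
  - destruct Hy as [H1 H2]; destruct (Rle_lt_or_eq_dec 0 y H1) as [|E]; [assumption|].
    destruct (H2 (eq_sym E)) as (_ & Hb & _); discriminate Hb.
  - intros a Ha; injection Ha as <-; destruct t1; [now apply Rinv_0_lt_compat | exact He1p].
  - intros a Ha; injection Ha as <-; destruct t2; [now apply Rinv_0_lt_compat | exact He2p]. }
pose proof (proj1 (proj1 Hk)) as kp.
assert (Hk2 := Hk); apply is_nth_smallest_square in Hk2; [|intros y Hy; apply Hpos, (Hrob e1 e2); trivial].
apply (is_nth_smallest_ext _ _ _ _ (Hrob e1 e2 He1p He2p)) in Hk2.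
specialize (HD' e1 e2 (k ^ 2) ltac:(lra) ltac:(lra) Hpos Hk2).
assert (Hkk : Rabs (k - k0) < D).
{ apply Rmult_lt_reg_r with k0; [exact k0p|]; apply Rle_lt_trans with (2 := HD').
  replace (k ^ 2 - k0 ^ 2) with ((k - k0) * (k + k0)) by ring.
  rewrite Rabs_mult, (Rabs_right (k + k0)) by lra.
  apply Rmult_le_compat_l; [apply Rabs_pos | lra]. }
specialize (HE e1 e2 k ltac:(lra) ltac:(lra) Hkk (proj1 Hk2)).
apply Rle_trans with (C * (e1 ^ 2 + e2 ^ 2)).
- eapply Rle_trans; [right|exact HE]; f_equal; unfold K1, K2; rewrite <- E1, <- E2; field; lra.
- apply Rmult_le_compat_r; [|apply Rle_abs].
  pose proof (pow2_ge_0 e1); pose proof (pow2_ge_0 e2); lra.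
Qed.

(** * Passage to limits in the Robin parameters *)

Definition limit_filter (t : bool) : (R -> Prop) -> Prop :=
  if t then Rbar_locally p_infty else at_right 0.
Definition small_parameter (t : bool) (alpha : R) : R := if t then / alpha else alpha.

Lemma limit_filter_small (t : bool) (D : R) : 0 < D ->
  limit_filter t (fun alpha => 0 < alpha /\ 0 < small_parameter t alpha < D).
Proof.
intros HD; destruct t; simpl.
- exists (/ D); intros x Hx; assert (0 < / D) by now apply Rinv_0_lt_compat.
  split; [lra|]; split; [apply Rinv_0_lt_compat; lra|].
  rewrite <- (Rinv_inv D); apply Rinv_lt_contravar; [apply Rmult_lt_0_compat; lra | exact Hx].
- exists (mkposreal D HD); intros x Hx Hx0; change (Rabs (x - 0) < D) in Hx.
  rewrite Rminus_0_r, Rabs_right in Hx by lra; lra.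
Qed.

Lemma robin_resonance_expansion (d l : nat) (R1 R2 : R) (t1 t2 : bool) (p : nat) (k : R -> R -> R)
    (k0 : R) (u du : R -> R) :
  (2 <= d)%nat -> 0 < R1 -> R1 < R2 -> (1 <= p)%nat ->
  (forall alpha1 alpha2 : R, 0 < alpha1 -> 0 < alpha2 ->
     robin_resonance d l R1 R2 alpha1 alpha2 p (k alpha1 alpha2)) ->
  (t1 = false -> t2 = false -> (l, p) <> (0%nat, 1%nat)) ->
  limit_resonance d l R1 R2 (limit_bc t1) (limit_bc t2) p k0 ->
  normalised_eigenfunction d l R1 R2 (limit_bc t1) (limit_bc t2) (k0 ^ 2) u du ->
  let K1 := boundary_mass d R1 t1 (u R1) (- du R1) / (2 * k0) in
  let K2 := boundary_mass d R2 t2 (u R2) (du R2) / (2 * k0) in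
  0 < side_sign t1 * K1 /\ 0 < side_sign t2 * K2 /\
  exists C, 0 <= C /\ filter_prod (limit_filter t1) (limit_filter t2)
    (fun '(alpha1, alpha2) =>
       let e1 := small_parameter t1 alpha1 in let e2 := small_parameter t2 alpha2 in
       0 < e1 /\ 0 < e2 /\
       Rabs (k alpha1 alpha2 - (k0 + K1 * e1 + K2 * e2)) <= C * (e1 ^ 2 + e2 ^ 2)).
Proof.
intros Hd R1p H12 Hp Hk Hlp Hlim Hnorm K1 K2.
destruct (resonance_expansion d l R1 R2 t1 t2 p k0 u du Hd R1p H12 Hp Hlp Hlim Hnorm)
  as (S1 & S2 & D & C & Dp & Cp & HE).
split; [exact S1|]; split; [exact S2|]; exists C; split; [exact Cp|].
apply (Filter_prod _ _ _ _ _ (limit_filter_small t1 D Dp) (limit_filter_small t2 D Dp)).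
intros alpha1 alpha2 [A1 B1] [A2 B2]; simpl.
split; [apply B1|]; split; [apply B2|]; apply HE; trivial.
assert (Hb : forall t alpha, robin_bc t (small_parameter t alpha) = Robin alpha).
{ intros [] alpha; unfold robin_bc, small_parameter; [now rewrite Rinv_inv | reflexivity]. }
rewrite !Hb; now apply Hk.
Qed.

Lemma is_bigO_prod (t1 t2 : bool) (C C' : R) (B : R -> R -> R) (f g : R * R -> R) :
  filter_prod (limit_filter t1) (limit_filter t2)
    (fun '(alpha1, alpha2) =>
       let e1 := small_parameter t1 alpha1 in let e2 := small_parameter t2 alpha2 in
       0 < e1 /\ 0 < e2 /\ B alpha1 alpha2 <= C * (e1 ^ 2 + e2 ^ 2)) ->
  (forall alpha1 alpha2,
     let e1 := small_parameter t1 alpha1 in let e2 := small_parameter t2 alpha2 in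
     0 < e1 -> 0 < e2 -> B alpha1 alpha2 <= C * (e1 ^ 2 + e2 ^ 2) ->
     Rabs (f (alpha1, alpha2)) <= C' * Rabs (g (alpha1, alpha2))) ->
  is_bigO (filter_prod (limit_filter t1) (limit_filter t2)) f g.
Proof.
intros [Q1 Q2 H1 H2 HQ] H; exists C'.
apply (Filter_prod _ _ _ _ _ H1 H2); intros alpha1 alpha2 A1 A2.
destruct (HQ alpha1 alpha2 A1 A2) as (E1 & E2 & E3); now apply H.
Qed.

Lemma le_quadratic_form (x C e1 e2 : R) : 0 <= C -> 0 < e1 -> 0 < e2 ->
  x <= C * (e1 ^ 2 + e2 ^ 2) -> x <= C * Rabs (e1 ^ 2 + e1 * e2 + e2 ^ 2).
Proof.
intros HC H1 H2 H; apply Rle_trans with (1 := H); apply Rmult_le_compat_l; [exact HC|].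
assert (0 < e1 * e2) by now apply Rmult_lt_0_compat.
pose proof (Rle_abs (e1 ^ 2 + e1 * e2 + e2 ^ 2)); lra.
Qed.

(** * Bessel functions of half-integer order *)

Definition gauss_product (z : R) (n : nat) : R :=
  prod_f_R0 (fun j => z + INR j) n / (INR (fact n) * Rpower (INR n) z).

Lemma prod_shift (z : R) (n : nat) :
  z * prod_f_R0 (fun j => z + 1 + INR j) n = prod_f_R0 (fun j => z + INR j) n * (z + INR (S n)).
Proof.
induction n as [|n IH]; [simpl; ring|].
cbn [prod_f_R0]; rewrite <- Rmult_assoc, IH, !S_INR; ring.
Qed.

(** The functional equation of 1/Gamma before the limit; the extra factor (z + n + 1)/n tends to
    1. *)
Lemma gauss_product_step (z : R) (n : nat) : (1 <= n)%nat ->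
  z * gauss_product (z + 1) n = gauss_product z n * ((z + INR (S n)) / INR n).
Proof.
intros Hn; unfold gauss_product.
assert (0 < INR n) by (apply lt_0_INR; lia).
rewrite Rpower_plus, Rpower_1 by assumption.
pose proof (INR_fact_lt_0 n); assert (0 < Rpower (INR n) z) by apply exp_pos.
transitivity (z * prod_f_R0 (fun j => z + 1 + INR j) n / (INR (fact n) * (Rpower (INR n) z * INR n)));
  [field; lra|].
rewrite prod_shift; field; lra.
Qed.

Lemma lim_shift_ratio (z : R) : is_lim_seq (fun n => (z + INR (S n)) / INR n) 1.
Proof.
apply (is_lim_seq_ext_loc (fun n => 1 + (z + 1) * / INR n)).
- exists 1%nat; intros n Hn; assert (0 < INR n) by (apply lt_0_INR; lia).
  rewrite S_INR; field; lra.
- replace (Finite 1) with (Finite (1 + (z + 1) * 0)) by (f_equal; ring).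
  apply is_lim_seq_plus'; [apply is_lim_seq_const|].
  apply is_lim_seq_scal_l with (lu := Finite 0).
  replace (Finite 0) with (Rbar_inv p_infty) by reflexivity.
  apply is_lim_seq_inv; [apply is_lim_seq_INR | discriminate].
Qed.

(** With its converse below, this carries convergence from 1/2 to every half-integer in both
    directions. *)
Lemma gauss_product_up (z L : R) : z <> 0 ->
  is_lim_seq (gauss_product z) L -> is_lim_seq (gauss_product (z + 1)) (L / z).
Proof.
intros Hz HL.
apply (is_lim_seq_ext_loc (fun n => / z * (gauss_product z n * ((z + INR (S n)) / INR n)))).
- exists 1%nat; intros n Hn; rewrite <- gauss_product_step by exact Hn; field; exact Hz.
- replace (Finite (L / z)) with (Rbar_mult (/ z) (L * 1)) by (simpl; f_equal; field; exact Hz).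
  apply is_lim_seq_scal_l, is_lim_seq_mult'; [exact HL | apply lim_shift_ratio].
Qed.

Lemma gauss_product_down (z L : R) :
  is_lim_seq (gauss_product (z + 1)) L -> is_lim_seq (gauss_product z) (z * L).
Proof.
intros HL.
apply (is_lim_seq_ext_loc (fun n => z * gauss_product (z + 1) n * / ((z + INR (S n)) / INR n))).
(* Past |z| the factor z + n + 1 is nonzero and may be divided by. *)
- destruct (nfloor_ex (Rabs z) (Rabs_pos z)) as [N HN].
  exists (S N); intros n Hn; rewrite gauss_product_step by lia.
  assert (0 < INR n) by (apply lt_0_INR; lia).
  assert (INR (S N) <= INR n) by (apply le_INR; lia).
  assert (z + INR (S n) <> 0).
  { rewrite S_INR in *; intros E; revert HN; rabs_lra. }
  field; lra.
- replace (Finite (z * L)) with (Finite (z * L * / 1)) by (f_equal; field).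
  apply is_lim_seq_mult'; [apply (is_lim_seq_scal_l (gauss_product (z + 1)) z L HL)|].
  apply (is_lim_seq_inv (fun n => (z + INR (S n)) / INR n) 1); [apply lim_shift_ratio|].
  intros E; injection E; lra.
Qed.

(* The squares of the Gauss products at 1/2 decrease, and stay above the increasing
   sequence with N + 1 in place of N. *)
Lemma gauss_product_half : exists g, 0 < g /\ is_lim_seq (gauss_product (/ 2)) g.
Proof.
set (P := prod_f_R0 (fun j => / 2 + INR j)).
assert (HP : forall n, 0 < P n).
{ intros n; induction n as [|n IH]; unfold P in *; cbn [prod_f_R0]; [simpl; lra|].
  apply Rmult_lt_0_compat; [exact IH|]; pose proof (pos_INR (S n)); lra. }
assert (Hpos : forall n, 0 < INR (S n)) by (intros; apply lt_0_INR; lia).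
(* Squaring replaces the power n^(1/2) by n, so the monotonicity claims become rational
   inequalities; starting at index 1 avoids n = 0. *)
set (r := fun n => (P (S n) / INR (fact (S n))) ^ 2).
assert (Hr : forall n, 0 < r n).
{ intros n; apply pow_lt, Rdiv_lt_0_compat; [apply HP | apply INR_fact_lt_0]. }
assert (HS : forall n, r (S n) = r n * ((INR (S n) + 3 / 2) ^ 2 / (INR (S n) + 1) ^ 2)).
{ intros n; unfold r; change (P (S (S n))) with (P (S n) * (/ 2 + INR (S (S n)))).
  rewrite (fact_simpl (S n)), mult_INR, (S_INR (S n)).
  specialize (Hpos n); pose proof (INR_fact_lt_0 (S n)); field; lra. }
assert (Hstep : forall x, 0 < x ->
  (x + 3 / 2) ^ 2 / (x + 1) ^ 2 * / (x + 1) <= / x /\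
  / (x + 1) <= (x + 3 / 2) ^ 2 / (x + 1) ^ 2 * / (x + 1 + 1)).
{ intros x Hx; pose proof (pow_lt (x + 1) 2 ltac:(lra)); pose proof (pow_lt (x + 1) 3 ltac:(lra)).
  split; apply Rminus_le_0.
  - replace (/ x - _) with ((3 / 4 * x + 1) / (x * (x + 1) ^ 3)) by (field; lra).
    apply Rlt_le, Rdiv_lt_0_compat; [lra | apply Rmult_lt_0_compat; lra].
  - replace (_ - / (x + 1)) with (1 / 4 / ((x + 1) ^ 2 * (x + 2))) by (field; lra).
    apply Rlt_le, Rdiv_lt_0_compat; [lra | apply Rmult_lt_0_compat; lra]. }
set (a := fun n => r n * / INR (S n)); set (b := fun n => r n * / (INR (S n) + 1)).
assert (Hdecr : forall n, a (S n) <= a n).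
{ intros n; unfold a; rewrite HS, (S_INR (S n)), Rmult_assoc.
  apply Rmult_le_compat_l; [apply Rlt_le, Hr | apply Hstep, Hpos]. }
assert (Hincr : forall n, b n <= b (S n)).
{ intros n; unfold b; rewrite HS, (S_INR (S n)), Rmult_assoc.
  apply Rmult_le_compat_l; [apply Rlt_le, Hr | apply Hstep, Hpos]. }
assert (Hb0 : 0 < b 0%nat).
{ apply Rmult_lt_0_compat; [apply Hr | apply Rinv_0_lt_compat; specialize (Hpos 0%nat); lra]. }
assert (Hba : forall n, b 0%nat <= a n).
{ intros n; apply Rle_trans with (b n).
  - induction n as [|n IH]; [lra | specialize (Hincr n); lra].
  - specialize (Hpos n); apply Rmult_le_compat_l; [apply Rlt_le, Hr | apply Rinv_le_contravar; lra]. }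
destruct (ex_finite_lim_seq_decr a (b 0%nat) Hdecr Hba) as [g Hg].
assert (Hg0 : b 0%nat <= g).
{ apply (is_lim_seq_le (fun _ => b 0%nat) a (b 0%nat) g Hba); [apply is_lim_seq_const | exact Hg]. }
exists (sqrt g); split; [apply sqrt_lt_R0; lra|].
apply is_lim_seq_incr_1.
apply (is_lim_seq_ext (fun n => sqrt (a n))).
- intros n; unfold a, r, gauss_product; fold P; specialize (Hpos n).
  assert (0 <= P (S n) / INR (fact (S n)))
    by (apply Rlt_le, Rdiv_lt_0_compat; [apply HP | apply INR_fact_lt_0]).
  rewrite Rpower_sqrt, sqrt_mult_alt, sqrt_pow2, sqrt_inv; trivial; [|apply pow2_ge_0].
  pose proof (INR_fact_lt_0 (S n)); pose proof (sqrt_lt_R0 _ Hpos); field; lra.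
- apply (is_lim_seq_continuous sqrt a g); [|exact Hg].
  apply continuity_pt_sqrt; lra.
Qed.

(** A class of arguments closed under integer shifts and reflection and free of zeros of 1/Gamma at
    integers, so the recurrence can be used in both directions. *)
Definition half_integer (z : R) : Prop := exists n : Z, z = IZR n + / 2.

Lemma half_integer_neq_0 (z : R) : half_integer z -> z <> 0.
Proof.
intros [n ->] E.
assert (H : IZR (2 * n + 1) = 0) by (rewrite plus_IZR, mult_IZR; lra).
apply eq_IZR in H; lia.
Qed.

Lemma half_integer_plus (z : R) (n : Z) : half_integer z -> half_integer (z + IZR n).
Proof. intros [m ->]; exists (m + n)%Z; rewrite plus_IZR; ring. Qed.

Lemma half_integer_opp (z : R) : half_integer z -> half_integer (- z).
Proof. intros [m ->]; exists (- m - 1)%Z; rewrite minus_IZR, opp_IZR; lra. Qed.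

Lemma gauss_product_half_integer (z : R) : half_integer z -> exists L : R, is_lim_seq (gauss_product z) L.
Proof.
intros [n ->].
assert (Hn : forall m : nat, (exists L : R, is_lim_seq (gauss_product (IZR (Z.of_nat m) + / 2)) L) /\
                        (exists L : R, is_lim_seq (gauss_product (IZR (- Z.of_nat m) + / 2)) L)).
{ intros m; induction m as [|m [[L1 H1] [L2 H2]]].
  - destruct gauss_product_half as [g [_ Hg]].
    split; exists g; (replace (_ + / 2) with (/ 2) by (simpl; ring)); exact Hg.
  - split.
    + apply gauss_product_up in H1; [|apply half_integer_neq_0; eexists; reflexivity].
      eexists; rewrite Nat2Z.inj_succ, succ_IZR.
      replace (IZR (Z.of_nat m) + 1 + / 2) with (IZR (Z.of_nat m) + / 2 + 1) by ring; exact H1.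
    + eexists; apply gauss_product_down.
      replace (IZR (- Z.of_nat (S m)) + / 2 + 1) with (IZR (- Z.of_nat m) + / 2); [exact H2|].
      rewrite Nat2Z.inj_succ, !opp_IZR, succ_IZR; ring. }
destruct (Z_le_gt_dec 0 n) as [Hz|Hz].
- destruct (Hn (Z.to_nat n)) as [H _]; now rewrite Z2Nat.id in H.
- destruct (Hn (Z.to_nat (- n))) as [_ H]; rewrite Z2Nat.id, Z.opp_involutive in H by lia; exact H.
Qed.

Lemma rgamma_step (z : R) : half_integer z -> rgamma z = z * rgamma (z + 1).
Proof.
intros Hz.
destruct (gauss_product_half_integer (z + 1) (half_integer_plus z 1 Hz)) as [L HL].
unfold rgamma; fold (gauss_product z) (gauss_product (z + 1)).
rewrite (is_lim_seq_unique _ _ HL), (is_lim_seq_unique _ _ (gauss_product_down z L HL)); reflexivity.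
Qed.

Lemma rgamma_half_neq_0 : rgamma (/ 2) <> 0.
Proof.
destruct gauss_product_half as [g [Hg HL]].
unfold rgamma; fold (gauss_product (/ 2)); rewrite (is_lim_seq_unique _ _ HL); simpl; lra.
Qed.

Definition bessel_term (nu y : R) (m : nat) : R :=
  (-1) ^ m / INR (fact m) * rgamma (nu + INR m + 1) * y ^ (2 * m).

(** Keeps the convergence of the series along with its value; the recurrences need it, and the total
    function [Series] does not record it. *)
Definition bessel_sum (nu x v : R) : Prop :=
  exists S, is_series (bessel_term nu (x / 2)) S /\ v = Rpower (x / 2) nu * S.

Lemma bessel_sum_unique (nu x v : R) : bessel_sum nu x v -> besselJ nu x = v.
Proof.
intros [S [HS ->]]; unfold besselJ; fold (bessel_term nu (x / 2)).
now rewrite (is_series_unique _ _ HS).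
Qed.

(** Termwise form of J_(nu-1) + J_(nu+1) = (2 nu / x) J_nu: the constant terms cancel, and the
    remaining index shift absorbs y^2. *)
Lemma bessel_term_recurrence (nu y : R) : half_integer nu ->
  bessel_term (nu - 1) y 0 = nu * bessel_term nu y 0 /\
  forall m, nu * bessel_term nu y (S m) - bessel_term (nu - 1) y (S m) = y ^ 2 * bessel_term (nu + 1) y m.
Proof.
intros Hnu; unfold bessel_term; split.
- replace (nu - 1 + INR 0 + 1) with nu by (simpl; ring).
  replace (nu + INR 0 + 1) with (nu + 1) by (simpl; ring).
  rewrite (rgamma_step nu Hnu) at 1; ring.
- intros m.
  replace (nu - 1 + INR (S m) + 1) with (nu + INR (S m)) by ring.
  rewrite (rgamma_step (nu + INR (S m))) by (rewrite INR_IZR_INZ; now apply half_integer_plus).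
  replace (nu + 1 + INR m + 1) with (nu + INR (S m) + 1) by (rewrite S_INR; ring).
  rewrite fact_simpl, mult_INR.
  replace (2 * S m)%nat with (2 + 2 * m)%nat by lia; rewrite pow_add.
  replace ((-1) ^ S m) with (- (-1) ^ m) by (simpl; ring).
  pose proof (INR_fact_neq_0 m); assert (INR (S m) <> 0) by (apply not_0_INR; lia).
  field; split; assumption.
Qed.

Lemma bessel_sum_up (nu x a b : R) : 0 < x -> half_integer nu ->
  bessel_sum (nu - 1) x a -> bessel_sum nu x b -> bessel_sum (nu + 1) x (2 * nu / x * b - a).
Proof.
intros Hx Hnu [A [HA ->]] [B [HB ->]].
set (y := x / 2) in *; assert (Hy : 0 < y) by (unfold y; lra).
destruct (bessel_term_recurrence nu y Hnu) as [E0 ES].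
exists (/ y ^ 2 * (nu * B - A)); split.
- apply (is_series_ext (fun m => scal (/ y ^ 2) (nu * bessel_term nu y (S m) - bessel_term (nu - 1) y (S m)))).
  { intros m; rewrite ES; change (/ y ^ 2 * (y ^ 2 * bessel_term (nu + 1) y m) = bessel_term (nu + 1) y m); field; lra. }
  apply (is_series_scal (/ y ^ 2) (fun m => nu * bessel_term nu y (S m) - bessel_term (nu - 1) y (S m))).
  apply (is_series_incr_1 (fun m => nu * bessel_term nu y m - bessel_term (nu - 1) y m)).
  match goal with |- is_series _ ?v => replace v with (minus (scal nu B) A) end.
  2:{ rewrite E0; change (nu * B - A = nu * B - A + (nu * bessel_term nu y 0 - nu * bessel_term nu y 0)); ring. }
  apply (is_series_minus (fun m => nu * bessel_term nu y m)); [|exact HA].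
  apply (is_series_scal nu (bessel_term nu y) B HB).
- fold y; replace (nu - 1) with (nu + - (1)) by ring; rewrite !Rpower_plus, Rpower_Ropp, !Rpower_1 by exact Hy.
  replace (2 * nu / x) with (nu / y) by (unfold y; field; lra); field; lra.
Qed.

Lemma bessel_sum_down (nu x b c : R) : 0 < x -> half_integer nu ->
  bessel_sum nu x b -> bessel_sum (nu + 1) x c -> bessel_sum (nu - 1) x (2 * nu / x * b - c).
Proof.
intros Hx Hnu [B [HB ->]] [C [HC ->]].
set (y := x / 2) in *; assert (Hy : 0 < y) by (unfold y; lra).
destruct (bessel_term_recurrence nu y Hnu) as [E0 ES].
exists (nu * B - y ^ 2 * C); split.
- assert (HD : is_series (fun m => nu * bessel_term nu y m - bessel_term (nu - 1) y m) (y ^ 2 * C)).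
  { apply is_series_decr_1.
    match goal with |- is_series _ ?v => replace v with (scal (y ^ 2) C) end.
    2:{ rewrite E0; change (y ^ 2 * C = y ^ 2 * C + - (nu * bessel_term nu y 0 - nu * bessel_term nu y 0)); ring. }
    apply (is_series_ext (fun m => scal (y ^ 2) (bessel_term (nu + 1) y m))).
    { intros m; rewrite ES; reflexivity. }
    apply (is_series_scal (y ^ 2) (bessel_term (nu + 1) y) C HC). }
  apply (is_series_ext (fun m => minus (nu * bessel_term nu y m)
    (nu * bessel_term nu y m - bessel_term (nu - 1) y m))).
  { intros m; change (nu * bessel_term nu y m + - (nu * bessel_term nu y m - bessel_term (nu - 1) y m) = bessel_term (nu - 1) y m); ring. }
  apply (is_series_minus (fun m => nu * bessel_term nu y m)); [|exact HD].
  apply (is_series_scal nu (bessel_term nu y) B HB).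
- fold y; replace (nu - 1) with (nu + - (1)) by ring; rewrite !Rpower_plus, Rpower_Ropp, !Rpower_1 by exact Hy.
  replace (2 * nu / x) with (nu / y) by (unfold y; field; lra); field; lra.
Qed.

Lemma half_integer_half : half_integer (/ 2).
Proof. exists 0%Z; ring. Qed.

(** An instance of the duplication formula, by induction: it turns the coefficients of orders 1/2
    and -1/2 into those of the sine and cosine series. *)
Lemma rgamma_half_plus (m : nat) :
  rgamma (/ 2 + INR m + 1) / INR (fact m) = rgamma (/ 2) * 2 * 4 ^ m / INR (fact (2 * m + 1)) /\
  rgamma (- / 2 + INR m + 1) / INR (fact m) = rgamma (/ 2) * 4 ^ m / INR (fact (2 * m)).
Proof.
assert (Hh : forall m, half_integer (/ 2 + INR m)).
{ intros k; rewrite INR_IZR_INZ; apply half_integer_plus, half_integer_half. }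
induction m as [|m [IH1 IH2]].
- replace (/ 2 + INR 0 + 1) with (/ 2 + 1) by (simpl; ring).
  replace (- / 2 + INR 0 + 1) with (/ 2) by (simpl; field).
  rewrite (rgamma_step (/ 2) half_integer_half); simpl; split; field.
- assert (H1 : rgamma (/ 2 + INR m + 1) = (/ 2 + INR m + 1) * rgamma (/ 2 + INR (S m) + 1)).
  { replace (/ 2 + INR m + 1) with (/ 2 + INR (S m)) by (rewrite S_INR; ring).
    apply rgamma_step, Hh. }
  assert (H2 : rgamma (- / 2 + INR m + 1) = (- / 2 + INR m + 1) * rgamma (- / 2 + INR (S m) + 1)).
  { replace (- / 2 + INR (S m) + 1) with (/ 2 + INR m + 1) by (rewrite S_INR; field).
    replace (- / 2 + INR m + 1) with (/ 2 + INR m) by field.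
    apply rgamma_step, Hh. }
  rewrite H1 in IH1; rewrite H2 in IH2.
  pose proof (pos_INR m); pose proof (INR_fact_lt_0 m).
  pose proof (INR_fact_lt_0 (2 * m + 1)); pose proof (INR_fact_lt_0 (2 * m)).
  replace (2 * S m + 1)%nat with (S (S (2 * m + 1))) by lia.
  replace (2 * S m)%nat with (S (S (2 * m))) by lia.
  rewrite !(fact_simpl (S _)), !(fact_simpl (2 * m + 1)), (fact_simpl (2 * m)), (fact_simpl m), !mult_INR, !S_INR.
  rewrite plus_INR, mult_INR; simpl (INR 2); simpl (INR 1).
  rewrite S_INR in IH1, IH2.
  split.
  + apply Rmult_eq_reg_l with ((/ 2 + INR m + 1) * (INR m + 1)); [|apply Rgt_not_eq; apply Rmult_lt_0_compat; lra].
    transitivity ((/ 2 + INR m + 1) * rgamma (/ 2 + (INR m + 1) + 1) / INR (fact m)); [field; lra|].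
    rewrite IH1; simpl pow; field; lra.
  + apply Rmult_eq_reg_l with ((- / 2 + INR m + 1) * (INR m + 1)); [|apply Rgt_not_eq; apply Rmult_lt_0_compat; lra].
    transitivity ((- / 2 + INR m + 1) * rgamma (- / 2 + (INR m + 1) + 1) / INR (fact m)); [field; lra|].
    rewrite IH2; simpl pow; field; lra.
Qed.

Lemma bessel_sum_half (x : R) : 0 < x ->
  bessel_sum (/ 2) x (rgamma (/ 2) / Rpower (x / 2) (/ 2) * sin x) /\
  bessel_sum (- / 2) x (rgamma (/ 2) / Rpower (x / 2) (/ 2) * cos x).
Proof.
intros Hx.
assert (Hy : 0 < x / 2) by lra.
assert (Hq : 0 < Rpower (x / 2) (/ 2)) by apply exp_pos.
assert (Hqq : Rpower (x / 2) (/ 2) * Rpower (x / 2) (/ 2) = x / 2).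
{ rewrite <- Rpower_plus; replace (/ 2 + / 2) with 1 by field; now apply Rpower_1. }
assert (Hpow : forall m, (x / 2) ^ (2 * m) * 4 ^ m = (x ^ 2) ^ m).
{ intros m; rewrite pow_mult, <- Rpow_mult_distr; f_equal; field. }
split.
- exists (2 * rgamma (/ 2) * (sin x / x)); split.
  + apply (is_series_ext (fun m => scal (2 * rgamma (/ 2)) (sin_n m * (x ^ 2) ^ m))).
    { intros m; destruct (rgamma_half_plus m) as [E _]; unfold bessel_term.
      change (2 * rgamma (/ 2) * (sin_n m * (x ^ 2) ^ m) =
        (-1) ^ m / INR (fact m) * rgamma (/ 2 + INR m + 1) * (x / 2) ^ (2 * m)).
      transitivity ((-1) ^ m * (rgamma (/ 2 + INR m + 1) / INR (fact m)) * (x / 2) ^ (2 * m));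
        [|unfold Rdiv; ring].
      rewrite E, <- Hpow; unfold sin_n, Rdiv; ring. }
    apply (is_series_scal (2 * rgamma (/ 2)) (fun m => sin_n m * (x ^ 2) ^ m)).
    apply is_series_Reals; unfold sin; destruct (exist_sin (Rsqr x)) as [s Hs].
    replace (x * s / x) with s by (field; lra).
    unfold sin_in in Hs; replace (x ^ 2) with (Rsqr x) by (unfold Rsqr; ring); exact Hs.
  + transitivity (rgamma (/ 2) * sin x * (2 / x) * (Rpower (x / 2) (/ 2) * Rpower (x / 2) (/ 2)) / Rpower (x / 2) (/ 2)).
    * rewrite Hqq; field; lra.
    * field; lra.
- exists (rgamma (/ 2) * cos x); split.
  + apply (is_series_ext (fun m => scal (rgamma (/ 2)) (cos_n m * (x ^ 2) ^ m))).
    { intros m; destruct (rgamma_half_plus m) as [_ E]; unfold bessel_term.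
      change (rgamma (/ 2) * (cos_n m * (x ^ 2) ^ m) =
        (-1) ^ m / INR (fact m) * rgamma (- / 2 + INR m + 1) * (x / 2) ^ (2 * m)).
      transitivity ((-1) ^ m * (rgamma (- / 2 + INR m + 1) / INR (fact m)) * (x / 2) ^ (2 * m));
        [|unfold Rdiv; ring].
      rewrite E, <- Hpow; unfold cos_n, Rdiv; ring. }
    apply (is_series_scal (rgamma (/ 2)) (fun m => cos_n m * (x ^ 2) ^ m)).
    apply is_series_Reals; unfold cos; destruct (exist_cos (Rsqr x)) as [s Hs].
    unfold cos_in in Hs; replace (x ^ 2) with (Rsqr x) by (unfold Rsqr; ring); exact Hs.
  + rewrite Rpower_Ropp; unfold Rdiv; ring.
Qed.

(** The recurrence f_(m+1) = (2m+1)/x f_m - f_(m-1); the nested match makes the two-step recursion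
    structural. *)
Fixpoint riccati (f0 f1 : R -> R) (n : nat) (x : R) : R :=
  match n with
  | O => f0 x
  | S m => match m with
           | O => f1 x
           | S j => (2 * INR m + 1) / x * riccati f0 f1 m x - riccati f0 f1 j x
           end
  end.

(* The Riccati-Bessel functions psi_n(x) = x j_n(x) and chi_n(x) = x y_n(x). *)
Definition psi : nat -> R -> R := riccati sin (fun x => sin x / x - cos x).
Definition chi : nat -> R -> R := riccati (fun x => - cos x) (fun x => - cos x / x - sin x).

Lemma riccati_SS (f0 f1 : R -> R) (n : nat) (x : R) :
  riccati f0 f1 (S (S n)) x = (2 * INR (S n) + 1) / x * riccati f0 f1 (S n) x - riccati f0 f1 n x.
Proof. reflexivity. Qed.

(** In closed form this is sqrt (2 / (PI x)); the constant stays unevaluated. *)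
Definition riccati_factor (x : R) : R := rgamma (/ 2) / Rpower (x / 2) (/ 2).

Lemma bessel_sum_psi (n : nat) (x : R) : 0 < x ->
  bessel_sum (INR n + / 2) x (riccati_factor x * psi n x).
Proof.
intros Hx; destruct (bessel_sum_half x Hx) as [H0 Hm]; fold (riccati_factor x) in H0, Hm.
assert (H1 : bessel_sum (INR 1 + / 2) x (riccati_factor x * psi 1 x)).
{ replace (INR 1 + / 2) with (/ 2 + 1) by (simpl; ring).
  replace (riccati_factor x * psi 1 x) with
    (2 * / 2 / x * (riccati_factor x * sin x) - riccati_factor x * cos x)
    by (unfold psi; simpl; field; lra).
  apply bessel_sum_up; [exact Hx | apply half_integer_half | | exact H0].
  replace (/ 2 - 1) with (- / 2) by field; exact Hm. }
assert (H : bessel_sum (INR n + / 2) x (riccati_factor x * psi n x) /\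
            bessel_sum (INR (S n) + / 2) x (riccati_factor x * psi (S n) x)); [|apply H].
induction n as [|n [IH1 IH2]].
- split; [|exact H1]; replace (INR 0 + / 2) with (/ 2) by (simpl; ring); exact H0.
- split; [exact IH2|].
  replace (INR (S (S n)) + / 2) with (INR (S n) + / 2 + 1) by (rewrite (S_INR (S n)); ring).
  unfold psi; rewrite riccati_SS; fold psi.
  replace (riccati_factor x * _) with
    (2 * (INR (S n) + / 2) / x * (riccati_factor x * psi (S n) x) - riccati_factor x * psi n x)
    by (unfold psi; field; lra).
  apply bessel_sum_up; [exact Hx | | | exact IH2].
  + eexists; rewrite INR_IZR_INZ; reflexivity.
  + replace (INR (S n) + / 2 - 1) with (INR n + / 2) by (rewrite S_INR; ring); exact IH1.
Qed.

(** At order nu = n + 1/2 the cosine in the definition of Y vanishes and the sine is (-1)^n, so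
    J_(-nu) = (-1)^(n+1) Y_nu; hence the sign and the downward recurrence. *)
Lemma bessel_sum_chi (n : nat) (x : R) : 0 < x ->
  bessel_sum (- (INR n + / 2)) x ((-1) ^ S n * (riccati_factor x * chi n x)).
Proof.
intros Hx; destruct (bessel_sum_half x Hx) as [H0 Hm]; fold (riccati_factor x) in H0, Hm.
assert (H1 : bessel_sum (- (INR 1 + / 2)) x ((-1) ^ 2 * (riccati_factor x * chi 1 x))).
{ replace (- (INR 1 + / 2)) with (- / 2 - 1) by (simpl; ring).
  replace ((-1) ^ 2 * (riccati_factor x * chi 1 x)) with
    (2 * - / 2 / x * (riccati_factor x * cos x) - riccati_factor x * sin x)
    by (unfold chi; simpl; field; lra).
  apply bessel_sum_down; [exact Hx | apply half_integer_opp, half_integer_half | exact Hm |].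
  replace (- / 2 + 1) with (/ 2) by field; exact H0. }
assert (H : bessel_sum (- (INR n + / 2)) x ((-1) ^ S n * (riccati_factor x * chi n x)) /\
            bessel_sum (- (INR (S n) + / 2)) x ((-1) ^ S (S n) * (riccati_factor x * chi (S n) x)));
  [|apply H].
induction n as [|n [IH1 IH2]].
- split; [|exact H1]; replace (- (INR 0 + / 2)) with (- / 2) by (simpl; ring).
  replace ((-1) ^ 1 * (riccati_factor x * chi 0 x)) with (riccati_factor x * cos x)
    by (unfold chi; simpl; ring); exact Hm.
- split; [exact IH2|].
  replace (- (INR (S (S n)) + / 2)) with (- (INR (S n) + / 2) - 1) by (rewrite (S_INR (S n)); ring).
  unfold chi; rewrite riccati_SS; fold chi.
  replace ((-1) ^ S (S (S n)) * _) with
    (2 * - (INR (S n) + / 2) / x * ((-1) ^ S (S n) * (riccati_factor x * chi (S n) x))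
     - (-1) ^ S n * (riccati_factor x * chi n x))
    by (unfold chi; simpl pow; field; lra).
  apply bessel_sum_down; [exact Hx | | exact IH2 |].
  + apply half_integer_opp; eexists; rewrite INR_IZR_INZ; reflexivity.
  + replace (- (INR (S n) + / 2) + 1) with (- (INR n + / 2)) by (rewrite S_INR; ring); exact IH1.
Qed.

Lemma sin_cos_half_integer_PI (n : nat) :
  sin ((INR n + / 2) * PI) = (-1) ^ n /\ cos ((INR n + / 2) * PI) = 0.
Proof.
induction n as [|n [IH1 IH2]].
- replace ((INR 0 + / 2) * PI) with (PI / 2) by (simpl; field).
  rewrite sin_PI2, cos_PI2; split; reflexivity.
- replace ((INR (S n) + / 2) * PI) with ((INR n + / 2) * PI + PI) by (rewrite S_INR; ring).
  rewrite neg_sin, neg_cos, IH1, IH2; split; simpl; ring.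
Qed.

Lemma besselJ_half_integer (n : nat) (x : R) : 0 < x ->
  besselJ (INR n + / 2) x = riccati_factor x * psi n x.
Proof. intros Hx; now apply bessel_sum_unique, bessel_sum_psi. Qed.

Lemma besselY_half_integer (n : nat) (x : R) : 0 < x ->
  besselY (INR n + / 2) x = riccati_factor x * chi n x.
Proof.
intros Hx; unfold besselY, besselY_quotient.
destruct (sin_cos_half_integer_PI n) as [-> ->].
assert (Hn : (-1) ^ n <> 0) by (apply pow_nonzero; lra).
destruct (Req_EM_T ((-1) ^ n) 0) as [E|_]; [contradiction|].
rewrite (bessel_sum_unique _ _ _ (bessel_sum_chi n x Hx)); simpl pow; field; exact Hn.
Qed.

(** The two formulas are proved together because the formula for index n + 2 uses both at the
    preceding step. *)
Lemma riccati_derive (f0 f1 : R -> R) :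
  (forall x, 0 < x -> is_derive f0 x (f0 x / x - f1 x)) ->
  (forall x, 0 < x -> is_derive f1 x (f0 x - f1 x / x)) ->
  forall n x, 0 < x ->
    is_derive (riccati f0 f1 n) x (INR (S n) / x * riccati f0 f1 n x - riccati f0 f1 (S n) x) /\
    is_derive (riccati f0 f1 (S n)) x (riccati f0 f1 n x - INR (S n) / x * riccati f0 f1 (S n) x).
Proof.
intros H0 H1 n; induction n as [|n IH]; intros x Hx.
- split; simpl.
  + replace (1 / x * f0 x - f1 x) with (f0 x / x - f1 x) by (field; lra); now apply H0.
  + replace (f0 x - 1 / x * f1 x) with (f0 x - f1 x / x) by (field; lra); now apply H1.
- destruct (IH x Hx) as [D1 D2]; split.
  + evar_last; [exact D2|].
    rewrite riccati_SS, (S_INR (S n)); generalize (riccati f0 f1 (S n) x) (riccati f0 f1 n x) (INR (S n)); intros; field; lra.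
  + apply (is_derive_ext (fun x => (2 * INR (S n) + 1) / x * riccati f0 f1 (S n) x - riccati f0 f1 n x));
      [reflexivity|].
    evar_last.
    * apply (is_derive_minus (fun x => (2 * INR (S n) + 1) / x * riccati f0 f1 (S n) x));
        [|exact D1].
      apply (is_derive_mult (fun x => (2 * INR (S n) + 1) / x) (riccati f0 f1 (S n)));
        [|exact D2 | intros; apply Rmult_comm].
      instantiate (1 := - (2 * INR (S n) + 1) / x ^ 2); generalize (2 * INR (S n) + 1); intros c;
        auto_derive; [lra | field; lra].
    * rewrite riccati_SS, (S_INR (S n)).
      generalize (riccati f0 f1 (S n) x) (riccati f0 f1 n x) (INR (S n)); intros b a z.
      unfold minus, plus, opp, mult; simpl; field; lra.
Qed.

Lemma psi_derive (n : nat) (x : R) : 0 < x ->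
  is_derive (psi n) x (INR (S n) / x * psi n x - psi (S n) x) /\
  is_derive (psi (S n)) x (psi n x - INR (S n) / x * psi (S n) x).
Proof.
apply riccati_derive; intros y Hy; auto_derive; try lra; field; lra.
Qed.

Lemma chi_derive (n : nat) (x : R) : 0 < x ->
  is_derive (chi n) x (INR (S n) / x * chi n x - chi (S n) x) /\
  is_derive (chi (S n)) x (chi n x - INR (S n) / x * chi (S n) x).
Proof.
apply riccati_derive; intros y Hy; auto_derive; try lra; field; lra.
Qed.

(** The recurrence leaves the determinant unchanged, and for n = 0 it is - (sin^2 + cos^2). *)
Lemma psi_chi_casoratian (n : nat) (x : R) : 0 < x ->
  psi n x * chi (S n) x - psi (S n) x * chi n x = - 1.
Proof.
intros Hx; induction n as [|n IH].
- unfold psi, chi; simpl; pose proof (sin2_cos2 x) as H; unfold Rsqr in H.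
  transitivity (- (sin x * sin x + cos x * cos x)); [field; lra | rewrite H; ring].
- unfold psi, chi in *; rewrite !riccati_SS, <- IH; ring.
Qed.

(** * The characteristic functions in dimension three *)

(** In dimension three the substitution u = f (k r) / r removes the first-order term and leaves the
    Riccati-Bessel equation. *)
Lemma radial_solution_of_riccati (l : nat) (R1 R2 k : R) (f f' : R -> R) :
  0 < R1 -> R1 < R2 -> 0 < k ->
  (forall x, 0 < x -> is_derive f x (f' x) /\
     is_derive f' x ((INR l * (INR l + 1) / x ^ 2 - 1) * f x)) ->
  radial_solution 3 l R1 R2 (k ^ 2) (fun r => f (k * r) / r)
    (fun r => k * f' (k * r) / r - f (k * r) / r ^ 2).
Proof.
intros R1p H12 Hk Hf.
assert (Hc : forall (h : R -> R) h' r, 0 < r -> is_derive h (k * r) h' ->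
  is_derive (fun r => h (k * r)) r (k * h')).
{ intros h h' r Hr Hh; apply (is_derive_comp h (fun r => k * r)); [exact Hh|].
  auto_derive; [trivial | ring]. }
assert (D1 : forall r, 0 < r -> is_derive (fun r => f (k * r) / r) r (k * f' (k * r) / r - f (k * r) / r ^ 2)).
{ intros r Hr; assert (Hkr : 0 < k * r) by now apply Rmult_lt_0_compat.
  destruct (Hf (k * r) Hkr) as [A _]; evar_last.
  - apply (is_derive_div (fun r => f (k * r)) (fun r => r)); [apply Hc; [exact Hr | exact A] | apply (is_derive_id r) | lra].
  - unfold one; simpl; field; lra. }
assert (D2 : forall r, 0 < r ->
  is_derive (fun r => k * f' (k * r) / r - f (k * r) / r ^ 2) r
    (- (INR 3 - 1) / r * (k * f' (k * r) / r - f (k * r) / r ^ 2)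
     - (k ^ 2 - radial_potential 3 l r) * (f (k * r) / r))).
{ intros r Hr; assert (Hkr : 0 < k * r) by now apply Rmult_lt_0_compat.
  destruct (Hf (k * r) Hkr) as [A B]; evar_last.
  - apply (is_derive_minus (fun r => k * f' (k * r) / r) (fun r => f (k * r) / r ^ 2)).
    + apply (is_derive_div (fun r => k * f' (k * r)) (fun r => r)); [|apply (is_derive_id r) | lra].
      apply (is_derive_scal (fun r => f' (k * r))), Hc; [exact Hr | exact B].
    + apply (is_derive_div (fun r => f (k * r)) (fun r => r ^ 2)); [apply Hc; [exact Hr | exact A] | |].
      * instantiate (1 := 2 * r); auto_derive; [trivial | ring].
      * apply pow_nonzero; lra.
  - unfold minus, plus, opp, one, scal, radial_potential; simpl; unfold mult; simpl.
    generalize (f (k * r)) (f' (k * r)); intros; field; lra. }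
split; [|split].
- eapply is_derive_continuous_on; intros r Hr; apply D1; lra.
- eapply is_derive_continuous_on; intros r Hr; apply D2; lra.
- intros r Hr; split; [apply D1 | apply D2]; lra.
Qed.

Lemma riccati_second_derive (g : nat -> R -> R) (n : nat) :
  (forall n x, 0 < x -> is_derive (g n) x (INR (S n) / x * g n x - g (S n) x) /\
     is_derive (g (S n)) x (g n x - INR (S n) / x * g (S n) x)) ->
  forall x, 0 < x -> is_derive (fun x => INR (S n) / x * g n x - g (S n) x) x
    ((INR n * (INR n + 1) / x ^ 2 - 1) * g n x).
Proof.
intros Hg x Hx; destruct (Hg n x Hx) as [D1 D2].
evar_last.
- apply (is_derive_minus (fun x => INR (S n) / x * g n x) (g (S n))); [|exact D2].
  apply (is_derive_mult (fun x => INR (S n) / x) (g n)); [|exact D1 | intros; apply Rmult_comm].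
  instantiate (1 := - INR (S n) / x ^ 2); generalize (INR (S n)); intros c.
  auto_derive; [lra | field; lra].
- rewrite !S_INR; unfold minus, plus, opp, mult; simpl; field; lra.
Qed.

Definition cross (m n : nat) (x y : R) : R := psi m x * chi n y - psi n y * chi m x.

(** An eigenfunction u and the solution w vanishing at R1 have zero Wronskian, so w du = 0 at R2; du
    does not vanish there, since otherwise u would be zero. *)
Lemma dirichlet_eigenvalue_3 (l : nat) (R1 R2 k : R) :
  0 < R1 -> R1 < R2 -> 0 < k ->
  (eigenvalue 3 l R1 R2 Dirichlet Dirichlet (k ^ 2) <-> cross l l (k * R1) (k * R2) = 0).
Proof.
intros R1p H12 Hk.
assert (Hx : 0 < k * R1) by now apply Rmult_lt_0_compat.
set (x := k * R1) in *.
(* The combination that vanishes at x = k R1; the Casoratian gives it slope 1 there. *)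
set (f := fun y => psi l x * chi l y + - chi l x * psi l y).
set (f' := fun y => psi l x * (INR (S l) / y * chi l y - chi (S l) y)
  + - chi l x * (INR (S l) / y * psi l y - psi (S l) y)).
assert (Hf : forall y, 0 < y -> is_derive f y (f' y) /\
  is_derive f' y ((INR l * (INR l + 1) / y ^ 2 - 1) * f y)).
{ intros y Hy; split.
  - apply (is_derive_plus (fun y => psi l x * chi l y) (fun y => - chi l x * psi l y));
      apply is_derive_scal; [now apply chi_derive | now apply psi_derive].
  - evar_last.
    + apply (is_derive_plus (fun y => psi l x * (INR (S l) / y * chi l y - chi (S l) y))
        (fun y => - chi l x * (INR (S l) / y * psi l y - psi (S l) y)));
      apply is_derive_scal; [exact (riccati_second_derive chi l chi_derive y Hy)
                            | exact (riccati_second_derive psi l psi_derive y Hy)].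
    + unfold plus, f; simpl; ring. }
assert (Hw := radial_solution_of_riccati l R1 R2 k f f' R1p H12 Hk Hf).
set (w := fun r => f (k * r) / r) in *; set (dw := fun r => k * f' (k * r) / r - f (k * r) / r ^ 2) in *.
assert (Hf1 : f x = 0) by (unfold f; ring).
assert (Hf1' : f' x = 1).
{ unfold f'; pose proof (psi_chi_casoratian l x Hx) as E.
  transitivity (- (psi l x * chi (S l) x - psi (S l) x * chi l x)); [ring | rewrite E; ring]. }
assert (Hf2 : cross l l x (k * R2) = f (k * R2)) by (unfold cross, f; ring).
assert (Hw1 : w R1 = 0) by (unfold w; fold x; rewrite Hf1; field; lra).
assert (Hdw1 : dw R1 <> 0).
{ unfold dw; fold x; rewrite Hf1, Hf1'; replace (k * 1 / R1 - 0 / R1 ^ 2) with (k / R1) by (field; lra).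
  apply Rgt_not_eq, Rdiv_lt_0_compat; lra. }
rewrite Hf2; unfold eigenvalue; split.
- intros [u [du Hu]]; apply eigenfunction_radial in Hu; simpl in Hu.
  destruct Hu as (Hu & U1 & U2 & [r0 [Hr0 Hn]]).
  assert (W := wronskian_constant 3 l R1 R2 (k ^ 2) u du w dw ltac:(lia) R1p H12 Hu Hw
    R2 R1 ltac:(lra) ltac:(lra)).
  unfold wronskian in W; rewrite U1, U2, Hw1, !Rmult_0_l, Rminus_diag, Rmult_0_r in W.
  apply Rmult_integral in W; destruct W as [W|W]; [apply pow_nonzero in W; lra|].
  assert (W' : w R2 * du R2 = 0) by lra.
  apply Rmult_integral in W'; destruct W' as [W'|W'].
  + apply Rmult_eq_reg_r with (/ R2); [|apply Rinv_neq_0_compat; lra].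
    rewrite Rmult_0_l; exact W'.
  + exfalso; apply Hn.
    apply (radial_solution_unique_zero 3 l R1 R2 (k ^ 2) u du R2); trivial; try lia; lra.
- intros Hz; exists w, dw; apply eigenfunction_radial; split; [exact Hw|]; simpl.
  split; [exact Hw1|]; split; [unfold w; rewrite Hz; field; lra|].
  apply NNPP; intros Hno; apply Hdw1.
  apply (radial_solution_zero_interior 3 l R1 R2 (k ^ 2) w dw); trivial; try lia; try lra.
  intros r Hr; apply NNPP; intros Hn; apply Hno; exists r; split; [lra | exact Hn].
Qed.

Lemma dirichlet_resonance_3 (l : nat) (R1 R2 k : R) :
  0 < R1 -> R1 < R2 ->
  (limit_resonance 3 l R1 R2 Dirichlet Dirichlet 1 k <->
   0 < k /\ cross l l (k * R1) (k * R2) = 0 /\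
   forall k', 0 < k' -> cross l l (k' * R1) (k' * R2) = 0 -> k <= k').
Proof.
intros R1p H12.
assert (Hpos : forall lam, eigenvalue 3 l R1 R2 Dirichlet Dirichlet lam -> 0 < lam).
{ intros lam H; apply eigenvalue_nonneg in H; trivial; try lia; try discriminate.
  destruct H as [H1 H2]; destruct (Rle_lt_or_eq_dec 0 lam H1) as [|E]; [assumption|].
  destruct (H2 (eq_sym E)) as (_ & H & _); discriminate H. }
split.
- intros [k0 [Hev [s [_ [Hl Hs]]]]].
  pose proof (Hpos _ Hev) as Hk2.
  assert (Hk : 0 < k).
  { destruct (Rle_lt_or_eq_dec 0 k k0) as [|E]; [assumption|]; rewrite <- E in Hk2; simpl in Hk2; lra. }
  split; [exact Hk|]; split; [now apply dirichlet_eigenvalue_3|].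
  intros k' Hk' Hz; apply Rnot_lt_le; intros Hlt.
  destruct s as [|y s]; [|discriminate].
  apply (proj2 (Hs (k' ^ 2))); split; [now apply dirichlet_eigenvalue_3|].
  assert (k' * k' < k * k) by (apply Rmult_le_0_lt_compat; lra); lra.
- intros (Hk & Hz & Hmin); split; [lra|]; split; [now apply dirichlet_eigenvalue_3|].
  exists []; split; [constructor|]; split; [reflexivity|]; intros y; split; [intros []|].
  intros [Hy Hlt]; pose proof (Hpos y Hy) as Hyp.
  assert (E : y = sqrt y ^ 2) by (symmetry; apply pow2_sqrt; lra).
  pose proof (sqrt_lt_R0 y Hyp) as Hsy.
  rewrite E in Hy; apply dirichlet_eigenvalue_3 in Hy; trivial.
  specialize (Hmin _ Hsy Hy).
  assert (k * k <= sqrt y * sqrt y) by (apply Rmult_le_compat; lra); lra.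
Qed.

(** [char_B], and below [char_C] and [char_D], with J and Y replaced by [psi] and [chi]; the factor
    dropped is common to all four functions. *)
Definition scaled_B (l : nat) (R1 R2 k : R) : R :=
  INR l / R2 * cross l l (k * R1) (k * R2) - k * cross l (S l) (k * R1) (k * R2).
Definition scaled_C (l : nat) (R1 R2 k : R) : R :=
  - (INR l / R1) * cross l l (k * R1) (k * R2) + k * cross (S l) l (k * R1) (k * R2).
Definition scaled_D (l : nat) (R1 R2 k : R) : R :=
  k * (INR l / R2) * cross (S l) l (k * R1) (k * R2)
  - k ^ 2 * cross (S l) (S l) (k * R1) (k * R2)
  - INR l / R1 * (INR l / R2) * cross l l (k * R1) (k * R2)
  + k * (INR l / R1) * cross l (S l) (k * R1) (k * R2).

(** Every term of A, B, C, D has one Bessel factor at R1 and one at R2, so the two values of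
    [riccati_factor] come out, and their product is a constant over k. *)
Lemma characteristic_3 (l : nat) (R1 R2 : R) : 0 < R1 -> R1 < R2 ->
  exists kap, kap <> 0 /\ forall k, 0 < k ->
    char_A 3 l R1 R2 k = kap / k * cross l l (k * R1) (k * R2) /\
    char_B 3 l R1 R2 k = kap / k * scaled_B l R1 R2 k /\
    char_C 3 l R1 R2 k = kap / k * scaled_C l R1 R2 k /\
    char_D 3 l R1 R2 k = kap / k * scaled_D l R1 R2 k.
Proof.
intros R1p H12.
assert (S1 : 0 < sqrt R1) by (apply sqrt_lt_R0; lra).
assert (S2 : 0 < sqrt R2) by (apply sqrt_lt_R0; lra).
exists (2 * rgamma (/ 2) ^ 2 / (sqrt R1 * sqrt R2)).
split.
{ unfold Rdiv; apply Rmult_integral_contrapositive; split.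
  - apply Rmult_integral_contrapositive; split; [lra | apply pow_nonzero, rgamma_half_neq_0].
  - apply Rinv_neq_0_compat, Rgt_not_eq, Rmult_lt_0_compat; assumption. }
intros k Hk.
assert (Hx : 0 < k * R1) by now apply Rmult_lt_0_compat.
assert (Hy : 0 < k * R2) by (apply Rmult_lt_0_compat; lra).
assert (Hfac : 2 * rgamma (/ 2) ^ 2 / (sqrt R1 * sqrt R2) / k = riccati_factor (k * R1) * riccati_factor (k * R2)).
{ unfold riccati_factor; rewrite !Rpower_sqrt by lra.
  replace (k * R1 / 2) with (k / 2 * R1) by field; replace (k * R2 / 2) with (k / 2 * R2) by field.
  rewrite !sqrt_mult by lra.
  assert (Hs : 0 < sqrt (k / 2)) by (apply sqrt_lt_R0; lra).
  assert (Hss : sqrt (k / 2) * sqrt (k / 2) = k / 2) by (apply sqrt_sqrt; lra).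
  replace k with (2 * (sqrt (k / 2) * sqrt (k / 2))) at 1 by (rewrite Hss; field).
  field; lra. }
rewrite Hfac.
assert (Eo : bessel_order 3 l = INR l + / 2) by (unfold bessel_order; simpl; field).
assert (Eo' : bessel_order 3 l + 1 = INR (S l) + / 2) by (rewrite Eo, S_INR; ring).
unfold char_A, char_B, char_C, char_D; rewrite Eo', Eo.
rewrite !besselJ_half_integer, !besselY_half_integer by assumption.
unfold scaled_B, scaled_C, scaled_D, cross.
generalize (riccati_factor (k * R1)) (riccati_factor (k * R2)) (psi l (k * R1)) (psi l (k * R2))
  (chi l (k * R1)) (chi l (k * R2)) (psi (S l) (k * R1)) (psi (S l) (k * R2))
  (chi (S l) (k * R1)) (chi (S l) (k * R2)); intros.
split; [|split; [|split]]; ring.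
Qed.

Lemma derivatives_scaled (A a a1 phi phi1 : R -> R) (k a2 phi2 : R) :
  0 < k -> (forall x, 0 < x -> A x = phi x * a x) ->
  (forall x, 0 < x -> is_derive a x (a1 x)) -> is_derive a1 k a2 ->
  (forall x, 0 < x -> is_derive phi x (phi1 x)) -> is_derive phi1 k phi2 ->
  Derive A k = phi1 k * a k + phi k * a1 k /\
  Derive_n A 2 k = phi2 * a k + 2 * phi1 k * a1 k + phi k * a2.
Proof.
intros Hk HA Ha Ha1 Hp Hp1.
assert (Hloc : forall x, 0 < x -> forall P : R -> Prop, (forall y, 0 < y -> P y) -> locally x P).
{ intros x Hx P HP; exists (mkposreal x Hx); intros y Hy; apply HP.
  change (Rabs (y - x) < x) in Hy; revert Hy; rabs_lra. }
assert (D : forall x, 0 < x -> Derive A x = phi1 x * a x + phi x * a1 x).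
{ intros x Hx; rewrite (Derive_ext_loc A (fun y => phi y * a y)) by now apply Hloc.
  apply is_derive_unique, (is_derive_mult phi a); [now apply Hp | now apply Ha | intros; apply Rmult_comm]. }
split; [now apply D|].
change (Derive_n A 2 k) with (Derive (Derive A) k).
rewrite (Derive_ext_loc _ (fun y => phi1 y * a y + phi y * a1 y)) by now apply Hloc.
apply is_derive_unique; evar_last.
- apply (is_derive_plus (fun y => phi1 y * a y) (fun y => phi y * a1 y)).
  + apply (is_derive_mult phi1 a); [exact Hp1 | now apply Ha | intros; apply Rmult_comm].
  + apply (is_derive_mult phi a1); [now apply Hp | exact Ha1 | intros; apply Rmult_comm].
- unfold plus, mult; simpl; ring.
Qed.

(* The mixed coefficient only depends on A, B, C, D up to a common factor, as the
   branch it describes is a zero of a linear combination of them. *)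
Lemma mixed_coefficient_scaled (d l n : nat) (R1 R2 kap k : R) (a a1 b b1 c c1 : R -> R) (a2 D : R) :
  0 < k -> kap <> 0 ->
  (forall x, 0 < x -> char_A d l R1 R2 x = kap / x ^ n * a x /\
     char_B d l R1 R2 x = kap / x ^ n * b x /\ char_C d l R1 R2 x = kap / x ^ n * c x) ->
  char_D d l R1 R2 k = kap / k ^ n * D ->
  (forall x, 0 < x -> is_derive a x (a1 x) /\ is_derive b x (b1 x) /\ is_derive c x (c1 x)) ->
  is_derive a1 k a2 -> a k = 0 -> a1 k <> 0 ->
  mixed_coefficient d l R1 R2 k =
  - (D * a1 k ^ 2 - (b k * c1 k + c k * b1 k) * a1 k + a2 * b k * c k) / a1 k ^ 3.
Proof.
intros Hk Hkap HABC HD Hder Ha2 Hz Hn.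
assert (Hp : forall x, 0 < x -> is_derive (fun x => kap / x ^ n) x (- INR n * kap / (x * x ^ n))).
{ intros x Hx; assert (x ^ n <> 0) by (apply pow_nonzero; lra).
  apply (is_derive_ext (fun x => - kap * - / x ^ n)); [intros t; change (- kap * - / t ^ n = kap * / t ^ n); ring|].
  evar_last; [apply (is_derive_scal (fun x => - / x ^ n) x (- kap)), pow_inv_derive; lra|].
  field; split; [assumption | lra]. }
(* The second derivative of the factor stays unevaluated, as it is multiplied by a k = 0. *)
assert (Hp1 : exists phi2, is_derive (fun x => - INR n * kap / (x * x ^ n)) k phi2).
{ apply (ex_derive_ext_loc (fun x => - INR n * kap / (x * x ^ n))); [now apply filter_forall|].
  auto_derive; apply Rmult_integral_contrapositive; split; [lra | apply pow_nonzero; lra]. }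
destruct Hp1 as [phi2 Hp1].
destruct (derivatives_scaled (char_A d l R1 R2) a a1 _ _ k a2 phi2 Hk (fun x H => proj1 (HABC x H))
  (fun x H => proj1 (Hder x H)) Ha2 Hp Hp1) as [E1 E2].
assert (Hone : forall F f f1 : R -> R, (forall x, 0 < x -> F x = kap / x ^ n * f x) ->
  (forall x, 0 < x -> is_derive f x (f1 x)) ->
  Derive F k = - INR n * kap / (k * k ^ n) * f k + kap / k ^ n * f1 k).
{ intros F f f1 HF Hf.
  rewrite (Derive_ext_loc F (fun x => kap / x ^ n * f x)).
  - apply is_derive_unique, (is_derive_mult (fun x => kap / x ^ n) f);
      [now apply Hp | now apply Hf | intros; apply Rmult_comm].
  - exists (mkposreal k Hk); intros y Hy; apply HF.
    change (Rabs (y - k) < k) in Hy; revert Hy; rabs_lra. }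
pose proof (Hone _ b b1 (fun x H => proj1 (proj2 (HABC x H))) (fun x H => proj1 (proj2 (Hder x H)))) as E3.
pose proof (Hone _ c c1 (fun x H => proj2 (proj2 (HABC x H))) (fun x H => proj2 (proj2 (Hder x H)))) as E4.
unfold mixed_coefficient; destruct (HABC k Hk) as (_ & EB & EC).
rewrite E1, E2, E3, E4, EB, EC, HD, Hz.
assert (Hkn : k ^ n <> 0) by (apply pow_nonzero; lra).
generalize dependent (k ^ n); intros q; intros; field; repeat split; trivial; lra.
Qed.

(** * Evaluation of the mixed coefficient *)

Lemma cross_0 (k R1 R2 : R) : 0 < k -> 0 < R1 -> R1 < R2 ->
  cross 0 0 (k * R1) (k * R2) = sin (k * (R2 - R1)) /\
  scaled_B 0 R1 R2 k = k * cos (k * (R2 - R1)) - sin (k * (R2 - R1)) / R2 /\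
  scaled_C 0 R1 R2 k = k * cos (k * (R2 - R1)) + sin (k * (R2 - R1)) / R1 /\
  scaled_D 0 R1 R2 k = - ((1 + k ^ 2 * R1 * R2) * sin (k * (R2 - R1))
    - k * (R2 - R1) * cos (k * (R2 - R1))) / (R1 * R2).
Proof.
intros Hk R1p H12; unfold scaled_B, scaled_C, scaled_D, cross, psi, chi; simpl.
replace (k * (R2 - R1)) with (k * R2 - k * R1) by ring; rewrite sin_minus, cos_minus.
split; [|split; [|split]]; field; lra.
Qed.

Lemma dirichlet_resonance_3_0 (R1 R2 k : R) : 0 < R1 -> R1 < R2 ->
  (limit_resonance 3 0 R1 R2 Dirichlet Dirichlet 1 k <-> k = PI / (R2 - R1)).
Proof.
intros R1p H12; rewrite dirichlet_resonance_3 by assumption.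
assert (Hw : 0 < R2 - R1) by lra.
pose proof PI_RGT_0.
assert (Hz : forall k, 0 < k -> (cross 0 0 (k * R1) (k * R2) = 0 <-> sin (k * (R2 - R1)) = 0)).
{ intros x Hx; now destruct (cross_0 x R1 R2 Hx R1p H12) as [-> _]. }
assert (Hlow : forall k, 0 < k -> sin (k * (R2 - R1)) = 0 -> PI / (R2 - R1) <= k).
{ intros x Hx E; apply Rnot_lt_le; intros Hlt.
  assert (x * (R2 - R1) < PI).
  { apply Rlt_le_trans with (PI / (R2 - R1) * (R2 - R1)); [now apply Rmult_lt_compat_r|].
    right; field; lra. }
  assert (0 < x * (R2 - R1)) by now apply Rmult_lt_0_compat.
  pose proof (sin_gt_0 (x * (R2 - R1)) ltac:(assumption) ltac:(assumption)); lra. }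
assert (Hpi : sin (PI / (R2 - R1) * (R2 - R1)) = 0).
{ replace (PI / (R2 - R1) * (R2 - R1)) with PI by (field; lra); apply sin_PI. }
assert (Hpos : 0 < PI / (R2 - R1)) by now apply Rdiv_lt_0_compat.
split.
- intros (Hk & E & Hmin); apply Hz in E; trivial.
  apply Rle_antisym; [|now apply Hlow].
  apply Hmin; [exact Hpos | now apply Hz].
- intros ->; split; [exact Hpos|]; split; [now apply Hz|].
  intros k' Hk' E; apply Hlow; [exact Hk' | now apply Hz].
Qed.

(** At the resonance k w = PI with w = R2 - R1, so the sine is 0 and the cosine -1; the second
    derivative of a vanishes and a rational expression in k and w remains. *)
Lemma mixed_coefficient_3_0 (R1 R2 k : R) : 0 < R1 -> R1 < R2 ->
  limit_resonance 3 0 R1 R2 Dirichlet Dirichlet 1 k ->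
  mixed_coefficient 3 0 R1 R2 k = 2 * PI / (R2 - R1) ^ 3.
Proof.
intros R1p H12 Hres; apply dirichlet_resonance_3_0 in Hres; trivial.
pose proof PI_RGT_0.
destruct (characteristic_3 0 R1 R2 R1p H12) as [kap [Hkap Hch]].
set (w := R2 - R1) in *; assert (Hw : 0 < w) by (unfold w; lra).
assert (Hk : 0 < k) by (rewrite Hres; now apply Rdiv_lt_0_compat).
assert (Ekw : k * w = PI) by (rewrite Hres; field; lra).
rewrite (mixed_coefficient_scaled 3 0 1 R1 R2 kap k
  (fun x => sin (x * w)) (fun x => w * cos (x * w))
  (fun x => x * cos (x * w) - sin (x * w) / R2)
  (fun x => cos (x * w) - x * w * sin (x * w) - w * cos (x * w) / R2)
  (fun x => x * cos (x * w) + sin (x * w) / R1)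
  (fun x => cos (x * w) - x * w * sin (x * w) + w * cos (x * w) / R1)
  (- w * w * sin (k * w)) (scaled_D 0 R1 R2 k)); trivial.
- destruct (cross_0 k R1 R2 Hk R1p H12) as (_ & _ & _ & ->); fold w.
  cbv beta; rewrite Ekw, sin_PI, cos_PI.
  replace R2 with (R1 + w) by (unfold w; ring); rewrite Hres; field; repeat split; lra.
- intros x Hx; destruct (Hch x Hx) as (EA & EB & EC & _).
  destruct (cross_0 x R1 R2 Hx R1p H12) as (FA & FB & FC & _); fold w in FA, FB, FC.
  rewrite EA, EB, EC, FA, FB, FC, pow_1; repeat split.
- rewrite pow_1; apply Hch, Hk.
- intros x Hx; split; [|split]; auto_derive; trivial; field; lra.
- auto_derive; [trivial | ring].
- now rewrite Ekw, sin_PI.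
- rewrite Ekw, cos_PI; lra.
Qed.

(** Writing theta as k * 2 - k * 1 lets the addition formulas apply before theta is identified with
    k. The common denominator is later moved into the scaling factor. *)
Lemma cross_1 (k theta : R) : 0 < k -> theta = k * 2 - k * 1 ->
  cross 1 1 (k * 1) (k * 2) = ((1 + 2 * k ^ 2) * sin theta - k * cos theta) / (2 * k ^ 2) /\
  scaled_B 1 1 2 k = (- sin theta + (k + 2 * k ^ 3) * cos theta) / (2 * k ^ 2) /\
  scaled_C 1 1 2 k = ((2 + 3 * k ^ 2) * sin theta + (- 2 * k + 2 * k ^ 3) * cos theta) / (2 * k ^ 2) /\
  scaled_D 1 1 2 k = ((- 2 + k ^ 2 - 2 * k ^ 4) * sin theta + (2 * k + 2 * k ^ 3) * cos theta) / (2 * k ^ 2).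
Proof.
intros Hk ->; rewrite sin_minus, cos_minus; unfold scaled_B, scaled_C, scaled_D, cross, psi, chi; simpl.
split; [|split; [|split]]; field; lra.
Qed.

Lemma cross_2 (k theta : R) : 0 < k -> theta = k * 2 - k * 1 ->
  cross 2 2 (k * 1) (k * 2) =
    ((18 + 6 * k ^ 2 + 8 * k ^ 4) * sin theta - (18 * k + 12 * k ^ 3) * cos theta) / (8 * k ^ 4) /\
  scaled_B 2 1 2 k =
    ((- 27 + 3 * k ^ 2 + 8 * k ^ 4) * sin theta + (27 * k + 6 * k ^ 3 + 8 * k ^ 5) * cos theta) / (8 * k ^ 4) /\
  scaled_C 2 1 2 k =
    ((54 + 12 * k ^ 2 + 20 * k ^ 4) * sin theta + (- 54 * k - 30 * k ^ 3 + 8 * k ^ 5) * cos theta) / (8 * k ^ 4) /\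
  scaled_D 2 1 2 k =
    ((- 81 + 18 * k ^ 2 + 26 * k ^ 4 - 8 * k ^ 6) * sin theta + (81 * k + 9 * k ^ 3 + 16 * k ^ 5) * cos theta)
    / (8 * k ^ 4).
Proof.
intros Hk ->; rewrite sin_minus, cos_minus; unfold scaled_B, scaled_C, scaled_D, cross, psi, chi; simpl.
split; [|split; [|split]]; field; lra.
Qed.

(** * Numerical bounds and localisation of the first roots *)

Lemma sin_cos_taylor (a : R) : 0 <= a <= 1 ->
  a - a ^ 3 / 6 + a ^ 5 / 120 - a ^ 7 / 5040 + a ^ 9 / 362880 - a ^ 11 / 39916800 <= sin a
    <= a - a ^ 3 / 6 + a ^ 5 / 120 - a ^ 7 / 5040 + a ^ 9 / 362880 /\
  1 - a ^ 2 / 2 + a ^ 4 / 24 - a ^ 6 / 720 + a ^ 8 / 40320 - a ^ 10 / 3628800 <= cos a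
    <= 1 - a ^ 2 / 2 + a ^ 4 / 24 - a ^ 6 / 720 + a ^ 8 / 40320.
Proof.
intros Ha; pose proof PI2_1.
destruct (sin_bound a 1) as [_ A2]; [lra | lra |].
destruct (sin_bound a 2) as [A1 _]; [lra | lra |].
destruct (cos_bound a 1) as [_ B2]; [lra | lra |].
destruct (cos_bound a 2) as [B1 _]; [lra | lra |].
unfold sin_approx, cos_approx, sin_term, cos_term in *.
cbn [sum_f_R0 Nat.mul Nat.add] in *.
rewrite ?fact_simpl, ?mult_INR in *; simpl INR in *; lra.
Qed.

(** Inversion of sin (PI / 6) = 1 / 2: a Taylor bound at each candidate, combined with monotonicity
    of the sine, excludes values on the wrong side. *)
Lemma PI_bounds : 314159265 / 100000000 < PI < 314159266 / 100000000.
Proof.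
pose proof PI2_1; pose proof PI_4.
assert (E : sin (PI / 6) = 1 / 2) by apply sin_PI6.
split; apply Rnot_le_lt; intros H1.
- destruct (sin_cos_taylor (314159265 / 600000000)) as [[_ A] _]; [lra|].
  assert (sin (PI / 6) <= sin (314159265 / 600000000)) by (apply sin_incr_1; lra).
  lra.
- destruct (sin_cos_taylor (314159266 / 600000000)) as [[A _] _]; [lra|].
  assert (sin (314159266 / 600000000) <= sin (PI / 6)) by (apply sin_incr_1; lra).
  lra.
Qed.

Lemma sin_cos_enclosure (t1 t2 t : R) : 0 <= t1 -> t1 <= t <= t2 -> t2 <= 1 ->
  sin t1 <= sin t <= sin t2 /\ cos t2 <= cos t <= cos t1.
Proof.
intros H1 Ht H2; pose proof PI_bounds.
split; split; try (apply sin_incr_1; lra); apply cos_decr_1; lra.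
Qed.

(** F has no zero on (0, PI) and is nonincreasing on [PI, 9/2], so a zero before lo would contradict
    F lo > 0; the sign change supplies a zero before hi. The bound 9/2 stays below 3 PI / 2, where
    sine and cosine are both nonpositive. *)
Lemma first_root_localisation (l : nat) (F F' q : R -> R) (lo hi k : R) :
  (forall x, 0 < x -> 0 < q x /\ cross l l (x * 1) (x * 2) = F x / q x) ->
  (forall x, is_derive F x (F' x)) ->
  (forall x, 0 < x < PI -> 0 < F x) -> (forall x, PI <= x <= 9 / 2 -> F' x <= 0) ->
  0 < lo < hi -> hi <= 9 / 2 -> 0 < F lo -> F hi < 0 ->
  limit_resonance 3 l 1 2 Dirichlet Dirichlet 1 k -> lo <= k <= hi /\ F k = 0.
Proof.
intros Hq HF Hpos Hneg Hlo Hhi Flo Fhi Hres.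
apply dirichlet_resonance_3 in Hres; [|lra|lra]; destruct Hres as (Hk & Zk & Hmin).
assert (Hz : forall x, 0 < x -> (cross l l (x * 1) (x * 2) = 0 <-> F x = 0)).
{ intros x Hx; destruct (Hq x Hx) as [qp ->]; split; intros E.
  - apply (Rmult_eq_reg_r (/ q x)); [|apply Rinv_neq_0_compat; lra].
    rewrite Rmult_0_l; exact E.
  - rewrite E; field; lra. }
apply Hz in Zk; [|exact Hk]; split; [|exact Zk].
assert (Hcont : forall x, continuity_pt F x).
{ intros x; apply (is_derive_continuity_pt F x (F' x)), HF. }
destruct (IVT_interv (fun x => - F x) lo hi) as [z [Hzz Ez]]; try lra.
{ intros x _; now apply (continuity_pt_opp F). }
pose proof (Hmin z ltac:(lra) (proj2 (Hz z ltac:(lra)) ltac:(lra))).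
split; [|lra]; apply Rnot_lt_le; intros Hkl.
destruct (Rlt_or_le k PI) as [Hp|Hp]; [specialize (Hpos k); lra|].
destruct (mvt_two_points F F' k lo) as [c [E Hc]]; [intros; apply HF|].
rewrite Rmin_left, Rmax_right in Hc by lra.
specialize (Hneg c ltac:(lra)).
assert (F' c * (lo - k) <= 0); [|lra].
rewrite <- (Rmult_0_l (lo - k)); apply Rmult_le_compat_r; lra.
Qed.

Lemma sin_cos_quadrants (x : R) : 0 < x <= 9 / 2 ->
  (x <= PI / 2 -> 0 < sin x /\ 0 <= cos x) /\
  (PI / 2 <= x < PI -> 0 < sin x /\ cos x <= 0) /\
  (PI <= x -> sin x <= 0 /\ cos x <= 0).
Proof.
intros Hx; pose proof PI_bounds; split; [|split]; intros Hq.
- split; [apply sin_gt_0; lra | apply cos_ge_0; lra].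
- split; [apply sin_gt_0; lra | apply cos_le_0; lra].
- split; [apply sin_le_0; lra | apply cos_le_0; lra].
Qed.

Lemma nonneg_of_derive (h h' : R -> R) (x : R) : 0 <= x -> h 0 = 0 ->
  (forall y, is_derive h y (h' y)) -> (forall y, 0 <= y <= x -> 0 <= h' y) -> 0 <= h x.
Proof.
intros Hx H0 Hd Hp.
destruct (mvt_two_points h h' 0 x) as [c [E Hc]]; [intros; apply Hd|].
rewrite Rmin_left, Rmax_right in Hc by lra.
assert (0 <= h' c * (x - 0)) by (apply Rmult_le_pos; [apply Hp|]; lra); lra.
Qed.

(** The start of the tangent series, multiplied by cos x to include PI / 2; the derivative in the
    second case is nonnegative by the first. The cases serve l = 1 and l = 2. *)
Lemma tan_bounds (x : R) : 0 <= x <= PI / 2 ->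
  x * cos x <= sin x /\ (x + x ^ 3 / 3) * cos x <= sin x.
Proof.
pose proof PI_bounds.
assert (H1 : forall x, 0 <= x <= PI / 2 -> 0 <= sin x - x * cos x).
{ intros y Hy; apply (nonneg_of_derive (fun x => sin x - x * cos x) (fun x => x * sin x)); try lra.
  - rewrite sin_0; ring.
  - intros z; auto_derive; [trivial | ring].
  - intros z Hz; apply Rmult_le_pos; [lra | apply sin_ge_0; lra]. }
intros Hx; split; [specialize (H1 x Hx); lra|].
assert (0 <= sin x - (x + x ^ 3 / 3) * cos x); [|lra].
apply (nonneg_of_derive (fun x => sin x - (x + x ^ 3 / 3) * cos x)
  (fun x => x * (sin x - x * cos x) + x ^ 3 / 3 * sin x)); try lra.
- rewrite sin_0; field.
- intros z; auto_derive; [trivial | field].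
- intros z Hz; assert (0 <= sin z) by (apply sin_ge_0; lra).
  assert (0 <= z ^ 3) by (apply pow_le; lra).
  apply Rplus_le_le_0_compat; apply Rmult_le_pos; try lra; apply H1; lra.
Qed.

Lemma first_root_1 (lo hi k : R) :
  let F x := (1 + 2 * x ^ 2) * sin x - x * cos x in
  0 < lo < hi -> hi <= 9 / 2 -> 0 < F lo -> F hi < 0 ->
  limit_resonance 3 1 1 2 Dirichlet Dirichlet 1 k -> lo <= k <= hi /\ F k = 0.
Proof.
intros F; apply (first_root_localisation 1 F (fun x => 5 * x * sin x + 2 * x ^ 2 * cos x)
  (fun x => 2 * x ^ 2)).
- intros x Hx; split; [apply Rmult_lt_0_compat; [lra | now apply pow_lt] | now apply cross_1; try ring].
- intros x; unfold F; auto_derive; [trivial | ring].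
- intros x Hx; pose proof PI_bounds; destruct (sin_cos_quadrants x) as (Q1 & Q2 & _); [lra|].
  unfold F; assert (0 < x ^ 2) by (apply pow_lt; lra).
  destruct (Rle_or_lt x (PI / 2)) as [Hq|Hq].
  + destruct (Q1 Hq) as [S1 C1]; destruct (tan_bounds x) as [T _]; [lra|].
    assert (0 < x ^ 2 * sin x) by (apply Rmult_lt_0_compat; lra); lra.
  + destruct (Q2 ltac:(lra)) as [S1 C1].
    assert (0 < x ^ 2 * sin x) by (apply Rmult_lt_0_compat; lra).
    assert (0 <= x * - cos x) by (apply Rmult_le_pos; lra); lra.
- intros x Hx; pose proof PI_bounds; destruct (sin_cos_quadrants x) as (_ & _ & Q); [lra|].
  destruct (Q ltac:(lra)) as [S1 C1].
  assert (0 <= x * - sin x) by (apply Rmult_le_pos; lra).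
  assert (0 <= x ^ 2 * - cos x) by (apply Rmult_le_pos; [apply pow_le|]; lra); lra.
Qed.

Lemma first_root_2 (lo hi k : R) :
  let F x := (18 + 6 * x ^ 2 + 8 * x ^ 4) * sin x - (18 * x + 12 * x ^ 3) * cos x in
  0 < lo < hi -> hi <= 9 / 2 -> 0 < F lo -> F hi < 0 ->
  limit_resonance 3 2 1 2 Dirichlet Dirichlet 1 k -> lo <= k <= hi /\ F k = 0.
Proof.
intros F; apply (first_root_localisation 2 F (fun x => (30 * x + 44 * x ^ 3) * sin x + (8 * x ^ 4 - 30 * x ^ 2) * cos x)
  (fun x => 8 * x ^ 4)).
- intros x Hx; split; [apply Rmult_lt_0_compat; [lra | now apply pow_lt] | now apply cross_2; try ring].
- intros x; unfold F; auto_derive; [trivial | ring].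
- intros x Hx; pose proof PI_bounds; destruct (sin_cos_quadrants x) as (Q1 & Q2 & _); [lra|].
  unfold F; assert (0 < x ^ 2) by (apply pow_lt; lra); assert (0 < x ^ 3) by (apply pow_lt; lra).
  assert (0 < x ^ 4) by (apply pow_lt; lra); assert (0 < x ^ 5) by (apply pow_lt; lra).
  assert (0 < x ^ 7) by (apply pow_lt; lra).
  destruct (Rle_or_lt x (PI / 2)) as [Hq|Hq].
  + destruct (Q1 Hq) as [S1 C1]; destruct (tan_bounds x) as [_ T]; [lra|].
    (* Here (18 + 6x^2)(x + x^3/3) = 18x + 12x^3 + 2x^5, which matches the cosine coefficient of F
       up to the nonnegative 2x^5. *)
    assert (T' : (18 + 6 * x ^ 2) * ((x + x ^ 3 / 3) * cos x) <= (18 + 6 * x ^ 2) * sin x)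
      by (apply Rmult_le_compat_l; lra).
    assert (0 <= x ^ 5 * cos x) by (apply Rmult_le_pos; lra).
    assert (0 < x ^ 4 * sin x) by (apply Rmult_lt_0_compat; lra); lra.
  + destruct (Q2 ltac:(lra)) as [S1 C1].
    assert (0 < (18 + 6 * x ^ 2 + 8 * x ^ 4) * sin x) by (apply Rmult_lt_0_compat; lra).
    assert (0 <= (18 * x + 12 * x ^ 3) * - cos x) by (apply Rmult_le_pos; lra); lra.
- intros x Hx; pose proof PI_bounds; destruct (sin_cos_quadrants x) as (_ & _ & Q); [lra|].
  destruct (Q ltac:(lra)) as [S1 C1].
  assert (0 < x ^ 3) by (apply pow_lt; lra).
  (* From x >= PI > 3, the factor 8x^2 - 30 is positive. *)
  assert (3 * 3 <= x * x) by (apply Rmult_le_compat; lra).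
  assert (0 <= (30 * x + 44 * x ^ 3) * - sin x) by (apply Rmult_le_pos; lra).
  assert (0 <= x * x * (8 * (x * x) - 30)) by (apply Rmult_le_pos; lra).
  assert (0 <= (8 * x ^ 4 - 30 * x ^ 2) * - cos x) by (apply Rmult_le_pos; lra); lra.
Qed.

(** Shifting by PI brings the argument into [0, 1], where the Taylor bounds are sharp; t1 and t2
    absorb the uncertainty in PI. *)
Lemma sin_cos_numeric (t1 t2 x : R) : 0 <= t1 -> t1 <= x - PI -> x - PI <= t2 -> t2 <= 1 ->
  - (t2 - t2 ^ 3 / 6 + t2 ^ 5 / 120 - t2 ^ 7 / 5040 + t2 ^ 9 / 362880) <= sin x
    <= - (t1 - t1 ^ 3 / 6 + t1 ^ 5 / 120 - t1 ^ 7 / 5040 + t1 ^ 9 / 362880 - t1 ^ 11 / 39916800) /\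
  - (1 - t1 ^ 2 / 2 + t1 ^ 4 / 24 - t1 ^ 6 / 720 + t1 ^ 8 / 40320) <= cos x
    <= - (1 - t2 ^ 2 / 2 + t2 ^ 4 / 24 - t2 ^ 6 / 720 + t2 ^ 8 / 40320 - t2 ^ 10 / 3628800).
Proof.
intros H1 H2 H3 H4; destruct (sin_cos_enclosure t1 t2 (x - PI)) as [A B]; try lra.
destruct (sin_cos_taylor t1) as [A1 B1]; [lra|]; destruct (sin_cos_taylor t2) as [A2 B2]; [lra|].
assert (E1 : sin x = - sin (x - PI)) by (rewrite <- neg_sin; f_equal; ring).
assert (E2 : cos x = - cos (x - PI)) by (rewrite <- neg_cos; f_equal; ring).
rewrite E1, E2; lra.
Qed.

(** * Interval evaluation of the mixed coefficient for l = 1 and l = 2 *)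

Lemma quotient_enclosure (n q v e : R) : q < 0 ->
  (v - e) * - q <= n -> n <= (v + e) * - q -> Rabs (- n / q - v) <= e.
Proof.
intros Hq H1 H2.
replace (- n / q - v) with ((n - v * - q) * / - q) by (field; lra).
assert (Hi : 0 < / - q) by (apply Rinv_0_lt_compat; lra).
assert (Ei : - q * / - q = 1) by (field; lra).
apply Rabs_le; split.
- replace (- e) with (- e * - q * / - q) by (rewrite Rmult_assoc, Ei; ring).
  apply Rmult_le_compat_r; lra.
- apply Rle_trans with (e * - q * / - q); [apply Rmult_le_compat_r | rewrite Rmult_assoc, Ei]; lra.
Qed.

(** Expanded, these inequalities are linear in x, y and the product x * y, so [lra] gets optimal
    bounds on the product over the box while treating it as an atom. *)
Lemma mccormick (a b c d x y : R) : a <= x <= b -> c <= y <= d ->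
  0 <= (x - a) * (y - c) /\ 0 <= (x - a) * (d - y) /\
  0 <= (b - x) * (y - c) /\ 0 <= (b - x) * (d - y).
Proof. intros; repeat split; apply Rmult_le_pos; lra. Qed.

Ltac enclose_mult Hx Hy := pose proof (mccormick _ _ _ _ _ _ Hx Hy); lra.

(** For f of the shape P sin k + Q cos k: the coefficients are enclosed from the powers of k, then
    each product is bounded by [mccormick]. *)
Ltac enclose_sum f p1 p2 q1 q2 Hs Hc :=
  match goal with |- _ <= ?X <= _ =>
    let X' := eval unfold f in X in
    match X' with ?P * ?s + ?Q * ?c =>
      let HP := fresh in let HQ := fresh in
      assert (HP : p1 <= P <= p2) by lra;
      assert (HQ : q1 <= Q <= q2) by lra;
      pose proof (mccormick _ _ _ _ _ _ HP Hs);
      pose proof (mccormick _ _ _ _ _ _ HQ Hc);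
      unfold f; lra
    end
  end.

(* For l = 1, 2 the first root is 3.28600659... and 3.55578811...; the constants below are
   outward roundings of an interval evaluation on an interval of width 10^-6 around it. *)
Lemma mixed_coefficient_3_1 (k : R) :
  limit_resonance 3 1 1 2 Dirichlet Dirichlet 1 k ->
  Rabs (mixed_coefficient 3 1 1 2 k - 620 / 100) <= 5 / 1000.
Proof.
intros Hres; pose proof PI_bounds.
destruct (sin_cos_numeric (14441334 / 100000000) (14441335 / 100000000) (3286006 / 1000000)) as [Slo Clo]; [lra .. |].
destruct (sin_cos_numeric (14441434 / 100000000) (14441435 / 100000000) (3286007 / 1000000)) as [Shi Chi]; [lra .. |].
destruct (first_root_1 (3286006 / 1000000) (3286007 / 1000000) k) as [K1 Hz]; trivial; try lra.
clear Slo Clo Shi Chi Hres.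
destruct (sin_cos_numeric (14441334 / 100000000) (14441435 / 100000000) k) as [Hs' Hc']; [lra .. |].
assert (Hs : (-14391291) / 100000000 <= sin k <= (-1439119) / 10000000) by lra.
assert (Hc : (-98959051) / 100000000 <= cos k <= (-98959035) / 100000000) by lra.
clear Hs' Hc'.
(* A, B, C, D are the numerators in [cross_1]; the suffixes 1 and 2 mark their derivatives. *)
set (A x := (1 + 2 * x ^ 2) * sin x + (- x) * cos x).
set (A1 x := (5 * x) * sin x + (2 * x ^ 2) * cos x).
set (A2 x := (5 - 2 * x ^ 2) * sin x + (9 * x) * cos x).
set (B x := (- 1) * sin x + (x + 2 * x ^ 3) * cos x).
set (B1 x := (- x - 2 * x ^ 3) * sin x + (6 * x ^ 2) * cos x).
set (C x := (2 + 3 * x ^ 2) * sin x + (- 2 * x + 2 * x ^ 3) * cos x).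
set (C1 x := (8 * x - 2 * x ^ 3) * sin x + (9 * x ^ 2) * cos x).
set (D x := (- 2 + x ^ 2 - 2 * x ^ 4) * sin x + (2 * x + 2 * x ^ 3) * cos x).
assert (K2 : 10797835 / 1000000 <= k ^ 2 <= 10797843 / 1000000) by enclose_mult K1 K1.
assert (K3 : 3548175 / 100000 <= k ^ 3 <= 35481788 / 1000000) by enclose_mult K1 K2.
assert (K4 : 11659324 / 100000 <= k ^ 4 <= 11659341 / 100000) by enclose_mult K1 K3.
assert (HA1 : (-2373539) / 100000 <= A1 k <= (-2373533) / 100000) by
  enclose_sum A1 (1643003 / 100000) (1643004 / 100000) (2159567 / 100000) (2159569 / 100000) Hs Hc.
assert (HA2 : (-2687791) / 100000 <= A2 k <= (-2687785) / 100000) by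
  enclose_sum A2 ((-1659569) / 100000) ((-1659567) / 100000) (2957405 / 100000) (2957407 / 100000) Hs Hc.
assert (HB : (-7333278) / 100000 <= B k <= (-7333266) / 100000) by
  enclose_sum B ((-1)) ((-1)) (742495 / 10000) (7424959 / 100000) Hs Hc.
assert (HB1 : (-5342728) / 100000 <= B1 k <= (-5342711) / 100000) by
  enclose_sum B1 ((-7424959) / 100000) ((-742495) / 10000) (6478701 / 100000) (6478706 / 100000) Hs Hc.
assert (HC : (-6867097) / 100000 <= C k <= (-6867081) / 100000) by
  enclose_sum C (343935 / 10000) (3439353 / 100000) (6439148 / 100000) (6439157 / 100000) Hs Hc.
assert (HC1 : (-8973967) / 100000 <= C1 k <= (-897395) / 10000) by
  enclose_sum C1 ((-4467553) / 100000) ((-4467544) / 100000) (9718051 / 100000) (9718059 / 100000) Hs Hc.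
assert (HD : (-4443631) / 100000 <= D k <= (-4443591) / 100000) by
  enclose_sum D ((-224389) / 1000) ((-2243886) / 10000) (7753551 / 100000) (7753559 / 100000) Hs Hc.
destruct (characteristic_3 1 1 2) as [kap [Hkap Hch]]; try lra.
(* The factor kap / k and the denominator 2k^2 combine to (kap / 2) / k^3. *)
rewrite (mixed_coefficient_scaled 3 1 3 1 2 (kap / 2) k A A1 B B1 C C1 (A2 k) (D k)); try lra.
- revert HA1 HA2 HB HB1 HC HC1 HD; generalize (A1 k) (A2 k) (B k) (B1 k) (C k) (C1 k) (D k).
  clear; intros a1 a2 b b1 c c1 d HA1 HA2 HB HB1 HC HC1 HD.
  (* From here on only enclosures of seven independent numbers are used, multiplied out factor by
     factor. *)
  assert (HAA : 5633658 / 10000 <= a1 ^ 2 <= 5633688 / 10000) by enclose_mult HA1 HA1.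
  assert (HAAA : (-1337178) / 100 <= a1 ^ 3 <= (-1337167) / 100) by enclose_mult HA1 HAA.
  assert (HDAA : (-2503404) / 100 <= d * a1 ^ 2 <= (-2503367) / 100) by enclose_mult HD HAA.
  assert (HBC1 : 6580836 / 1000 <= b * c1 <= 658086 / 100) by enclose_mult HB HC1.
  assert (HCB1 : 3668882 / 1000 <= c * b1 <= 3668904 / 1000) by enclose_mult HC HB1.
  assert (HS : 1024971 / 100 <= b * c1 + c * b1 <= 1024977 / 100) by lra.
  assert (HSA : (-2432823) / 10 <= (b * c1 + c * b1) * a1 <= (-2432802) / 10) by enclose_mult HS HA1.
  assert (HA2B : 1971024 / 1000 <= a2 * b <= 1971032 / 1000) by enclose_mult HA2 HB.
  assert (HABC : (-1353527) / 10 <= a2 * b * c <= (-1353518) / 10) by enclose_mult HA2B HC.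
  apply quotient_enclosure; lra.
- intros x Hx; destruct (Hch x Hx) as (-> & -> & -> & _).
  destruct (cross_1 x x Hx ltac:(ring)) as (-> & -> & -> & _).
  unfold A, B, C; split; [|split]; field; lra.
- assert (kp : 0 < k) by lra; destruct (Hch k kp) as (_ & _ & _ & ->).
  destruct (cross_1 k k kp ltac:(ring)) as (_ & _ & _ & ->); unfold D; field; lra.
- intros x Hx; unfold A, B, C; split; [|split]; auto_derive; trivial; unfold A1, B1, C1; ring.
- unfold A1, A2; auto_derive; [trivial | ring].
- rewrite <- Hz; unfold A; ring.
Qed.

Lemma mixed_coefficient_3_2 (k : R) :
  limit_resonance 3 2 1 2 Dirichlet Dirichlet 1 k ->
  Rabs (mixed_coefficient 3 2 1 2 k - 596 / 100) <= 5 / 1000.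
Proof.
intros Hres; pose proof PI_bounds.
destruct (sin_cos_numeric (41419534 / 100000000) (41419535 / 100000000) (3555788 / 1000000)) as [Slo Clo]; [lra .. |].
destruct (sin_cos_numeric (41419634 / 100000000) (41419635 / 100000000) (3555789 / 1000000)) as [Shi Chi]; [lra .. |].
destruct (first_root_2 (3555788 / 1000000) (3555789 / 1000000) k) as [K1 Hz]; trivial; try lra.
clear Slo Clo Shi Chi Hres.
destruct (sin_cos_numeric (41419534 / 100000000) (41419635 / 100000000) k) as [Hs' Hc']; [lra .. |].
assert (Hs : (-40245437) / 100000000 <= sin k <= (-40245344) / 100000000) by lra.
assert (Hc : (-91544046) / 100000000 <= cos k <= (-91544004) / 100000000) by lra.
clear Hs' Hc'.
set (A x := (18 + 6 * x ^ 2 + 8 * x ^ 4) * sin x + (- 18 * x - 12 * x ^ 3) * cos x).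
set (A1 x := (30 * x + 44 * x ^ 3) * sin x + (- 30 * x ^ 2 + 8 * x ^ 4) * cos x).
set (A2 x := (30 + 162 * x ^ 2 - 8 * x ^ 4) * sin x + (- 30 * x + 76 * x ^ 3) * cos x).
set (B x := (- 27 + 3 * x ^ 2 + 8 * x ^ 4) * sin x + (27 * x + 6 * x ^ 3 + 8 * x ^ 5) * cos x).
set (B1 x := (- 21 * x + 26 * x ^ 3 - 8 * x ^ 5) * sin x + (21 * x ^ 2 + 48 * x ^ 4) * cos x).
set (C x := (54 + 12 * x ^ 2 + 20 * x ^ 4) * sin x + (- 54 * x - 30 * x ^ 3 + 8 * x ^ 5) * cos x).
set (C1 x := (78 * x + 110 * x ^ 3 - 8 * x ^ 5) * sin x + (- 78 * x ^ 2 + 60 * x ^ 4) * cos x).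
set (D x := (- 81 + 18 * x ^ 2 + 26 * x ^ 4 - 8 * x ^ 6) * sin x + (81 * x + 9 * x ^ 3 + 16 * x ^ 5) * cos x).
assert (K2 : 12643628 / 1000000 <= k ^ 2 <= 12643636 / 1000000) by enclose_mult K1 K1.
assert (K3 : 4495806 / 100000 <= k ^ 3 <= 44958102 / 1000000) by enclose_mult K1 K2.
assert (K4 : 15986133 / 100000 <= k ^ 4 <= 15986153 / 100000) by enclose_mult K1 K3.
assert (K5 : 56843299 / 100000 <= k ^ 5 <= 56843387 / 100000) by enclose_mult K1 K4.
assert (K6 : 20212272 / 10000 <= k ^ 6 <= 2021231 / 1000) by enclose_mult K1 K5.
assert (HA1 : (-1662565) / 1000 <= A1 k <= (-1662559) / 1000) by
  enclose_sum A1 (2084828 / 1000) (2084831 / 1000) (8995815 / 10000) (8995834 / 10000) Hs Hc.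
assert (HA2 : (-3351953) / 1000 <= A2 k <= (-3351943) / 1000) by
  enclose_sum A2 (7993754 / 10000) (7993784 / 10000) (3310138 / 1000) (3310143 / 1000) Hs Hc.
assert (HB : (-5016862) / 1000 <= B k <= (-5016848) / 1000) by
  enclose_sum B (1289821 / 1000) (1289824 / 1000) (4913218 / 1000) (4913226 / 1000) Hs Hc.
assert (HB1 : (-5877802) / 1000 <= B1 k <= (-5877781) / 1000) by
  enclose_sum B1 ((-3453233) / 1000) ((-3453224) / 1000) (793886 / 100) (793887 / 100) Hs Hc.
assert (HC : (-4122006) / 1000 <= C k <= (-4121988) / 1000) by
  enclose_sum C (340295 / 100) (3402955 / 1000) (3006708 / 1000) (3006717 / 1000) Hs Hc.
assert (HC1 : (-8149582) / 1000 <= C1 k <= (-814956) / 100) by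
  enclose_sum C1 (6752671 / 10000) (6752789 / 10000) (8605476 / 1000) (8605489 / 1000) Hs Hc.
assert (HD : (-4184105) / 1000 <= D k <= (-4184058) / 1000) by
  enclose_sum D ((-1186687) / 100) ((-1186683) / 100) (9787569 / 1000) (9787584 / 1000) Hs Hc.
destruct (characteristic_3 2 1 2) as [kap [Hkap Hch]]; try lra.
(* With the denominator 8k^4 of [cross_2] the common factor is (kap / 8) / k^5. *)
rewrite (mixed_coefficient_scaled 3 2 5 1 2 (kap / 8) k A A1 B B1 C C1 (A2 k) (D k)); try lra.
- revert HA1 HA2 HB HB1 HC HC1 HD; generalize (A1 k) (A2 k) (B k) (B1 k) (C k) (C1 k) (D k).
  clear; intros a1 a2 b b1 c c1 d HA1 HA2 HB HB1 HC HC1 HD.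
  assert (HAA : 2764102 <= a1 ^ 2 <= 2764123) by enclose_mult HA1 HA1.
  assert (HAAA : (-4595535000) <= a1 ^ 3 <= (-4595482000)) by enclose_mult HA1 HAA.
  assert (HDAA : (-11565390000) <= d * a1 ^ 2 <= (-11565160000)) by enclose_mult HD HAA.
  assert (HBC1 : 40885100 <= b * c1 <= 40885330) by enclose_mult HB HC1.
  assert (HCB1 : 24228140 <= c * b1 <= 24228340) by enclose_mult HC HB1.
  assert (HS : 65113240 <= b * c1 + c * b1 <= 65113670) by lra.
  assert (HSA : (-108255800000) <= (b * c1 + c * b1) * a1 <= (-108254600000)) by enclose_mult HS HA1.
  assert (HA2B : 16816180 <= a2 * b <= 16816290) by enclose_mult HA2 HB.
  assert (HABC : (-69316850000) <= a2 * b * c <= (-69316090000)) by enclose_mult HA2B HC.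
  apply quotient_enclosure; lra.
- intros x Hx; destruct (Hch x Hx) as (-> & -> & -> & _).
  destruct (cross_2 x x Hx ltac:(ring)) as (-> & -> & -> & _).
  unfold A, B, C; split; [|split]; field; lra.
- assert (kp : 0 < k) by lra; destruct (Hch k kp) as (_ & _ & _ & ->).
  destruct (cross_2 k k kp ltac:(ring)) as (_ & _ & _ & ->); unfold D; field; lra.
- intros x Hx; unfold A, B, C; split; [|split]; auto_derive; trivial; unfold A1, B1, C1; ring.
- unfold A1, A2; auto_derive; [trivial | ring].
- rewrite <- Hz; unfold A; ring.
Qed.

Theorem theorem3p3 :
  (forall (d : nat) (R1 R2 : R) (l p : nat) (k : R -> R -> R),
    (2 <= d)%nat -> 0 < R1 -> R1 < R2 -> (1 <= p)%nat ->
    (forall alpha1 alpha2 : R, 0 < alpha1 -> 0 < alpha2 ->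
       robin_resonance d l R1 R2 alpha1 alpha2 p (k alpha1 alpha2)) ->
    (* (i) *)
    (forall (kNN : R) (u du : R -> R),
       (l, p) <> (0%nat, 1%nat) ->
       limit_resonance d l R1 R2 Neumann Neumann p kNN ->
       normalised_eigenfunction d l R1 R2 Neumann Neumann (kNN ^ 2) u du ->
       let c1 := R1 ^ (d - 1) * Rabs (u R1) ^ 2 / (2 * kNN) in
       let c2 := R2 ^ (d - 1) * Rabs (u R2) ^ 2 / (2 * kNN) in
       0 < c1 /\ 0 < c2 /\
       is_bigO (filter_prod (at_right 0) (at_right 0))
         (fun '(alpha1, alpha2) =>
            k alpha1 alpha2 - (kNN + c1 * alpha1 + c2 * alpha2))
         (fun '(alpha1, alpha2) =>
            alpha1 ^ 2 + alpha1 * alpha2 + alpha2 ^ 2)) /\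
    (* (ii) *)
    (forall (kND : R) (u du : R -> R),
       limit_resonance d l R1 R2 Neumann Dirichlet p kND ->
       normalised_eigenfunction d l R1 R2 Neumann Dirichlet (kND ^ 2) u du ->
       let d1 := R1 ^ (d - 1) * Rabs (u R1) ^ 2 / (2 * kND) in
       let d2 := - (R2 ^ (d - 1) * Rabs (du R2) ^ 2 / (2 * kND)) in
       0 < d1 /\ d2 < 0 /\
       is_bigO (filter_prod (at_right 0) (Rbar_locally p_infty))
         (fun '(alpha1, alpha2) =>
            k alpha1 alpha2 - (kND + d1 * alpha1 + d2 * / alpha2))
         (fun '(alpha1, alpha2) =>
            alpha1 ^ 2 + alpha1 * / alpha2 + (/ alpha2) ^ 2)) /\
    (* (iii) *)
    (forall (kDN : R) (u du : R -> R),
       limit_resonance d l R1 R2 Dirichlet Neumann p kDN ->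
       normalised_eigenfunction d l R1 R2 Dirichlet Neumann (kDN ^ 2) u du ->
       let e1 := - (R1 ^ (d - 1) * Rabs (du R1) ^ 2 / (2 * kDN)) in
       let e2 := R2 ^ (d - 1) * Rabs (u R2) ^ 2 / (2 * kDN) in
       e1 < 0 /\ 0 < e2 /\
       is_bigO (filter_prod (Rbar_locally p_infty) (at_right 0))
         (fun '(alpha1, alpha2) =>
            k alpha1 alpha2 - (kDN + e1 * / alpha1 + e2 * alpha2))
         (fun '(alpha1, alpha2) =>
            (/ alpha1) ^ 2 + / alpha1 * alpha2 + alpha2 ^ 2)) /\
    (* (iv) *)
    (forall (kDD : R) (u du : R -> R),
       limit_resonance d l R1 R2 Dirichlet Dirichlet p kDD ->
       normalised_eigenfunction d l R1 R2 Dirichlet Dirichlet (kDD ^ 2) u du ->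
       let f1 := - (R1 ^ (d - 1) * Rabs (du R1) ^ 2 / (2 * kDD)) in
       let f2 := - (R2 ^ (d - 1) * Rabs (du R2) ^ 2 / (2 * kDD)) in
       let g := mixed_coefficient d l R1 R2 kDD in
       f1 < 0 /\ f2 < 0 /\
       is_bigO (filter_prod (Rbar_locally p_infty) (Rbar_locally p_infty))
         (fun '(alpha1, alpha2) =>
            let mu1 := / alpha1 in
            let mu2 := / alpha2 in
            k alpha1 alpha2
            - (kDD + f1 * mu1 + f2 * mu2 + g * (mu1 * mu2)))
         (fun '(alpha1, alpha2) =>
            let mu1 := / alpha1 in
            let mu2 := / alpha2 in
            mu1 ^ 2 + mu2 ^ 2))) /\
  (* the mixed coefficient is in general nonzero *)
  (exists (d : nat) (R1 R2 : R) (l p : nat) (kDD : R),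
     (2 <= d)%nat /\ 0 < R1 /\ R1 < R2 /\ (1 <= p)%nat /\
     limit_resonance d l R1 R2 Dirichlet Dirichlet p kDD /\
     mixed_coefficient d l R1 R2 kDD <> 0) /\
  (* d = 3, R1 = 1, R2 = 2, p = 1, to two decimals *)
  (forall kDD : R, limit_resonance 3 0 1 2 Dirichlet Dirichlet 1 kDD ->
     Rabs (mixed_coefficient 3 0 1 2 kDD - 628 / 100) <= 5 / 1000) /\
  (forall kDD : R, limit_resonance 3 1 1 2 Dirichlet Dirichlet 1 kDD ->
     Rabs (mixed_coefficient 3 1 1 2 kDD - 620 / 100) <= 5 / 1000) /\
  (forall kDD : R, limit_resonance 3 2 1 2 Dirichlet Dirichlet 1 kDD ->
     Rabs (mixed_coefficient 3 2 1 2 kDD - 596 / 100) <= 5 / 1000) /\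
  (* d = 3, l = 0, p = 1, every shell *)
  (forall R1 R2 kDD : R, 0 < R1 -> R1 < R2 ->
     limit_resonance 3 0 R1 R2 Dirichlet Dirichlet 1 kDD ->
     mixed_coefficient 3 0 R1 R2 kDD = 2 * PI / (R2 - R1) ^ 3).
Proof.
pose proof PI_bounds.
split; [|split; [|split; [|split; [|split]]]].
- intros d R1 R2 l p k Hd R1p H12 Hp Hk.
  (* Translate [boundary_mass] into the coefficients of the statement; at R1 the trace is - du,
     whose sign disappears in the absolute value. *)
  assert (HN : forall R0 k0 y z, boundary_mass d R0 false y z / (2 * k0) = R0 ^ (d - 1) * Rabs y ^ 2 / (2 * k0)).
  { intros; unfold boundary_mass, side_sign, other_trace; rewrite pow2_abs; unfold Rdiv; ring. }
  assert (HD : forall R0 k0 y z, boundary_mass d R0 true y z / (2 * k0) = - (R0 ^ (d - 1) * Rabs z ^ 2 / (2 * k0))).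
  { intros; unfold boundary_mass, side_sign, other_trace; rewrite pow2_abs; unfold Rdiv; ring. }
  split; [|split; [|split]].
  + intros kNN u du Hlp Hl Hn c1 c2.
    destruct (robin_resonance_expansion d l R1 R2 false false p k kNN u du) as (S1 & S2 & C & C0 & HC); trivial.
    rewrite HN in S1, S2, HC; rewrite HN in HC; fold c1 in S1, HC; fold c2 in S2, HC; simpl in S1, S2.
    split; [lra|]; split; [lra|].
    apply (is_bigO_prod false false C C _ _ _ HC); intros; now apply le_quadratic_form.
  + intros kND u du Hl Hn d1 d2.
    destruct (robin_resonance_expansion d l R1 R2 false true p k kND u du) as (S1 & S2 & C & C0 & HC);
      trivial; [discriminate|].
    rewrite HN in S1, HC; rewrite HD in S2, HC; fold d1 in S1, HC; fold d2 in S2, HC; simpl in S1, S2.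
    split; [lra|]; split; [lra|].
    apply (is_bigO_prod false true C C _ _ _ HC); intros; now apply le_quadratic_form.
  + intros kDN u du Hl Hn e1 e2.
    destruct (robin_resonance_expansion d l R1 R2 true false p k kDN u du) as (S1 & S2 & C & C0 & HC);
      trivial; [discriminate|].
    rewrite HD, Rabs_Ropp in S1, HC; rewrite HN in S2, HC; fold e1 in S1, HC; fold e2 in S2, HC; simpl in S1, S2.
    split; [lra|]; split; [lra|].
    apply (is_bigO_prod true false C C _ _ _ HC); intros; now apply le_quadratic_form.
  + intros kDD u du Hl Hn f1 f2 g.
    destruct (robin_resonance_expansion d l R1 R2 true true p k kDD u du) as (S1 & S2 & C & C0 & HC);
      trivial; [discriminate|].
    rewrite HD in S1, S2, HC; rewrite HD in HC; rewrite Rabs_Ropp in S1, HC.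
    fold f1 in S1, HC; fold f2 in S2, HC; simpl in S1, S2.
    split; [lra|]; split; [lra|].
    (* The term in mu1 mu2 is itself O(mu1^2 + mu2^2). *)
    apply (is_bigO_prod true true C (C + Rabs g) _ _ _ HC); simpl.
    intros alpha1 alpha2 H1 H2 HE; set (m1 := / alpha1) in *; set (m2 := / alpha2) in *.
    replace (k alpha1 alpha2 - (kDD + f1 * m1 + f2 * m2 + g * (m1 * m2))) with
      (k alpha1 alpha2 - (kDD + f1 * m1 + f2 * m2) + - (g * (m1 * m2))) by ring.
    assert (M : 0 < m1 * m2) by now apply Rmult_lt_0_compat.
    pose proof (pow2_ge_0 (m1 - m2)).
    rewrite (Rabs_right (m1 * (m1 * 1) + m2 * (m2 * 1))) by lra.
    eapply Rle_trans; [apply Rabs_triang|].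
    rewrite Rmult_plus_distr_r; apply Rplus_le_compat; [exact HE|].
    rewrite Rabs_Ropp, Rabs_mult, (Rabs_right (m1 * m2)) by lra.
    apply Rmult_le_compat_l; [apply Rabs_pos | lra].
(* In this shell of width 1 the radial resonance is PI, and the closed form gives 2 PI. *)
- assert (Hres : limit_resonance 3 0 1 2 Dirichlet Dirichlet 1 PI).
  { apply dirichlet_resonance_3_0; [lra | lra | field]. }
  exists 3%nat, 1, 2, 0%nat, 1%nat, PI.
  split; [lia|]; split; [lra|]; split; [lra|]; split; [lia|]; split; [exact Hres|].
  rewrite (mixed_coefficient_3_0 1 2 PI ltac:(lra) ltac:(lra) Hres); replace (2 - 1) with 1 by ring.
  rewrite pow1; lra.
- intros kDD Hres; rewrite (mixed_coefficient_3_0 1 2 kDD ltac:(lra) ltac:(lra) Hres).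
  replace (2 - 1) with 1 by ring; rewrite pow1; apply Rabs_le; lra.
- exact mixed_coefficient_3_1.
- exact mixed_coefficient_3_2.
- exact mixed_coefficient_3_0.
Qed.
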